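(* Let $1 < p < \infty$, $0 < \alpha < 1/p$, $\alpha -1/p = -1/r$, $0 < q, u \leq \infty$, $b > 1/q$ and $-\infty < \xi < \infty$. Then $$\mathrm{Lip}^{(\alpha,-b)}_{p,q}(\mathbb{T}) \hookrightarrow L_{r,q}(\log L)_{-b + \xi}(\mathbb{T}) \iff \xi \leq 1/\max\{p,q\},$$ $$\mathrm{Lip}^{(\alpha,-b)}_{p,q}(\mathbb{T}) \hookrightarrow L_{r, u}(\log L)_{-b + 1/q}(\mathbb{T}) \iff u \geq \max\{p,q\}.$$
   Context: $A\hookrightarrow B$ means $A\subset B$ with continuous inclusion; $1/\infty=0$. Lipschitz space on the one-dimensional torus $\mathbb{T}$: for $\alpha>0$, $h\in\mathbb{R}$, $\Delta^\alpha_h f(x)=\sum_{j=0}^\infty(-1)^j\binom{\alpha}{j}f(x+(\alpha-j)h)$, where $\binom{\alpha}{j}=\frac{\alpha(\alpha-1)\cdots(\alpha-j+1)}{j!}$, $\binom{\alpha}{0}=1$, and $\omega_\alpha(f,t)_p=\sup_{|h|\le t}\|\Delta_h^\alpha f\|_{L_p(\mathbb{T})}$, $t>0$. $\mathrm{Lip}^{(\alpha,-b)}_{p,q}(\mathbb{T})$ is the set of $f\in L_p(\mathbb{T})$ with $$\|f\|_{\mathrm{Lip}^{(\alpha,-b)}_{p,q}}=\|f\|_{L_p}+\Big(\int_0^1\big(t^{-\alpha}(1-\log t)^{-b}\omega_\alpha(f,t)_p\big)^q\frac{dt}{t}\Big)^{1/q}<\infty$$ (supremum over $0<t<1$ if $q=\infty$).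 Lorentz--Zygmund space: for $1\le r<\infty$, $0<u\le\infty$, $c\in\mathbb{R}$, $L_{r,u}(\log L)_c(\mathbb{T})$ is the set of measurable $f$ on $\mathbb{T}$ with $$\|f\|_{L_{r,u}(\log L)_c(\mathbb{T})}=\Big(\int_0^1\big(t^{1/r}(1+|\log t|)^cf^*(t)\big)^u\frac{dt}{t}\Big)^{1/u}<\infty$$ (supremum if $u=\infty$), where $f^*$ is the non-increasing rearrangement of $f$. *)

(* Defs.v *)
From HB Require Import structures.
From mathcomp Require Import all_boot all_order all_algebra.
From mathcomp Require Import complex.
From mathcomp Require Import all_classical all_reals all_analysis.
Set Implicit Arguments.
Unset Strict Implicit.
Unset Printing Implicit Defensive.
Import Order.TTheory GRing.Theory Num.Theory.
Import numFieldNormedType.Exports.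

Local Open Scope classical_set_scope.
Local Open Scope ring_scope.

(* The torus is R/Z with total mass 1: a function on it is a 1-periodic
   function f : R -> R[i], integrated over the period [0, 1[. *)
Definition torus_measure (R : realType)
    : {measure set (measurableTypeR R) -> \bar R} :=
  mrestr (@lebesgue_measure R) (measurable_itv `[0, 1[%R).

(* R[i] has no measurable structure in the library, hence the two components. *)
Definition torus_fun (R : realType) (f : R -> R[i]) : Prop :=
  [/\ forall x, f (x + 1) = f x,
      measurable_fun setT (fun x => complex.Re (f x)) &
      measurable_fun setT (fun x => complex.Im (f x))].

Definition cabs (R : realType) (z : R[i]) : R := ComplexField.Normc.normc z.

Definition Lp_norm (R : realType) (p : R) (f : R -> R[i]) : \bar R :=
  Lnorm (torus_measure R) p%:E (fun x => (cabs (f x))%:E).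

Definition gbinom (R : realType) (a : R) (j : nat) : R :=
  (\prod_(0 <= i < j) (a - i%:R)) / (j`!)%:R.

Definition frac_diff_re (R : realType) (a h : R) (g : R -> R) (x : R) : R :=
  limn (series (fun j => (-1) ^+ j * gbinom a j * g (x + (a - j%:R) * h))).

(* The coefficients are real, so the complex series is summed componentwise.
   For a > 0 and f integrable over a period it converges absolutely for almost
   every x; where it diverges the value is an arbitrary default, which only
   affects a null set. *)
Definition frac_diff (R : realType) (a h : R) (f : R -> R[i]) (x : R) : R[i] :=
  Complex (frac_diff_re a h (fun y => complex.Re (f y)) x)
          (frac_diff_re a h (fun y => complex.Im (f y)) x).

Definition modulus (R : realType) (a p : R) (f : R -> R[i]) (t : R) : \bar R :=
  ereal_sup [set Lp_norm p (frac_diff a h f) | h in [set h : R | `|h| <= t]].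

(* The L_q quasi-norm for dt/t on (0, 1), with a genuine supremum at q = +oo;
   the branch -oo is never used. *)
Definition Lq_dtt (R : realType) (q : \bar R) (g : R -> \bar R) : \bar R :=
  match q with
  | s%:E => ((\int[@lebesgue_measure R]_(t in `]0%R, 1%R[)
                (g t `^ s * (t^-1)%:E)) `^ s^-1)%E
  | +oo%E => ereal_sup [set g t | t in `]0, 1[]
  | -oo%E => 0%E
  end.

(* lip_norm p q a b is the norm of Lip^(a, -b)_{p, q}: note the sign of b. *)
Definition lip_norm (R : realType) (p : R) (q : \bar R) (a b : R)
    (f : R -> R[i]) : \bar R :=
  (Lp_norm p f +
   Lq_dtt q (fun t => (t `^ (- a) * (1 - ln t) `^ (- b))%:E * modulus a p f t))%E.

Definition lip_space (R : realType) (p : R) (q : \bar R) (a b : R)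
    : set (R -> R[i]) :=
  [set f | [/\ torus_fun f, (Lp_norm p f < +oo)%E
             & (lip_norm p q a b f < +oo)%E]].

Definition rearrangement (R : realType) (f : R -> R[i]) (t : R) : \bar R :=
  ereal_inf [set s%:E | s in [set s : R | 0 <= s /\
    (torus_measure R [set x : R | (s < cabs (f x))%R] <= t%:E)%E]].

Definition lz_norm (R : realType) (r : R) (u : \bar R) (c : R)
    (f : R -> R[i]) : \bar R :=
  Lq_dtt u (fun t =>
    ((t `^ r^-1 * (1 + `|ln t|) `^ c)%:E * rearrangement f t)%E).

Definition lz_space (R : realType) (r : R) (u : \bar R) (c : R)
    : set (R -> R[i]) :=
  [set f | torus_fun f /\ (lz_norm r u c f < +oo)%E].

(* A `<=` B with the inclusion continuous, for the topologies given by the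
   quasi-norms nA and nB. *)
Definition cont_embed (R : realType) (A : set (R -> R[i]))
    (nA : (R -> R[i]) -> \bar R) (B : set (R -> R[i]))
    (nB : (R -> R[i]) -> \bar R) : Prop :=
  A `<=` B /\
  forall f, A f -> forall e : R, 0 < e -> exists2 d : R, 0 < d &
    forall g, A g ->
      (nA (fun x => (g x - f x)%R) < d%:E)%E ->
      (nB (fun x => (g x - f x)%R) < e%:E)%E.

Definition lip_embeds_lz (R : realType) (p : R) (q : \bar R) (a b r : R)
    (u : \bar R) (c : R) : Prop :=
  cont_embed (lip_space p q a b) (lip_norm p q a b)
             (lz_space r u c) (lz_norm r u c).

(* 1/q for q in ]0, +oo], with 1/+oo = 0. *)
Definition recip (R : realType) (q : \bar R) : R := fine (q^-1)%E.

(* Main.v *)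
Require Import Defs.
From HB Require Import structures.
From mathcomp Require Import all_boot all_order all_algebra.
From mathcomp Require Import complex.
From mathcomp Require Import all_classical all_reals all_analysis.
From mathcomp Require Import measurable_realfun.
From mathcomp Require Import zify ring lra.
Set Implicit Arguments.
Unset Strict Implicit.
Unset Printing Implicit Defensive.
Import Order.TTheory GRing.Theory Num.Theory.
Import numFieldNormedType.Exports.
Local Open Scope classical_set_scope.
Local Open Scope ring_scope.

(** Write omega for the modulus of smoothness of f in L_p and D m for 2^-m. Both
    equivalences rest on one inequality between omega and the rearrangement of f
    at dyadic points, valid for every M with a constant that does not depend on M:
    the sum over m <= M of (D m ^ (1/r) times the rearrangement at D m) ^ p is at
    most C (D M ^ -alpha omega(D M) + |f|_p) ^ p; this is
    [sum_rearrangement_powR_le].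

    It is proved at the single scale h = D M. Up to a damping factor that makes the
    series converge, a function g of period 1 is recovered from its fractional
    difference of step h by convolution with the coefficients of (1 - z)^-alpha,
    which are of size j^(alpha - 1); folded over one period they act like a Riesz
    potential of order alpha truncated at h ([periodic_inversion]). Averaging over
    translations by less than h turns this sum into an integral against a step
    kernel, at the price of the oscillation of g at scale h, which is controlled by
    the first difference and hence by the fractional one ([pint_diff_le], from
    1 - z = (1 - z)^(1 - alpha) (1 - z)^alpha). The bathtub principle bounds the
    potential of each level set of the damped difference ([level_set]), and Schur's test
    adds up the levels ([level_sum_le]).

    For sufficiency, put F m = D m ^ (1/r) times the rearrangement of f at D m and
    Z M = D M ^ -alpha omega(D M) + |f|_p. The inequality says that the l_p norm
    of F 0, ..., F M is at most a constant times Z M. The Lipschitz norm controls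
    the l_q norm of (M + 1)^-b Z M, and the Lorentz-Zygmund norm is controlled by
    the l_u norm of (m + 1)^c F m. What remains is an inequality for
    sequences: the weights are powers, so a term of index m may be averaged over
    the window from m to 2 m, and exchanging the sums brings in the partial l_p
    norms ([weighted_sum_le_large] when u is at least p and q,
    [weighted_sum_le_small] when q < p, where Hoelder's inequality costs the
    exponent 1/q - 1/p).

    For necessity, the test functions are sums of a_k T_k over k < K, where T_k is
    the tent of half-width D k and height D k ^ (-1/r) around the integers. A
    fractional difference of step h, not larger than any of the widths, has L_p
    norm at most C h^alpha (sum of a_k^p)^(1/p) ([pint_fdiff_tsum]), while the
    rearrangement at D (k + 2) is at least a_k D k ^ (-1/r) / 2. So an
    embedding implies an inequality between sequences ([necessity_seq]), which is
    tested on three families. With a_k = (k + 1)^b for k + 1 a power of two, the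
    Lipschitz norm grows at most like K^(1/q) and the term k = K - 1 forces
    xi <= 1/q ([necessity_recip]). With exponent b - 1/q instead, both norms
    become logarithmic, of orders (log K)^(1/q) and (log K)^(1/u), so that q <= u
    ([necessity_recip_log]). With a_k = (k + 1)^b for all k, the Lipschitz norm is
    at most of order K^(1/p + 1/q) and the other one at least of order
    K^(c + b + 1/u), which gives the conditions involving p ([necessity_dense]). *)

(** * Inequalities for real powers *)

Section elementary.
Context {R : realType}.
Implicit Types x y s p : R.

Lemma eq_ler x y : x = y -> x <= y.
Proof. by move->. Qed.

Lemma powR_le_tangent y a : 0 <= y -> 0 <= a -> a <= 1 -> y `^ a <= 1 + a * (y - 1).
Proof.
move=> y0 a0 a1; have [->|an0] := eqVneq a 0; first by rewrite powRr0 mul0r addr0.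
have [->|an1] := eqVneq a 1; first by rewrite powRr1// mul1r; lra.
have ap : 0 < a by rewrite lt_neqAle eq_sym an0.
have a1p : 0 < 1 - a by rewrite subr_gt0 lt_neqAle an1.
have := @conjugate_powR R (y `^ a) 1 (a^-1) ((1 - a)^-1) (powR_ge0 _ _) ler01.
rewrite !invrK !invr_gt0 => /(_ ap a1p); rewrite addrC subrK => /(_ erefl).
rewrite mulr1 -powRrM mulfV// powRr1// powR1 mul1r; lra.
Qed.

Lemma powR_ge_tangent y p : 0 <= y -> 1 <= p -> 1 + p * (y - 1) <= y `^ p.
Proof.
move=> y0 p1; have p0 : 0 < p by lra.
have := @powR_le_tangent (y `^ p) p^-1 (powR_ge0 _ _).
rewrite invr_ge0 (ltW p0) invf_le1// => /(_ isT p1).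
rewrite -powRrM mulfV ?gt_eqF// powRr1// => h.
have := ler_wpM2l (ltW p0) h.
rewrite mulrDr mulrA mulfV ?gt_eqF// mul1r; lra.
Qed.

Lemma powRN_ge_tangent y s : 0 < y -> 0 <= s -> 1 + s * (1 - y) <= y `^ (- s).
Proof.
move=> y0 s0; rewrite /powR gt_eqF//.
apply: le_trans (expR_ge1Dx _); rewrite lerD2l mulNr -mulrN ler_wpM2l//.
have := @le_ln1Dx R (y - 1); rewrite subrKC => h.
rewrite -opprB lerN2; apply: h; lra.
Qed.

(** Jensen's inequality for the power p, for weights of arbitrary total mass;
    it follows from the tangent line at the weighted mean. *)
Lemma powR_sum_le (I : eqType) (r : seq I) (P : pred I) (w y : I -> R) p :
  1 <= p -> (forall i, P i -> 0 <= w i) -> (forall i, P i -> 0 <= y i) ->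
  (\sum_(i <- r | P i) w i * y i) `^ p <=
  (\sum_(i <- r | P i) w i) `^ (p - 1) * \sum_(i <- r | P i) w i * y i `^ p.
Proof.
move=> p1 w0 y0; have p0 : 0 < p by lra.
set W := \sum_(i <- r | P i) w i; set S := \sum_(i <- r | P i) w i * y i.
have S0 : 0 <= S by apply: sumr_ge0 => i Pi; rewrite mulr_ge0 ?w0 ?y0.
have W0 : 0 <= W by apply: sumr_ge0 => i Pi; rewrite w0.
have RHS0 : 0 <= \sum_(i <- r | P i) w i * y i `^ p.
  by apply: sumr_ge0 => i Pi; rewrite mulr_ge0 ?w0 ?powR_ge0.
have [->|Sn0] := eqVneq S 0.
  by rewrite powR0 ?gt_eqF// mulr_ge0 ?powR_ge0.
have Sp : 0 < S by rewrite lt_neqAle eq_sym Sn0.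
have Wp : 0 < W.
  rewrite lt_neqAle eq_sym W0 andbT; apply: contra Sn0 => W00.
  rewrite /S big1_seq// => i /andP[Pi ir].
  have /eqP -> : w i == 0; last by rewrite mul0r.
  move: W00; rewrite /W psumr_eq0// => /allP /(_ _ ir); by rewrite Pi.
pose A := S / W.
have Ap : 0 < A by rewrite divr_gt0.
have WA : W * A = S by rewrite /A mulrC divfK ?gt_eqF.
rewrite -WA powRM ?(ltW Ap)// -[W `^ p]mulr_powRB1// mulrAC [X in X <= _]mulrC.
rewrite ler_wpM2l ?powR_ge0//.
apply: le_trans (_ : \sum_(i <- r | P i) w i * (A `^ p * (1 + p * (y i / A - 1))) <= _).
  rewrite (eq_bigr (fun i => A `^ p * (1 - p) * w i + A `^ p * p / A * (w i * y i))); last first.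
    by move=> i _; field; rewrite gt_eqF.
  rewrite big_split/= -!mulr_sumr -/W -/S -WA.
  rewrite [X in _ <= _ + X](_ : _ = A `^ p * p * W); last by field; rewrite gt_eqF.
  by apply: eq_ler; ring.
apply: ler_sum => i Pi; apply: ler_wpM2l; first exact: w0.
have yE : y i = A * (y i / A) by rewrite mulrCA mulfV ?gt_eqF// mulr1.
rewrite [X in _ <= X `^ _]yE powRM ?(ltW Ap)// ?divr_ge0 ?y0 ?(ltW Ap)//.
rewrite ler_wpM2l ?powR_ge0// powR_ge_tangent// divr_ge0 ?y0 ?(ltW Ap)//.
Qed.

(** The tangent inequality bounds each term by an increment of n^s / s. *)
Lemma sum_powR_le s n : 0 < s -> s <= 1 ->
  \sum_(j < n) j.+1%:R `^ (s - 1) <= s^-1 * n%:R `^ s :> R.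
Proof.
move=> s0 s1; elim: n => [|n IH]; first by rewrite big_ord0 mulr_ge0 ?invr_ge0 ?powR_ge0 // ltW.
rewrite big_ord_recr/=; apply: le_trans (lerD IH (lexx _)) _.
have n1 : 0 < n.+1%:R :> R by rewrite ltr0n.
rewrite -lerBrDl -mulrBr -(ler_pM2l s0) mulrA mulfV ?gt_eqF// mul1r.
have h : (n%:R / n.+1%:R) `^ s <= 1 + s * (n%:R / n.+1%:R - 1).
  by apply: powR_le_tangent => //; rewrite ?divr_ge0// ltW.
have -> : n%:R `^ s = n.+1%:R `^ s * (n%:R / n.+1%:R) `^ s :> R.
  by rewrite -powRM ?divr_ge0// mulrCA mulfV ?mulr1// gt_eqF.
have e : n.+1%:R `^ s = n.+1%:R * n.+1%:R `^ (s - 1) :> R.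
  by rewrite mulr_powRB1.
rewrite -[X in _ <= X - _]mulr1 -mulrBr.
have h' : s * (1 - n%:R / n.+1%:R) <= 1 - (n%:R / n.+1%:R) `^ s.
  by rewrite lerBrDl -lerBrDr -mulrN opprB.
apply: le_trans (ler_wpM2l (powR_ge0 _ _) h').
rewrite e [X in _ <= X](_ : _ = n.+1%:R `^ (s - 1) * s * (n.+1%:R - n%:R)); last first.
  by field; rewrite gt_eqF.
have -> : n.+1%:R - n%:R = 1 :> R by rewrite -natr1; ring.
by rewrite mulr1 mulrC.
Qed.

Lemma sum_powRN_le s (J n : nat) : 0 < s -> (0 < J)%N ->
  \sum_(J <= j < n) j.+1%:R `^ (- s - 1) <= s^-1 * J%:R `^ (- s) :> R.
Proof.
move=> s0 J0.
suff H : forall m, \sum_(J <= j < J + m) j.+1%:R `^ (- s - 1) <= s^-1 * (J%:R `^ (- s) - (J + m)%:R `^ (- s)) :> R.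
  have [nJ|Jn] := leqP n J; first by rewrite big_geq// mulr_ge0 ?invr_ge0 ?powR_ge0 ?ltW.
  rewrite -(subnKC (ltnW Jn)); apply: le_trans (H _) _.
  rewrite ler_wpM2l ?invr_ge0 ?(ltW s0)// lerBlDr lerDl powR_ge0//.
elim=> [|m IH]; first by rewrite addn0 big_geq// subrr mulr0.
rewrite addnS big_nat_recr/= ?leq_addr//; apply: le_trans (lerD IH (lexx _)) _.
rewrite -lerBrDl -mulrBr -(ler_pM2l s0) mulrA mulfV ?gt_eqF// mul1r.
set x := (J + m)%N; have x0 : 0 < x%:R :> R by rewrite ltr0n addn_gt0 J0.
have n1 : 0 < x.+1%:R :> R by rewrite ltr0n.
have h : 1 + s * (1 - x%:R / x.+1%:R) <= (x%:R / x.+1%:R) `^ (- s) :> R.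
  by apply: powRN_ge_tangent; rewrite ?divr_gt0// ltW.
have -> : x%:R `^ (- s) = x.+1%:R `^ (- s) * (x%:R / x.+1%:R) `^ (-s) :> R.
  by rewrite -powRM ?divr_ge0// ?(ltW x0)// mulrCA mulfV ?mulr1// gt_eqF.
have -> : x.+1%:R `^ (- s - 1) = x.+1%:R `^ (- s) / x.+1%:R :> R.
  by rewrite powRB ?powRr1 ?ltW// pnatr_eq0 implybT.
rewrite (_ : _ - _ = x.+1%:R `^ (- s) * ((x%:R / x.+1%:R) `^ (-s) - 1)); last by ring.
rewrite mulrCA ler_wpM2l ?powR_ge0//.
have -> : s / x.+1%:R = s * (1 - x%:R / x.+1%:R).
  by rewrite -natr1; field; rewrite natr1 gt_eqF.
by rewrite lerBrDl.
Qed.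

Lemma powRN_le (x y s : R) : 0 < x -> x <= y -> s <= 0 -> y `^ s <= x `^ s.
Proof.
move=> x0 xy s0; rewrite -(opprK s) !(powRN _ (- s)) lef_pV2 ?posrE ?powR_gt0//; last exact: lt_le_trans xy.
by apply: ge0_ler_powR; rewrite ?oppr_ge0 ?nnegrE// ltW// (lt_le_trans x0).
Qed.

Lemma powRD_pos (x s t : R) : 0 < x -> x `^ (s + t) = x `^ s * x `^ t.
Proof. by move=> x0; rewrite powRD// (gt_eqF x0) implybT. Qed.

Lemma powR_add_le x y p : 0 <= p -> 0 <= x -> 0 <= y -> (x + y) `^ p <= 2 `^ p * (x `^ p + y `^ p).
Proof.
move=> p0; wlog xy : x y / x <= y.
  move=> H x0 y0; have [/H|/ltW/H] := leP x y; first exact.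
  by rewrite addrC [y `^ p + _]addrC; exact.
move=> x0 y0; apply: (@le_trans _ _ ((2 * y) `^ p)).
  by apply: ge0_ler_powR; rewrite ?nnegrE ?mulr_ge0 ?addr_ge0// mulr_natl mulr2n lerD2r.
by rewrite powRM// ler_wpM2l ?powR_ge0// lerDr powR_ge0.
Qed.

(** The two terms are what remains of x below and above the threshold s; the
    second one is of use when an integral of x^p is known. *)
Lemma le_powR_chebyshev p s x : 1 <= p -> 0 < s -> 0 <= x -> x <= s + s `^ (1 - p) * x `^ p.
Proof.
move=> p1 s0 x0; have [h|h] := leP x s; first by rewrite ler_wpDr// mulr_ge0 ?powR_ge0.
apply: le_trans (_ : s `^ (1 - p) * x `^ p <= _); last by rewrite lerDr ltW.
have xp : 0 < x by exact: lt_trans h.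
rewrite -[X in X <= _](powRr1 x0) -[X in x `^ X](subrK p 1) powRD_pos// ler_wpM2r ?powR_ge0//.
rewrite -[1 - p]opprB !powRN lef_pV2 ?posrE ?powR_gt0//.
by apply: ge0_ler_powR; rewrite ?nnegrE ?subr_ge0// ltW.
Qed.

End elementary.

(** * Binomial coefficients and products of power series *)

(** The coefficient of z^j in (1 - z)^x. It is locked because unfolding it
    exposes a product over a variable range. *)
HB.lock Definition binc (R : realType) (x : R) (j : nat) : R := (-1) ^+ j * gbinom x j.
Canonical locked_binc := Unlockable binc.unlock.

Section coefficients.
Context {R : realType}.
Implicit Types x y : R.

Lemma binc0 x : binc x 0 = 1.
Proof. by rewrite unlock /gbinom big_geq// fact0 divr1 expr0 mulr1. Qed.

Lemma bincS x j : binc x j.+1 = binc x j * (j%:R - x) / j.+1%:R.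
Proof.
rewrite unlock /gbinom big_nat_recr//= factS natrM exprS.
have : j`!%:R != 0 :> R by rewrite pnatr_eq0 -lt0n fact_gt0.
have : j.+1%:R != 0 :> R by rewrite pnatr_eq0.
move: (j.+1%:R : R) (j`!%:R : R) => c d c0 d0.
by field; rewrite c0 d0.
Qed.

Lemma bincS_eq x j : j.+1%:R * binc x j.+1 = (j%:R - x) * binc x j.
Proof. by rewrite bincS; field; rewrite addrC natr1 pnatr_eq0. Qed.

(** (1 - z)^x (1 - z)^y = (1 - z)^(x + y); both sides satisfy the recurrence
    [bincS_eq]. *)
Lemma binc_vandermonde x y n :
  \sum_(i < n.+1) binc x i * binc y (n - i) = binc (x + y) n.
Proof.
elim: n => [|n IH]; first by rewrite big_ord_recl big_ord0 subnn !binc0 mulr1 addr0.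
have n1 : n.+1%:R != 0 :> R by rewrite pnatr_eq0.
apply: (mulfI n1); rewrite bincS_eq -IH.
pose F i : R := binc x i * binc y (n.+1 - i).
have -> : n.+1%:R * (\sum_(i < n.+2) F i) =
   \sum_(i < n.+2) i%:R * F i + \sum_(i < n.+2) (n.+1 - i)%:R * F i.
  rewrite mulr_sumr -big_split/=; apply: eq_bigr => i _.
  by rewrite -mulrDl -natrD subnKC// -ltnS.
rewrite big_ord_recl mul0r add0r [X in _ + X]big_ord_recr/= subnn mul0r addr0.
rewrite -big_split mulr_sumr /=; apply: eq_bigr => i _.
rewrite /F /bump /= add1n subSS.
have -> : (n.+1 - i = (n - i).+1)%N by rewrite subSn// -ltnS.
rewrite mulrA bincS_eq [X in _ + X]mulrCA bincS_eq.
have -> : n%:R = i%:R + (n - i)%:R :> R by rewrite -natrD subnKC// -ltnS.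
by ring.
Qed.

Lemma binc_zero j : binc (0 : R) j = (j == 0)%N%:R.
Proof.
case: j => [|j]; first by rewrite binc0.
elim: j => [|j IH]; first by rewrite bincS subr0 mulr0 mul0r.
by rewrite bincS IH !mul0r.
Qed.

Lemma binc_one j : binc (1 : R) j = (j == 0)%N%:R - (j == 1)%N%:R.
Proof.
case: j => [|j]; first by rewrite binc0 subr0.
elim: j => [|[|j] IH]; first by rewrite bincS binc0 mul1r divr1.
  by rewrite bincS subrr mulr0 mul0r subr0.
by rewrite bincS IH/= subrr !mul0r.
Qed.

Lemma binc_m1 j : binc (-1 : R) j = 1.
Proof.
elim: j => [|j IH]; first by rewrite binc0.
by rewrite bincS IH opprK natr1 mul1r divff// pnatr_eq0.
Qed.

(** Summation is multiplication by (1 - z)^-1, whose coefficients are 1. *)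
Lemma sum_binc x n : \sum_(i < n.+1) binc x i = binc (x - 1) n.
Proof.
rewrite -binc_vandermonde; apply: eq_bigr => i _.
by rewrite binc_m1 mulr1.
Qed.

(** By induction with the sharper quantity x^(1 - x) (j + x)^(x - 1), for which
    the induction step is the tangent inequality. *)
Lemma bincN_bounds x j : 0 < x -> x <= 1 -> 0 <= binc (- x) j <= j.+1%:R `^ (x - 1).
Proof.
move=> x0 x1.
have H : 0 <= binc (- x) j <= x `^ (1 - x) * (j%:R + x) `^ (x - 1).
  elim: j => [|j /andP[h0 IH]].
    rewrite binc0 ler01 add0r -powRD; last by rewrite (gt_eqF x0) implybT.
    by rewrite subrKA subrr powRr0 lexx.
  rewrite bincS opprK; apply/andP; split.
    by rewrite divr_ge0// mulr_ge0// addr_ge0// ltW.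
  have jx : 0 < j%:R + x by rewrite ltr_wpDl.
  have jx1 : 0 < j.+1%:R + x by rewrite ltr_wpDl.
  apply: le_trans (_ : x `^ (1 - x) * (j%:R + x) `^ (x - 1) * ((j%:R + x) / j.+1%:R) <= _).
    by rewrite -mulrA ler_wpM2r// divr_ge0// ltW.
  rewrite -mulrA ler_wpM2l ?powR_ge0//.
  rewrite mulrC -ler_pdivlMr ?powR_gt0//.
  have -> : (j.+1%:R + x) `^ (x - 1) / (j%:R + x) `^ (x - 1) = ((j.+1%:R + x) / (j%:R + x)) `^ (x - 1).
    rewrite powRM ?invr_ge0 ?(ltW jx) ?(ltW jx1)//.
    by rewrite -(powR_inv1 (ltW jx)) -powRrM mulN1r powRN.
  set z := _ / (_ + x).
  have z0 : 0 < z by rewrite divr_gt0.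
  have := @powR_le_tangent R z (1 - x) (ltW z0).
  rewrite subr_ge0 x1 => /(_ isT); rewrite gerBl (ltW x0) => /(_ isT) h.
  rewrite -opprB powRN.
  rewrite -[leLHS]invrK lef_pV2 ?posrE ?powR_gt0 ?invr_gt0 ?mulr_gt0 ?invr_gt0 ?ltr0n//.
  apply: le_trans h _; rewrite /z -natr1 le_eqVlt; apply/orP; left; apply/eqP.
  by field; rewrite (gt_eqF jx) natr1 pnatr_eq0.
case/andP: H => -> /= h; apply: le_trans h _.
have xj : 0 < x * j.+1%:R by rewrite mulr_gt0 ?ltr0n.
apply: le_trans (_ : x `^ (1 - x) * (x * j.+1%:R) `^ (x - 1) <= _).
  rewrite ler_wpM2l ?powR_ge0// -opprB !powRN lef_pV2 ?posrE ?powR_gt0//.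
    apply: ge0_ler_powR; rewrite ?nnegrE ?subr_ge0//; first exact: ltW.
      by rewrite addr_ge0// ltW.
    by rewrite -natr1 mulrDr mulr1 lerD2r ler_piMl.
  by rewrite ltr_wpDl.
rewrite powRM ?(ltW x0)// mulrA -powRD; last by rewrite (gt_eqF x0) implybT.
by rewrite subrKA subrr powRr0 mul1r.
Qed.

(** Nonpositivity from index 1 on, and the decay j^(-x - 1), which makes
    the series of coefficients absolutely convergent. *)
Lemma binc_bounds x j : 0 < x -> x <= 1 ->
  - (j.+1%:R `^ (- x - 1)) <= binc x j.+1 <= 0.
Proof.
move=> x0 x1.
suff H : - (x * j.+1%:R `^ (- x - 1)) <= binc x j.+1 <= 0.
  case/andP: H => h ->; rewrite andbT; apply: le_trans _ h.
  by rewrite lerN2 ler_piMl// powR_ge0.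
elim: j => [|j /andP[IH h0]].
  rewrite bincS binc0 mul1r sub0r divr1 powR1 mulr1 lexx/=; lra.
have jx : 0 <= j.+1%:R - x by rewrite subr_ge0 (le_trans x1)// ler1n.
rewrite bincS; apply/andP; split; last first.
  by rewrite mulr_le0_ge0 ?invr_ge0// mulr_le0_ge0.
rewrite lerNl -[X in X <= _]mulNr -(mulNr (binc _ _) (_ - _)); move: IH; rewrite lerNl => IH.
apply: le_trans (_ : x * j.+1%:R `^ (- x - 1) * ((j.+1%:R - x) / j.+2%:R) <= _).
  by rewrite -[X in X <= _]mulrA ler_wpM2r// divr_ge0.
rewrite -mulrA ler_wpM2l ?(ltW x0)//.
have j1 : 0 < j.+1%:R :> R by rewrite ltr0n.
have j2 : 0 < j.+2%:R :> R by rewrite ltr0n.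
have -> : j.+1%:R `^ (- x - 1) = j.+2%:R `^ (- x - 1) * (j.+1%:R / j.+2%:R) `^ (- x - 1) :> R.
  by rewrite -powRM ?divr_ge0// mulrCA divff ?mulr1// gt_eqF.
rewrite -mulrA ler_piMr ?powR_ge0//.
have z0 : 0 < j.+1%:R / j.+2%:R :> R by rewrite divr_gt0.
have x1' : 1 <= 1 + x by lra.
have h := powR_ge_tangent (ltW z0) x1'.
rewrite (_ : - x - 1 = - (1 + x)) ?powRN; last by ring.
rewrite ler_pdivrMl ?powR_gt0// mulr1; apply: le_trans h.
rewrite le_eqVlt; apply/orP; left; apply/eqP.
rewrite -[j.+2%:R]natr1; move: (j.+1%:R : R) j1 => c c0.
by field; rewrite gt_eqF//; lra.
Qed.

Lemma norm_binc_le x j : 0 < x -> x <= 1 -> `|binc x j.+1| <= j.+1%:R `^ (- x - 1).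
Proof.
by move=> x0 x1; have /andP[h1 h2] := binc_bounds j x0 x1; rewrite ler0_norm// lerNl.
Qed.

Lemma sum_norm_binc_le x n : 0 < x -> x <= 1 -> \sum_(j < n) `|binc x j| <= 2 + x^-1.
Proof.
move=> x0 x1; case: n => [|[|n]]; first by rewrite big_ord0 addr_ge0// invr_ge0 ltW.
  by rewrite big_ord1 binc0 normr1; have := invr_ge0 x; rewrite (ltW x0); lra.
rewrite 2!big_ord_recl/= binc0 normr1 addrA lerD//.
  rewrite lerD2l; apply: le_trans (norm_binc_le _ x0 x1) _.
  by rewrite powR1.
rewrite (eq_bigr (fun i : 'I_n => `|binc x i.+2|)); last by move=> i _; rewrite /bump.
apply: le_trans (_ : \sum_(1 <= j < n.+1) j.+1%:R `^ (- x - 1) <= _).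
  rewrite big_add1/= big_mkord; apply: ler_sum => i _; exact: norm_binc_le.
by apply: le_trans (sum_powRN_le _ x0 _) _ => //; rewrite powR1 mulr1.
Qed.

Lemma sum_tail_binc_le x J n : 0 < x -> x <= 1 -> (0 < J)%N ->
  \sum_(J <= j < n) `|binc x j.+1| <= x^-1 * J%:R `^ (- x).
Proof.
move=> x0 x1 J0; apply: le_trans (sum_powRN_le _ x0 J0).
by apply: ler_sum => j _; exact: norm_binc_le.
Qed.

End coefficients.

Section convolution.
Context {R : realType}.

Lemma sum_triangle (F : nat -> nat -> R) M :
  \sum_(n < M) \sum_(i < n.+1) F i (n - i)%N = \sum_(i < M) \sum_(j < M - i) F i j.
Proof.
elim: M => [|M IH]; first by rewrite !big_ord0.
rewrite big_ord_recr/= IH [in RHS]big_ord_recr/= subSnn big_ord1.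
rewrite big_ord_recr/= subnn addrA; congr (_ + _).
rewrite -big_split/=; apply: eq_bigr => i _.
have -> : (M.+1 - i = (M - i).+1)%N by rewrite subSn// ltnW.
by rewrite big_ord_recr.
Qed.

(** The pairs with i < M that lie beyond the diagonal i + j = M - 1 lie on later
    diagonals. *)
Lemma sum_corner_le (F : nat -> nat -> R) M L : (forall i j, 0 <= F i j) ->
  \sum_(i < M) \sum_(M - i <= j < L) F i j <=
  \sum_(M <= n < M + L) \sum_(i < n.+1) F i (n - i)%N.
Proof.
move=> F0.
apply: le_trans (_ : \sum_(M <= n < M + L) \sum_(i < M) F i (n - i)%N <= _); last first.
  rewrite !big_seq; apply: ler_sum => n; rewrite mem_index_iota => /andP[Mn _].
  rewrite (big_ord_widen_cond n.+1 xpredT (fun i => F i (n - i)%N)) ?leqW//.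
  rewrite [leRHS](bigID (fun i : 'I_n.+1 => (i < M)%N))/= lerDl.
  exact: sumr_ge0.
rewrite exchange_big/=; apply: ler_sum => i _.
have [LM|ML] := leqP L (M - i); first by rewrite big_geq// sumr_ge0.
have -> : \sum_(M - i <= j < L) F i j = \sum_(M <= n < L + i) F i (n - i)%N.
  transitivity (\sum_(M - i + i <= n < L + i) F i (n - i)%N).
    by rewrite big_addn addnK; apply: eq_bigr => j _; rewrite addnK.
  by rewrite subnK// ltnW.
have h : (M <= L + i)%N by rewrite addnC -leq_subLR ltnW.
have h2 : (L + i <= M + L)%N by rewrite addnC leq_add2r ltnW.
rewrite [leRHS](@big_cat_nat _ _ _ (L + i))//= lerDl.
exact: sumr_ge0.
Qed.

Lemma is_cvg_series_abs_bound (f : nat -> R) B :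
  (forall n, \sum_(j < n) `|f j| <= B) -> cvgn (series f).
Proof.
move=> hB; apply: normed_cvg.
have E : [normed series f] = series (fun j => `|f j|) by [].
rewrite E; apply: nondecreasing_is_cvgn.
  by apply/nondecreasing_seqP => n; rewrite seriesSr lerDl.
by exists B => _ [n _ <-]; rewrite seriesEord; exact: hB.
Qed.

Lemma lim_series_abs_bound (f : nat -> R) B :
  (forall n, \sum_(j < n) `|f j| <= B) -> `|limn (series f)| <= B.
Proof.
move=> hB; have cf := is_cvg_series_abs_bound hB.
rewrite -lim_norm//; apply: limr_le; first exact: is_cvg_norm.
near=> n; rewrite seriesEord; apply: le_trans (ler_norm_sum _ _ _) (hB _).
Unshelve. all: by end_near. Qed.

(** If u and v have a finitely supported product d as power series, then formally
    the combination of the b_n with coefficients d_n is the combination of the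
    inner series, sum over j of v_j b_(i+j), with coefficients u_i. The absolute
    bound B justifies the rearrangement; only the partial sums of the outer series
    enter the conclusion, so that the inner series may diverge where u_i = 0. *)
Lemma convolution_le (u v d b : nat -> R) (K B : R) (n0 : nat) :
  (forall n, \sum_(i < n.+1) u i * v (n - i)%N = d n) ->
  (forall n, (n0 <= n)%N -> d n = 0) ->
  (forall L, \sum_(n < L) (\sum_(i < n.+1) `|u i| * `|v (n - i)%N|) * `|b n| <= B) ->
  (forall M, \sum_(i < M) `|u i| * `|limn (series (fun j => v j * b (i + j)%N))| <= K) ->
  `|\sum_(n < n0) d n * b n| <= K.
Proof.
move=> uvd dn0 hB hK.
pose T n := (\sum_(i < n.+1) `|u i| * `|v (n - i)%N|) * `|b n|.
have T0 n : 0 <= T n by rewrite mulr_ge0// sumr_ge0// => i _; rewrite mulr_ge0.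
have cT : cvgn (series T).
  apply: nondecreasing_is_cvgn.
    apply/nondecreasing_seqP => n; rewrite seriesSr lerDl; exact: T0.
  by exists B => _ [n _ <-]; rewrite seriesEord; exact: hB.
have tail0 : forall e, 0 < e -> exists M, (n0 <= M)%N /\ forall L, \sum_(M <= n < M + L) T n <= e.
  move=> e e0; have /cvgrPdist_le/(_ e e0)[N _ hN] := cT.
  exists (maxn N n0); rewrite leq_maxr; split=> // L.
  set M := maxn N n0.
  have := hN M (leq_maxl _ _); rewrite /= => h.
  rewrite -sub_series_geq ?leq_addr//; apply: le_trans _ h.
  apply: le_trans (ler_norm _); rewrite lerB//.
  apply: nondecreasing_cvgn_le => //.
  by apply/nondecreasing_seqP => n; rewrite seriesSr lerDl; exact: T0.
apply/ler_addgt0Pr => e e0; have [M [n0M hM]] := tail0 _ e0.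
(* if u_i = 0, the inner series may diverge, but then it is multiplied by 0 *)
have cv i : u i != 0 -> cvgn (series (fun j => v j * b (i + j)%N)).
  move=> ui0; apply: (is_cvg_series_abs_bound (B := `|u i|^-1 * B)) => n.
  rewrite ler_pdivlMl ?normr_gt0// mulr_sumr.
  apply: le_trans (hB (i + n)%N); rewrite big_split_ord/=.
  apply: ler_wpDl; first by apply: sumr_ge0 => j _; exact: T0.
  apply: ler_sum => j _; rewrite normrM mulrA ler_wpM2r//.
  have hi : (i < (i + j).+1)%N by rewrite ltnS leq_addr.
  rewrite (bigD1 (Ordinal hi))//= addKn lerDl.
  by apply: sumr_ge0 => k _; rewrite mulr_ge0.
have lim_term i : (fun L => \sum_(j < L) u i * (v j * b (i + j)%N)) @ \oo -->
    u i * limn (series (fun j => v j * b (i + j)%N)).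
  have [->|ui0] := eqVneq (u i) 0.
    rewrite mul0r (_ : (fun L => _) = cst 0); first exact: cvg_cst.
    by apply/funext => L; rewrite big1// => j _; rewrite mul0r.
  rewrite (_ : (fun L => _) = (fun L => u i * series (fun j => v j * b (i + j)%N) L)).
    by apply: cvgMr => //; exact: cv.
  by apply/funext => L; rewrite seriesEord/= mulr_sumr.
have lim_sum : (fun L => \sum_(i < M) \sum_(j < L) u i * (v j * b (i + j)%N)) @ \oo -->
    \sum_(i < M) u i * limn (series (fun j => v j * b (i + j)%N)).
  elim: (M) => [|m IH].
    rewrite big_ord0 (_ : (fun L => _) = cst 0); first exact: cvg_cst.
    by apply/funext => L; rewrite big_ord0.
  rewrite big_ord_recr/= (_ : (fun L => _) = (fun L => \sum_(i < m) \sum_(j < L) u i * (v j * b (i + j)%N)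
     + \sum_(j < L) u m * (v j * b (m + j)%N))); first by apply: cvgD.
  by apply/funext => L; rewrite big_ord_recr.
set D := \sum_(n < n0) d n * b n.
(* since d vanishes from n0 on, D is the sum over the triangle i + j < M; the rest of the
   rectangle of the partial sums lies in the tail bounded by hM *)
have DE : D = \sum_(i < M) \sum_(j < M - i) u i * (v j * b (i + j)%N).
  rewrite /D (big_ord_widen _ (fun n => d n * b n) n0M) big_mkcond/=.
  rewrite -(sum_triangle (fun i j => u i * (v j * b (i + j)%N))); apply: eq_bigr => n _.
  case: ltnP => [_|h]; last first.
    transitivity (d n * b n); first by rewrite dn0// mul0r.
    rewrite -uvd mulr_suml; apply: eq_bigr => i _.
    by rewrite subnKC ?mulrA// -ltnS.
  rewrite -uvd mulr_suml; apply: eq_bigr => i _.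
  by rewrite subnKC ?mulrA// -ltnS.
have near_le L : (M <= L)%N -> `|D - \sum_(i < M) \sum_(j < L) u i * (v j * b (i + j)%N)| <= e.
  move=> ML; rewrite DE -sumrB.
  apply: le_trans (hM L); apply: le_trans (ler_norm_sum _ _ _) _.
  pose F i j := `|u i| * `|v j| * `|b (i + j)%N|.
  have F0 i j : 0 <= F i j by rewrite !mulr_ge0.
  have -> : \sum_(M <= n < M + L) T n = \sum_(M <= n < M + L) \sum_(i < n.+1) F i (n - i)%N.
    rewrite !big_seq; apply: eq_bigr => n _; rewrite /T mulr_suml.
    by apply: eq_bigr => i _; rewrite /F subnKC// -ltnS.
  apply: le_trans (sum_corner_le M L F0).
  apply: ler_sum => i _.
  have h : (M - i <= L)%N by apply: leq_trans ML; rewrite leq_subr.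
  rewrite -!(big_mkord xpredT (fun j => u i * (v j * b (i + j)%N))).
  rewrite (@big_cat_nat _ _ _ (M - i)%N 0 L)//= opprD addrA subrr sub0r normrN.
  apply: le_trans (ler_norm_sum _ _ _) _.
  by apply: ler_sum => j _; rewrite !normrM mulrA.
have := hK M; set S := \sum_(i < M) u i * _ in lim_sum *.
have : `|S| <= \sum_(i < M) `|u i| * `|limn (series (fun j => v j * b (i + j)%N))|.
  apply: le_trans (ler_norm_sum _ _ _) _.
  by apply: ler_sum => i _; rewrite normrM.
move=> h1 h2.
have h3 : `|D - S| <= e.
  have hc : (fun L => `|D - \sum_(i < M) \sum_(j < L) u i * (v j * b (i + j)%N)|) @ \oo --> `|D - S|.
    by apply: cvg_norm; apply: cvgB => //; exact: cvg_cst.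
  rewrite -(cvg_lim _ hc)//; apply: limr_le; first by apply/cvg_ex; eexists; exact: hc.
  by exists M => // L /= ML; exact: near_le.
rewrite -[D](subrK S) addrC; apply: le_trans (ler_normD _ _) _.
by apply: lerD => //; exact: le_trans h1 h2.
Qed.

End convolution.

(** * Recovering a periodic sequence from its fractional difference *)

Section periodic_inversion.
Context {R : realType}.
Implicit Types (al : R) (N : nat).

(** The damping factor. Its N-th power is 1/2, so a damped series of a sequence
    of period N is comparable with a sum over one period. *)
Definition hroot N : R := 2 `^ (- (N%:R)^-1).

Lemma hroot_gt0 N : 0 < hroot N. Proof. by rewrite powR_gt0. Qed.

Lemma hrootX N j : hroot N ^+ j = 2 `^ (- (j%:R / N%:R)).
Proof. by rewrite -powR_mulrn ?powR_ge0// -powRrM mulNr mulrC. Qed.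

Lemma hroot_lt1 N : (0 < N)%N -> hroot N < 1.
Proof.
move=> N0; rewrite /hroot powRN invf_lt1 ?powR_gt0//.
have H : (1 : R) `^ N%:R^-1 < 2 `^ N%:R^-1.
  apply: gt0_ltr_powR; rewrite ?nnegrE ?invr_gt0 ?ltr0n//; lra.
by rewrite powR1 in H.
Qed.

Lemma hrootXN N : (0 < N)%N -> hroot N ^+ N = 2^-1.
Proof. by move=> N0; rewrite hrootX divff ?pnatr_eq0 -?lt0n// powR_inv1. Qed.

Lemma hrootX_ge N j : 1 - j%:R / N%:R <= hroot N ^+ j.
Proof.
rewrite hrootX; have := @powRN_ge_tangent R 2 (j%:R / N%:R).
by rewrite divr_ge0// => /(_ _ isT) H; apply: le_trans (H _) => //; lra.
Qed.

Lemma sum_geo_le (q : R) n : 0 <= q -> q < 1 -> \sum_(i < n) q ^+ i <= (1 - q)^-1.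
Proof.
move=> q0 q1; have h : 0 < 1 - q by rewrite subr_gt0.
rewrite -(ler_pM2l h) mulfV ?gt_eqF//.
have -> : (1 - q) * \sum_(i < n) q ^+ i = 1 - q ^+ n.
  rewrite -opprB mulNr -subrX1; lra.
by rewrite gerBl exprn_ge0.
Qed.

Lemma sum_mul_ord (N M : nat) (F : nat -> R) :
  \sum_(i < M * N) F i = \sum_(m < M) \sum_(k < N) F (m * N + k)%N.
Proof.
elim: M => [|M IH]; first by rewrite mul0n !big_ord0.
by rewrite big_ord_recr/= -IH mulSn addnC big_split_ord.
Qed.

(** The coefficients of (1 - q z)^al and (1 - q z)^(-al), where q is the damping
    factor, are inverse to each other, and the latter are positive and at most
    (j + 1)^(al - 1) q^j. Folding them over the period N gives a geometric series of
    ratio 1/2, hence the factor 2. *)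
Lemma periodic_inversion al N (b : nat -> R) : 0 < al -> al < 1 -> (0 < N)%N ->
  (forall n, b (n + N)%N = b n) ->
  `|b 0%N| <= 2 * \sum_(k < N) k.+1%:R `^ (al - 1) *
    `|limn (series (fun j => binc al j * hroot N ^+ j * b (k + j)%N))|.
Proof.
move=> al0 al1 N0 bN.
have q0 := hroot_gt0 N; have q1 := hroot_lt1 N0.
set q := hroot N in q0 q1 *.
have bM m k : b (k + m * N)%N = b k.
  by elim: m => [|m IH]; rewrite ?mul0n ?addn0// mulSn addnCA addnC bN.
pose Bb : R := \sum_(k < N) `|b k|.
have bB n : `|b n| <= Bb.
  rewrite (divn_eq n N) addnC bM /Bb (bigD1 (Ordinal (ltn_pmod n N0)))//= lerDl.
  exact: sumr_ge0.
pose u j := binc (- al) j * q ^+ j; pose v j := binc al j * q ^+ j.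
pose d (n : nat) : R := (n == 0)%N%:R.
have -> : b 0%N = \sum_(n < 1) d n * b n.
  by rewrite big_ord1 /d eqxx mul1r.
apply: (@convolution_le R u v d b _ ((1 - q)^-1 * ((2 + al^-1) * Bb))).
- move=> n; rewrite /d -binc_zero -[X in binc X](addNr al) -binc_vandermonde.
  have [->|n0] := eqVneq n 0%N.
    by rewrite !big_ord1 /u /v subnn !expr0 !mulr1.
  transitivity (q ^+ n * \sum_(i < n.+1) binc (- al) i * binc al (n - i)).
    rewrite mulr_sumr; apply: eq_bigr => i _.
    have -> : q ^+ n = q ^+ i * q ^+ (n - i) by rewrite -exprD subnKC// -ltnS.
    by rewrite /u /v mulrACA mulrC.
  by rewrite binc_vandermonde addNr binc_zero (negbTE n0) mulr0.
- by case.
- move=> L; apply: le_trans (_ : \sum_(n < L) q ^+ n * ((2 + al^-1) * Bb) <= _); last first.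
    rewrite -mulr_suml ler_wpM2r ?sum_geo_le// ?(ltW q0)// mulr_ge0//.
      by rewrite addr_ge0// invr_ge0 ltW.
    exact: sumr_ge0.
  apply: ler_sum => n _; rewrite mulrA ler_pM//.
    by apply: sumr_ge0 => i _; rewrite mulr_ge0.
  apply: le_trans (_ : \sum_(i < n.+1) q ^+ n * `|binc al (n - i)%N| <= _).
    apply: ler_sum => i _; rewrite /u /v !normrM.
    have -> : q ^+ n = q ^+ i * q ^+ (n - i) by rewrite -exprD subnKC// -ltnS.
    rewrite !(ger0_norm (exprn_ge0 _ (ltW q0))) mulrACA [leRHS]mulrC.
    rewrite ler_wpM2r ?mulr_ge0 ?exprn_ge0 ?(ltW q0)// ler_piMl//.
    have /andP[h0 h] := bincN_bounds i al0 (ltW al1).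
    rewrite ger0_norm//; apply: le_trans h _.
    by rewrite -[leRHS](powRr0 i.+1%:R); apply: ler_powR; rewrite ?ler1n//; lra.
  rewrite -mulr_sumr ler_pM2l ?exprn_gt0//.
  apply: le_trans (sum_norm_binc_le n.+1 al0 (ltW al1)).
  rewrite (reindex_inj rev_ord_inj)/=; apply: ler_sum => i _.
  by rewrite subSS subKn// -ltnS.
- move=> M; pose g k := limn (series (fun j => v j * b (k + j)%N)).
  have gM m k : g (m * N + k)%N = g k.
    rewrite /g; congr (limn (series _)); apply/funext => j.
    by rewrite [(m * N + k)%N]addnC -addnA [(m * N + j)%N]addnC addnA bM.
  apply: le_trans (_ : \sum_(i < M * N) `|u i| * `|g i| <= _).
    rewrite (big_ord_widen _ (fun i => `|u i| * `|g i|) (leq_pmulr M N0)) big_mkcond/=.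
    by apply: ler_sum => i _; case: ifP => // _; rewrite mulr_ge0.
  rewrite (sum_mul_ord N M (fun i => `|u i| * `|g i|)).
  apply: le_trans (_ : \sum_(m < M) 2^-1 ^+ m * \sum_(k < N) k.+1%:R `^ (al - 1) * `|g k| <= _).
    apply: ler_sum => m _; rewrite mulr_sumr; apply: ler_sum => k _.
    rewrite gM mulrA ler_wpM2r// /u normrM.
    have /andP[c0 c1] := bincN_bounds (m * N + k) al0 (ltW al1).
    rewrite mulnC in c0 c1 *.
    rewrite !ger0_norm ?exprn_ge0 ?(ltW q0)// mulrC exprD exprM hrootXN// -mulrA.
    rewrite ler_pM2l ?exprn_gt0 ?invr_gt0//.
    rewrite -[leRHS]mul1r ler_pM ?exprn_ge0 ?(ltW q0)//.
      by rewrite exprn_ile1// ltW.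
    apply: le_trans c1 _; apply: powRN_le; rewrite ?ltr0n//; last by lra.
    by rewrite ler_nat ltnS leq_addl.
  rewrite -mulr_suml ler_wpM2r//.
    by apply: sumr_ge0 => k _; rewrite mulr_ge0 ?powR_ge0.
  apply: le_trans (sum_geo_le M _ _) _; [by rewrite invr_ge0| by lra|].
  have e2 : 1 - 2^-1 = 2^-1 :> R by lra.
  by rewrite e2 invrK.
Qed.

(** Undoing the damping costs N^-al, because 1 - q^j is at most j/N for j up to N
    and at most 1 beyond. *)
Lemma sum_binc_hroot_le al N n : 0 < al -> al < 1 -> (0 < N)%N ->
  \sum_(j < n) `|binc al j * (1 - hroot N ^+ j)| <= (al^-1 + (1 - al)^-1) * N%:R `^ (- al).
Proof.
move=> al0 al1 N0.
have N0' : 0 < N%:R :> R by rewrite ltr0n.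
have q0 := hroot_gt0 N; have q1 := hroot_lt1 N0.
have qj j : 0 <= 1 - hroot N ^+ j <= 1.
  by rewrite subr_ge0 exprn_ile1 ?(ltW q0) ?(ltW q1)//= gerBl exprn_ge0 ?ltW.
apply: le_trans (_ : \sum_(j < n + N.+1) `|binc al j * (1 - hroot N ^+ j)| <= _).
  by rewrite big_split_ord/= lerDl sumr_ge0.
rewrite addnS big_ord_recl/= expr0 subrr mulr0 normr0 add0r.
rewrite -(big_mkord xpredT (fun j => `|binc al (bump 0 j) * (1 - hroot N ^+ (bump 0 j))|)).
rewrite (@big_cat_nat _ _ _ N)//= ?leq_addl// addrC mulrDl lerD//.
  apply: le_trans (sum_tail_binc_le (n + N)%N al0 (ltW al1) N0).
  apply: ler_sum => j _; rewrite normrM [`|1 - _|]ger0_norm//; last by have /andP[] := qj (bump 0 j).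
  by rewrite ler_piMr//; have /andP[] := qj (bump 0 j).
have -> : (1 - al)^-1 * N%:R `^ (- al) = N%:R^-1 * ((1 - al)^-1 * N%:R `^ (1 - al)).
  rewrite mulrCA; congr (_ * _); rewrite addrC powRD ?pnatr_eq0 -?lt0n ?N0 ?implybT//.
  by rewrite powRr1 ?ltW// mulrCA mulVf ?mulr1// gt_eqF.
rewrite big_mkord.
have al1' : 0 < 1 - al by lra.
have al1'' : 1 - al <= 1 by lra.
apply: le_trans (ler_wpM2l _ (sum_powR_le N al1' al1'')); last by rewrite invr_ge0.
rewrite mulr_sumr; apply: ler_sum => j _; rewrite normrM [`|1 - _|]ger0_norm; last by have /andP[] := qj (bump 0 j).
rewrite mulrC; apply: le_trans (_ : j.+1%:R / N%:R * j.+1%:R `^ (- al - 1) <= _).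
  rewrite ler_pM//; first by have /andP[] := qj (bump 0 j).
    by rewrite lerBlDr addrC -lerBlDr hrootX_ge.
  have -> : bump 0 j = j.+1 by [].
  by apply: norm_binc_le => //; exact: ltW.
rewrite mulrAC mulrC ler_pM2l ?invr_gt0//.
by rewrite (_ : 1 - al - 1 = 1 + (- al - 1)) ?powRD_pos ?powRr1 ?ltr0n//; ring.
Qed.

End periodic_inversion.

(** * Integration on the torus *)

Section integral_tools.
Local Open Scope ereal_scope.
Context d (T : measurableType d) (R : realType).
Variable mu : {measure set T -> \bar R}.

(** The integral of a nonnegative function is a supremum over simple functions
    below it, so no measurability is needed. In particular, integrands built from the
    modulus of smoothness can be compared without knowing that it is measurable. *)
Lemma le_integral_ge0 (D : set T) (f g : T -> \bar R) :
  (forall x, D x -> 0 <= f x) -> (forall x, D x -> f x <= g x) ->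
  \int[mu]_(x in D) f x <= \int[mu]_(x in D) g x.
Proof.
move=> f0 fg.
have g0 x : D x -> 0 <= g x by move=> Dx; exact: le_trans (f0 _ Dx) (fg _ Dx).
rewrite !ge0_integralE//; apply: ereal_sup_le => _ /= [h hf <-]; exists h => //.
move=> x; apply: le_trans (hf x) _; rewrite /patch; case: ifPn => //.
by rewrite inE => Dx; exact: fg.
Qed.

End integral_tools.

Section torus.
Context {R : realType}.
Local Notation mu := (@lebesgue_measure R).
Local Notation tm := (@torus_measure R).
Implicit Types (c : R) (F : R -> \bar R).

Lemma measurable_shift c : measurable_fun setT (fun x : R => x + c).
Proof. by apply: measurable_funD. Qed.

Lemma measurable_opp_shift c : measurable_fun setT (fun x : R => c - x).
Proof. by apply: measurable_funB. Qed.

Lemma lebesgue_measure_shift c (A : set R) : measurable A ->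
  pushforward mu ((fun x => x + c) : _ -> measurableTypeR R) A = mu A.
Proof.
move=> mA; apply/esym.
have mf : measurable_fun setT ((fun x => x + c) : measurableTypeR R -> measurableTypeR R) by exact: measurable_shift.
pose phi : {mfun measurableTypeR R >-> measurableTypeR R} :=
  HB.pack (fun x : R => x + c) (isMeasurableFun.Build _ _ _ _ _ mf).
apply: (@lebesgue_measure_unique R (pushforward mu phi)) => // _ [[a b]] _ <-.
rewrite -[RHS]/(mu ((fun x : R => x + c) @^-1` `]a, b]%classic)).
have -> : (fun x : R => x + c) @^-1` `]a, b]%classic = `](a - c)%R, (b - c)%R]%classic.
  by apply/seteqP; split => x /=; rewrite !in_itv/= ltrBlDr lerBrDr.
rewrite !lebesgue_measure_itv/= !lte_fin ltrD2r.
by case: ifP => // _; rewrite -!EFinB; congr EFin; ring.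
Qed.

Local Open Scope ereal_scope.

Lemma ge0_lebesgue_shift c (D : set R) F : measurable D -> measurable_fun D F ->
  (forall x, 0 <= F x) ->
  \int[mu]_(x in (fun x : R => (x + c)%R) @^-1` D) F (x + c)%R = \int[mu]_(x in D) F x.
Proof.
move=> mD mF F0.
have mf : measurable_fun setT ((fun x => (x + c)%R) : measurableTypeR R -> measurableTypeR R) by exact: measurable_shift.
rewrite -(@ge0_integral_pushforward _ _ (measurableTypeR R) (measurableTypeR R) R _ mf mu D F)//.
by apply: eq_measure_integral => A mA _; exact: lebesgue_measure_shift.
Qed.

Lemma ge0_lebesgue_opp (D : set R) F : measurable D -> measurable_fun D F ->
  (forall x, 0 <= F x) ->
  \int[mu]_(x in (fun x : R => (- x)%R) @^-1` D) F (- x)%R = \int[mu]_(x in D) F x.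
Proof.
move=> mD mF F0.
have mf : measurable_fun setT ((fun x => (- x)%R) : measurableTypeR R -> measurableTypeR R) by exact: oppr_measurable.
rewrite -(@ge0_integral_pushforward _ _ (measurableTypeR R) (measurableTypeR R) R _ mf mu D F)//.
by apply: eq_measure_integral => A mA _; exact: lebesgue_measureN.
Qed.

Lemma torus_measureE (A : set R) : tm A = mu (A `&` `[0%R, 1%R[).
Proof. by []. Qed.

Lemma torus_measureT : tm setT = 1.
Proof. by rewrite torus_measureE setTI lebesgue_measure_itv/= lte_fin ltr01 sube0. Qed.

Lemma torus_fin_num : fin_num_fun tm.
Proof.
move=> A mA; rewrite ge0_fin_numE//; apply: (@le_lt_trans _ _ (tm setT)).
  by apply: le_measure; rewrite ?inE.
by rewrite torus_measureT ltry.
Qed.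

Lemma torus_integralE F : measurable_fun setT F -> (forall x, 0 <= F x) ->
  \int[tm]_x F x = \int[mu]_(x in `[0%R, 1%R[) F x.
Proof.
move=> mF F0.
have mI : measurable (`[0%R : R, 1%R[%classic : set (measurableTypeR R)) by [].
rewrite (@ge0_negligible_integral _ (measurableTypeR R) R tm setT _ _ (measurableC mI))//; last first.
  by rewrite -[LHS]/(mu (~` `[0%R, 1%R[ `&` `[0%R, 1%R[)) setICl measure0.
rewrite setDE setCK setTI; apply: eq_measure_integral => A mA AI.
by rewrite -[LHS]/(mu (A `&` `[0%R, 1%R[)) setIidl.
Qed.

Lemma periodic_int F : (forall x, F (x + 1)%R = F x) -> forall (n : int) x, F (x + n%:~R)%R = F x.
Proof.
move=> per.
have H (n : nat) x : F (x + n%:R)%R = F x.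
  elim: n x => [|n IH] x; first by rewrite addr0.
  by rewrite -natr1 addrA per IH.
case=> n x; first exact: H.
by rewrite NegzE mulrNz -[in RHS](subrK n.+1%:R%R x) H.
Qed.

(** It suffices to translate by c in [0, 1[; the part of the period that leaves
    [0, 1[ comes back at the other end. *)
Lemma torus_shift c F : measurable_fun setT F -> (forall x, 0 <= F x) ->
  (forall x, F (x + 1)%R = F x) -> \int[tm]_x F (x + c)%R = \int[tm]_x F x.
Proof.
move=> mF F0 per.
have mFc c' : measurable_fun setT (fun x : R => F (x + c')%R).
  by apply: (measurableT_comp mF); exact: measurable_shift.
wlog /andP[c0 c1] : c / (0 <= c < 1)%R.
  move=> H; rewrite -[RHS](H (c - (Num.floor c)%:~R)%R); last first.
    by rewrite subr_ge0 floor_le_tmp/= ltrBlDl -intrD1 floorD1_gt.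
  apply: eq_integral => x _.
  by rewrite -[RHS](periodic_int per (Num.floor c)); congr F; ring.
rewrite !torus_integralE//.
have e1 : `[0%R, 1%R[%classic = (fun x : R => (x + c)%R) @^-1` `[c, (1 + c)%R[%classic.
  by apply/seteqP; split => x /=; rewrite !in_itv/= ltrD2r lerDr.
rewrite [in LHS]e1 ge0_lebesgue_shift//; last exact: measurable_funS mF.
have e2 : `[c, (1 + c)%R[%classic = `[c, 1%R[ `|` `[1%R, (1 + c)%R[ :> set R.
  by rewrite -itv_bndbnd_setU// bnd_simp; lra.
have e3 : `[0%R, 1%R[%classic = `[0%R, c[ `|` `[c, 1%R[ :> set R.
  by rewrite -itv_bndbnd_setU// bnd_simp; lra.
rewrite e2 e3 !ge0_integral_setU//; first last.
- rewrite disj_set2E; apply/eqP/seteqP; split => x //= [].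
  by rewrite !in_itv/= => /andP[_ h1] /andP[h2 _]; move: (lt_le_trans h1 h2); rewrite ltxx.
- exact: measurable_funS mF.
- rewrite disj_set2E; apply/eqP/seteqP; split => x //= [].
  by rewrite !in_itv/= => /andP[_ h1] /andP[h2 _]; move: (lt_le_trans h1 h2); rewrite ltxx.
- exact: measurable_funS mF.
rewrite addeC; congr (_ + _).
have e4 : `[0%R, c[%classic = (fun x : R => (x + 1)%R) @^-1` `[1%R, (1 + c)%R[%classic.
  by apply/seteqP; split => x /=; rewrite !in_itv/= (addrC x) ltrD2l lerDl.
rewrite [in RHS]e4.
under [in RHS]eq_integral do rewrite -per.
by rewrite ge0_lebesgue_shift//; exact: measurable_funS mF.
Qed.

Lemma torus_opp F : measurable_fun setT F -> (forall x, 0 <= F x) ->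
  (forall x, F (x + 1)%R = F x) -> \int[tm]_x F (- x)%R = \int[tm]_x F x.
Proof.
move=> mF F0 per.
have mFc : measurable_fun setT (fun x : R => F (- x)%R).
  by apply: (measurableT_comp mF); exact: oppr_measurable.
rewrite -[RHS](torus_shift (-1)%R)// !torus_integralE//; last first.
  by apply: (measurableT_comp mF); exact: measurable_shift.
have e1 : `[0%R, 1%R[%classic = (fun x : R => (- x)%R) @^-1` `](-1)%R, 0%R]%classic.
  by apply/seteqP; split => x /=; rewrite !in_itv/= oppr_le0 ltrN2 andbC.
rewrite [in LHS]e1 ge0_lebesgue_opp//; last exact: measurable_funS mF.
rewrite -[RHS]/(\int[mu]_(x in `[0%R, 1%R[) F (x + (- 1))%R).
have e2 : `[0%R, 1%R[%classic = (fun x : R => (x + (- 1))%R) @^-1` `[(-1)%R, 0%R[%classic.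
  by apply/seteqP; split => x /=; rewrite !in_itv/= subr_lt0 lerBrDr addNr.
rewrite [in RHS]e2 ge0_lebesgue_shift//; last exact: measurable_funS mF.
transitivity (\int[mu]_(x in `](-1)%R, 0%R[) F x).
  by apply/esym/integral_itv_bndo_bndc; exact: measurable_funS mF.
by apply: integral_itv_obnd_cbnd; exact: measurable_funS mF.
Qed.

Lemma torus_reflect c F : measurable_fun setT F -> (forall x, 0 <= F x) ->
  (forall x, F (x + 1)%R = F x) -> \int[tm]_x F (c - x)%R = \int[tm]_x F x.
Proof.
move=> mF F0 per; rewrite -[RHS](torus_shift c)//.
have mFc : measurable_fun setT (fun x : R => F (x + c)%R).
  by apply: (measurableT_comp mF); exact: measurable_shift.
rewrite -[RHS](torus_opp mFc)//.
  by apply: eq_integral => x _; rewrite addrC.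
by move=> x; rewrite addrAC per.
Qed.

End torus.

(** * Integrals of p-th powers and series of translates *)

Section measurable_limits.
Context d (T : measurableType d) (R : realType).

(** The sequence converges exactly where its lower and upper limits agree and are
    finite, and the limit takes a fixed default value elsewhere. *)
Lemma measurable_limn (u : nat -> T -> R) : (forall n, measurable_fun setT (u n)) ->
  measurable_fun setT (fun x => limn (fun n => u n x)).
Proof.
move=> mu.
pose S x := limn_esup (fun n => (u n x)%:E); pose I x := limn_einf (fun n => (u n x)%:E).
have mS : measurable_fun setT S.
  by apply: measurable_fun_limn_esup => n; exact/measurable_EFinP.
have mI : measurable_fun setT I.
  rewrite (_ : I = (fun x => - limn_esup (fun n => (- u n x)%:E))%E).
    apply: measurableT_comp => //; apply: measurable_fun_limn_esup => n.
    by apply/measurable_EFinP; exact: measurableT_comp.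
  apply/funext => x; rewrite /I -[X in limn_einf X]/(fun n => (u n x)%:E).
  by rewrite -limn_einfN; congr limn_einf; apply/funext => n /=; rewrite opprK.
pose c x := (S x == I x) && (S x \is a fin_num).
have cP x : c x -> (fun n => u n x) @ \oo --> fine (S x).
  move=> /andP[/eqP SI fS]; suff H : (fun n => (u n x)%:E) @ \oo --> (fine (S x))%:E by exact: (fine_cvg H).
  rewrite fineK//.
  apply: (@squeeze_cvge _ _ _ _ (einfs (fun n => (u n x)%:E)) _ (esups (fun n => (u n x)%:E))).
  - near=> n; apply/andP; split.
      by apply: ereal_inf_lbound; exists n => /=.
    by apply: ereal_sup_ubound; exists n => /=.
  - rewrite SI /I limn_einf_lim; exact: is_cvg_einfs.
  - rewrite /S limn_esup_lim; exact: is_cvg_esups.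
have nP x : ~~ c x -> limn (fun n => u n x) = point.
  move=> nc; apply: dvgP => cu; move/negP: nc; apply.
  have : (fun n => (u n x)%:E) @ \oo --> (limn (fun n => u n x))%:E.
    by apply: cvg_EFin; [exact: nearW|exact: cu].
  by move=> /cvg_limn_einf_sup[e1 e2]; rewrite /c /S /I e1 e2 eqxx.
rewrite (_ : (fun x => _) = (fun x => if c x then fine (S x) else point)).
  apply: measurable_fun_ifT => //; last exact: (measurableT_comp (@fine_measurable R setT measurableT)).
  apply: measurable_and; last first.
    apply: (measurable_fun_bool true) => //.
    rewrite (_ : _ @^-1` _ = setT `&` [set x | S x \is a fin_num]); last first.
      by rewrite setTI; apply/seteqP; split => x /=.
    by rewrite setTI; exact: emeasurable_fin_num.
  apply: (measurable_fun_bool true) => //.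
  rewrite (_ : _ @^-1` _ = setT `&` [set x | S x = I x]); last first.
    by rewrite setTI; apply/seteqP; split => x /= /eqP.
  rewrite setTI; exact: measurable_eqe.
apply/funext => x; case: ifPn => real_cx; last exact: nP.
by apply/cvg_lim => //; exact: cP.
Unshelve. all: by end_near. Qed.

End measurable_limits.

Lemma nd_lim_ge (R : realType) (u : (\bar R)^nat) n :
  {homo u : n m / (n <= m)%N >-> (n <= m)%E} -> (u n <= limn u)%E.
Proof.
move=> nd; rewrite (cvg_lim _ (ereal_nondecreasing_cvgn nd))//.
by apply: ereal_sup_ubound; exists n.
Qed.

Section pint.
Context {R : realType}.
Local Notation tm := (@torus_measure R).
Implicit Types (p c : R) (f g : R -> R).
Local Open Scope ereal_scope.

Global Instance torus_ae_filter : Filter (nbhs (almost_everywhere tm)).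
Proof. exact: ae_filter_ringOfSetsType. Qed.

Definition pint p g : \bar R := \int[tm]_x (`|g x| `^ p)%:E.

Definition per (T : Type) (g : R -> T) := forall x, g (x + 1)%R = g x.

Lemma pint_ge0 p g : 0 <= pint p g.
Proof. by apply: integral_ge0 => x _; rewrite lee_fin powR_ge0. Qed.

Lemma measurable_pow p g : measurable_fun setT g ->
  measurable_fun setT (fun x => (`|g x| `^ p)%:E).
Proof.
move=> mg; apply/measurable_EFinP; apply: (measurableT_comp (measurable_powR p)).
exact: measurableT_comp.
Qed.

Lemma pint_le p f g : (0 <= p)%R -> (forall x, `|f x| <= `|g x|)%R -> pint p f <= pint p g.
Proof.
move=> p0 fg; apply: le_integral_ge0 => x _; rewrite lee_fin ?powR_ge0//.
by apply: ge0_ler_powR; rewrite ?nnegrE.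
Qed.

Lemma pint_shift p g c : measurable_fun setT g -> per g ->
  pint p (fun x => g (x + c)%R) = pint p g.
Proof.
move=> mg pg; rewrite /pint (torus_shift c (F := fun x => (`|g x| `^ p)%:E))//.
- exact: measurable_pow.
- by move=> x; rewrite pg.
Qed.

Lemma pint_add p f g : (0 <= p)%R -> measurable_fun setT f -> measurable_fun setT g ->
  pint p (fun x => f x + g x)%R <= (2 `^ p)%:E * (pint p f + pint p g).
Proof.
move=> p0 mf mg; rewrite -ge0_integralD//; do ?[exact: measurable_pow].
rewrite -ge0_integralZl//; do ?[by rewrite lee_fin powR_ge0]; last first.
- by move=> x _; rewrite -EFinD lee_fin addr_ge0 ?powR_ge0.
- by apply: emeasurable_funD; exact: measurable_pow.
apply: le_integral_ge0 => x _; first by rewrite lee_fin powR_ge0.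
rewrite -EFinD -EFinM lee_fin.
apply: le_trans (powR_add_le p0 (normr_ge0 _) (normr_ge0 _)).
by apply: ge0_ler_powR; rewrite ?nnegrE// ler_normD.
Qed.

(** Jensen's inequality with weights |th j|: a sum of total weight A multiplies
    the L_p bound by A. Working with integrals of p-th powers avoids
    roots in the extended reals. *)
Lemma pint_sum_le p (th : nat -> R) (F : nat -> R -> R) (A X : R) n : (1 <= p)%R ->
  (forall j, measurable_fun setT (F j)) -> (forall j, pint p (F j) <= X%:E) -> (0 <= X)%R ->
  (forall n, \sum_(j < n) `|th j| <= A)%R ->
  \int[tm]_x ((\sum_(j < n) `|th j| * `|F j x|) `^ p)%:E <= (A `^ p * X)%:E.
Proof.
move=> p1 mF hX X0 hA.
set W := (\sum_(j < n) `|th j|)%R.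
have W0 : (0 <= W)%R by exact: sumr_ge0.
apply: (@le_trans _ _ (\int[tm]_x ((W `^ (p - 1))%:E * \sum_(j < n) (`|th j|%:E * (`|F j x| `^ p)%:E)))).
  apply: le_integral_ge0 => x _; first by rewrite lee_fin powR_ge0.
  rewrite (eq_bigr (fun j : 'I_n => (`|th j| * `|F j x| `^ p)%:E))//.
  rewrite sumEFin -EFinM lee_fin; exact: powR_sum_le.
have mt j : measurable_fun setT (fun x : R => `|th j|%:E * (`|F j x| `^ p)%:E).
  by apply: emeasurable_funM => //; exact: measurable_pow.
rewrite ge0_integralZl//; last 3 first.
- by apply: emeasurable_sum => j; exact: mt.
- by move=> x _; apply: sume_ge0 => j _; rewrite mule_ge0// lee_fin powR_ge0.
- by rewrite lee_fin powR_ge0.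
rewrite ge0_integral_sum//; last by move=> j; exact: mt.
apply: (@le_trans _ _ ((W `^ (p - 1))%:E * \sum_(j < n) (`|th j|%:E * X%:E))).
  rewrite lee_wpmul2l ?lee_fin ?powR_ge0//; apply: lee_sum => j _.
  rewrite ge0_integralZl//; last first.
  - exact: measurable_pow.
  by apply: lee_wpmul2l => //; exact: hX.
rewrite (eq_bigr (fun j : 'I_n => (`|th j| * X)%:E))//.
rewrite sumEFin -EFinM lee_fin -mulr_suml mulrA [(_ * W)%R]mulrC.
rewrite mulr_powRB1//; last by lra.
rewrite ler_wpM2r//; apply: ge0_ler_powR; rewrite ?nnegrE//; first by lra.
  exact: le_trans (hA n).
exact: hA.
Qed.

(** Here G only has to be dominated by the series of absolute values, and only
    almost everywhere: the bound then passes to G by monotone convergence. It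
    applies to functions that are not literally sums of the series. *)
Lemma pint_series_ae p (th : nat -> R) (F : nat -> R -> R) (A X : R) (G : R -> R) : (1 <= p)%R ->
  (forall j, measurable_fun setT (F j)) -> (forall j, pint p (F j) <= X%:E) -> (0 <= X)%R ->
  (forall n, \sum_(j < n) `|th j| <= A)%R ->
  measurable_fun setT G ->
  {ae tm, forall x, forall K : R, (forall n, \sum_(j < n) `|th j| * `|F j x| <= K)%R -> (`|G x| <= K)%R} ->
  pint p G <= (A `^ p * X)%:E.
Proof.
move=> p1 mF hX X0 hA mG hG; have p0 : (0 < p)%R by lra.
pose S n (x : R) : R := (\sum_(j < n) `|th j| * `|F j x|)%R.
have S0 n x : (0 <= S n x)%R by apply: sumr_ge0 => j _; rewrite mulr_ge0.
have ndS x : {homo S ^~ x : n m / (n <= m)%N >-> (n <= m)%R}.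
  by apply/nondecreasing_seqP => n; rewrite /S big_ord_recr/= lerDl mulr_ge0.
have mS n : measurable_fun setT (fun x => (S n x `^ p)%:E).
  apply/measurable_EFinP; apply: (measurableT_comp (measurable_powR p)).
  by apply: measurable_sum => j; apply: measurable_funM => //; exact: measurableT_comp.
have ndSp x : {homo (fun n => (S n x `^ p)%:E) : n m / (n <= m)%N >-> (n <= m)}.
  by move=> n m nm; rewrite lee_fin; apply: ge0_ler_powR; rewrite ?nnegrE ?S0 ?(ltW p0)//; exact: ndS.
have cvS x : cvgn (fun n => (S n x `^ p)%:E) by exact: ereal_nondecreasing_is_cvgn.
apply: (@le_trans _ _ (\int[tm]_x limn (fun n => (S n x `^ p)%:E))); last first.
  rewrite monotone_convergence//.
    apply: lime_le; last by apply: nearW => n; exact: pint_sum_le.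
    apply: ereal_nondecreasing_is_cvgn => n m nm; apply: le_integral_ge0 => x _.
      by rewrite lee_fin powR_ge0.
    exact: ndSp.
  by move=> n x _; rewrite lee_fin powR_ge0.
apply: ae_ge0_le_integral => //.
- exact: measurable_pow.
- by move=> x _; apply: lime_ge => //; apply: nearW => n; rewrite lee_fin powR_ge0.
- apply: (emeasurable_fun_cvg (fun n x => (S n x `^ p)%:E)) => // x _; exact: cvS.
- apply: filterS hG => x Hx _.
  have := leey (limn (fun n => (S n x `^ p)%:E)); rewrite le_eqVlt => /predU1P[->|fin]; first exact: leey.
  have lb n : (S n x `^ p)%:E <= limn (fun n => (S n x `^ p)%:E) by apply: (nd_lim_ge (u := fun n => (S n x `^ p)%:E)).
  have fn : limn (fun n => (S n x `^ p)%:E) \is a fin_num.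
    by rewrite ge0_fin_numE//; apply: le_trans (lb 0%N); rewrite lee_fin powR_ge0.
  rewrite -(fineK fn) lee_fin; set s := fine _.
  have s0 : (0 <= s)%R by rewrite -lee_fin fineK//; apply: le_trans (lb 0%N); rewrite lee_fin powR_ge0.
  have H : (`|G x| <= s `^ p^-1)%R.
    apply: Hx => n; rewrite -[leLHS](@powRr1 _ (S n x))// -(@mulfV _ p) ?gt_eqF// powRrM.
    apply: ge0_ler_powR; rewrite ?nnegrE ?powR_ge0 ?invr_ge0 ?(ltW p0)//.
    by rewrite -lee_fin /s fineK.
  rewrite -[leRHS]powRr1// -(@mulVf _ p) ?gt_eqF// powRrM.
  by apply: ge0_ler_powR; rewrite ?nnegrE ?powR_ge0 ?(ltW p0).
Qed.

Lemma pint_series p (th : nat -> R) (F : nat -> R -> R) (A X : R) : (1 <= p)%R ->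
  (forall j, measurable_fun setT (F j)) -> (forall j, pint p (F j) <= X%:E) -> (0 <= X)%R ->
  (forall n, \sum_(j < n) `|th j| <= A)%R ->
  pint p (fun x => limn (series (fun j => th j * F j x)%R)) <= (A `^ p * X)%:E.
Proof.
move=> p1 mF hX X0 hA; apply: (pint_series_ae p1 mF hX X0 hA).
  apply: measurable_limn => n; rewrite /series/=.
  by apply: measurable_sum => j; exact: measurable_funM.
apply: nearW => x K HK; apply: lim_series_abs_bound => n.
by under eq_bigr do rewrite normrM; exact: HK.
Qed.

(** The limit of the partial sums of absolute values is integrable to the power
    p, hence finite almost everywhere. *)
Lemma ae_series_bound p (th : nat -> R) (F : nat -> R -> R) (A X : R) : (1 <= p)%R ->
  (forall j, measurable_fun setT (F j)) -> (forall j, pint p (F j) <= X%:E) -> (0 <= X)%R ->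
  (forall n, \sum_(j < n) `|th j| <= A)%R ->
  {ae tm, forall x, exists B : R, forall n, (\sum_(j < n) `|th j| * `|F j x| <= B)%R}.
Proof.
move=> p1 mF hX X0 hA; have p0 : (0 < p)%R by lra.
pose S n (x : R) : R := (\sum_(j < n) `|th j| * `|F j x|)%R.
have S0 n x : (0 <= S n x)%R by apply: sumr_ge0 => j _; rewrite mulr_ge0.
have ndS x : {homo S ^~ x : n m / (n <= m)%N >-> (n <= m)%R}.
  by apply/nondecreasing_seqP => n; rewrite /S big_ord_recr/= lerDl mulr_ge0.
have mS n : measurable_fun setT (fun x => (S n x `^ p)%:E).
  apply/measurable_EFinP; apply: (measurableT_comp (measurable_powR p)).
  by apply: measurable_sum => j; apply: measurable_funM => //; exact: measurableT_comp.
have ndSp x : {homo (fun n => (S n x `^ p)%:E) : n m / (n <= m)%N >-> (n <= m)}.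
  by move=> n m nm; rewrite lee_fin; apply: ge0_ler_powR; rewrite ?nnegrE ?S0 ?(ltW p0)//; exact: ndS.
have cvS x : cvgn (fun n => (S n x `^ p)%:E) by exact: ereal_nondecreasing_is_cvgn.
have L0 x : 0 <= limn (fun n => (S n x `^ p)%:E).
  by apply: lime_ge => //; apply: nearW => n; rewrite lee_fin powR_ge0.
have int : tm.-integrable setT (fun x => limn (fun n => (S n x `^ p)%:E)).
  apply/integrableP; split.
    apply: (emeasurable_fun_cvg (fun n x => (S n x `^ p)%:E)) => // x _; exact: cvS.
  under eq_integral do rewrite gee0_abs//.
  apply: (@le_lt_trans _ _ (A `^ p * X)%:E); last exact: ltry.
  rewrite monotone_convergence//.
    apply: lime_le; last by apply: nearW => n; exact: pint_sum_le.
    apply: ereal_nondecreasing_is_cvgn => n m nm; apply: le_integral_ge0 => x _.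
      by rewrite lee_fin powR_ge0.
    exact: ndSp.
  by move=> n x _; rewrite lee_fin powR_ge0.
apply: filterS (integrable_ae measurableT int) => x /(_ I) fn.
exists ((fine (limn (fun n => (S n x `^ p)%:E))) `^ p^-1)%R => n.
rewrite -[leLHS](@powRr1 _ (S n x))// -(@mulfV _ p) ?gt_eqF// powRrM.
apply: ge0_ler_powR; rewrite ?nnegrE ?powR_ge0 ?invr_ge0 ?(ltW p0) ?fine_ge0//.
by rewrite -lee_fin fineK//; apply: (nd_lim_ge (u := fun n => (S n x `^ p)%:E)).
Qed.

End pint.

(** * Fractional and first differences *)

Section fractional_differences.
Context {R : realType}.
Local Notation tm := (@torus_measure R).
Implicit Types (p al y : R) (g : R -> R).

(** The fractional difference without the translation by al * y, which does not
    change the norms. *)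
Definition fdiff al y g (x : R) : R :=
  limn (series (fun j => binc al j * g (x - j%:R * y))).

Lemma frac_diff_reE al y g x : frac_diff_re al y g x = fdiff al y g (x + al * y).
Proof.
rewrite /frac_diff_re /fdiff; congr (limn (series _)); apply/funext => j.
by rewrite unlock; congr (_ * g _); ring.
Qed.

Lemma per_fdiff al y g : per g -> per (fdiff al y g).
Proof.
move=> pg x; rewrite /fdiff; congr (limn (series _)); apply/funext => j.
by rewrite addrAC pg.
Qed.

Lemma measurable_comp_shift g (c : R) : measurable_fun setT g -> measurable_fun setT (fun x : R => g (x + c)).
Proof. by move=> mg; apply: (measurableT_comp mg); exact: measurable_shift. Qed.

Lemma measurable_fdiff al y g : measurable_fun setT g -> measurable_fun setT (fdiff al y g).
Proof.
move=> mg; apply: measurable_limn => n; rewrite /series/=.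
apply: measurable_sum => j; apply: measurable_funM => //.
exact: (measurable_comp_shift (- (j%:R * y))).
Qed.

Lemma pint_frac_diff_re p al y g : measurable_fun setT g -> per g ->
  pint p (frac_diff_re al y g) = pint p (fdiff al y g).
Proof.
move=> mg pg; rewrite -(pint_shift p (al * y) (measurable_fdiff al y mg) (per_fdiff al y pg)).
by congr (pint p _); apply/funext => x; rewrite frac_diff_reE.
Qed.

Lemma pint_fdiff_le p al y g X : 1 <= p -> 0 < al -> al <= 1 -> 0 <= X ->
  measurable_fun setT g -> per g -> (pint p g <= X%:E)%E ->
  (pint p (fdiff al y g) <= ((2 + al^-1) `^ p * X)%:E)%E.
Proof.
move=> p1 al0 al1 X0 mg pg hX.
have mF j : measurable_fun setT (fun x : R => g (x - j%:R * y)) by exact: measurable_comp_shift.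
have hF j : (pint p (fun x => g (x - j%:R * y)%R) <= X%:E)%E by rewrite pint_shift.
have hA n : \sum_(j < n) `|binc al j| <= 2 + al^-1 by exact: sum_norm_binc_le.
exact: (@pint_series R p (binc al) (fun j x => g (x - j%:R * y)) _ X p1 mF hF X0 hA).
Qed.

(** The first difference is the fractional difference of order 1 - al of the
    fractional difference of order al, and the coefficients of (1 - z)^(1 - al) are
    absolutely summable. The composition of the two series is legitimate at
    almost every point, where the double series converges absolutely. *)
Lemma pint_diff_le p al y g X V : 1 <= p -> 0 < al -> al < 1 -> 0 <= X ->
  measurable_fun setT g -> per g -> (pint p g <= V%:E)%E ->
  (pint p (fdiff al y g) <= X%:E)%E ->
  (pint p (fun x => g x - g (x - y))%R <= ((2 + (1 - al)^-1) `^ p * X)%:E)%E.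
Proof.
move=> p1 al0 al1 X0 mg pg hV hX.
have V0 : 0 <= V by rewrite -lee_fin; apply: le_trans hV; exact: pint_ge0.
have al1' : 0 < 1 - al by lra.
have al1'' : 1 - al <= 1 by lra.
have mF j : measurable_fun setT (fun x : R => g (x - j%:R * y)) by exact: measurable_comp_shift.
have mD j : measurable_fun setT (fun x : R => fdiff al y g (x - j%:R * y)).
  by apply: measurable_comp_shift; exact: measurable_fdiff.
have pD := per_fdiff al y pg.
have hD j : (pint p (fun x => fdiff al y g (x - j%:R * y)%R) <= X%:E)%E.
  by rewrite (@pint_shift R p (fdiff al y g))//; exact: measurable_fdiff.
have hF j : (pint p (fun x => g (x - j%:R * y)%R) <= V%:E)%E by rewrite pint_shift.
have hA n : \sum_(j < n) `|binc (1 - al) j| <= 2 + (1 - al)^-1 by exact: sum_norm_binc_le.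
have mG : measurable_fun setT (fun x : R => g x - g (x - y)).
  by apply: measurable_funB => //; exact: measurable_comp_shift.
apply: (@pint_series_ae R p (binc (1 - al)) (fun j x => fdiff al y g (x - j%:R * y)) _ X _ p1 mD hD X0 hA mG).
pose T n := \sum_(i < n.+1) `|binc (1 - al) i| * `|binc al (n - i)%N|.
have T0 n : 0 <= T n by apply: sumr_ge0 => i _; rewrite mulr_ge0.
have hT n : \sum_(j < n) `|T j| <= (2 + (1 - al)^-1) * (2 + al^-1).
  under eq_bigr do rewrite (ger0_norm (T0 _)).
  rewrite (sum_triangle (fun i j => `|binc (1 - al) i| * `|binc al j|)).
  apply: le_trans (_ : \sum_(i < n) `|binc (1 - al) i| * (2 + al^-1) <= _).
    apply: ler_sum => i _; rewrite -mulr_sumr ler_wpM2l//.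
    exact: sum_norm_binc_le (ltW al1).
  rewrite -mulr_suml ler_wpM2r//; first by rewrite addr_ge0// invr_ge0 ltW.
have H := @ae_series_bound R p T (fun j x => g (x - j%:R * y)) _ V p1 mF hF V0 hT.
apply: filterS H => x [B hB] K hK.
have -> : g x - g (x - y) = \sum_(n < 2) binc 1 n * g (x - n%:R * y).
  by rewrite big_ord_recl big_ord1 !binc_one/= subr0 mul1r mul0r subr0 mul1r sub0r mulN1r.
apply: (@convolution_le R (binc (1 - al)) (binc al) (binc 1) (fun n => g (x - n%:R * y)) K B) => //.
- by move=> n; rewrite binc_vandermonde subrK.
- by case=> [|[|n]]// _; rewrite binc_one subrr.
- by move=> L; apply: le_trans (hB L); apply: ler_sum => n _; rewrite (ger0_norm (T0 _)).
- move=> M; apply: le_trans (hK M); apply: ler_sum => i _; rewrite ler_wpM2l// /fdiff.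
  rewrite (_ : (fun j => _) = (fun j => binc al j * g (x - i%:R * y - j%:R * y)))//.
  by apply/funext => j; rewrite natrD mulrDl opprD addrA.
Qed.

End fractional_differences.

(** * The bathtub principle *)

Section bathtub.
Context {R : realType}.
Local Notation mu := (@lebesgue_measure R).
Local Notation tm := (@torus_measure R).
Implicit Types (p al y : R) (N : nat).

(** The weights decrease, so among all d with values in [0, 1] and sum D the
    largest weighted sum is attained by filling the first D indices. *)
Lemma bathtub_sum al N (d : nat -> R) (D : R) : 0 < al -> al < 1 ->
  (forall k, 0 <= d k <= 1) -> \sum_(k < N) d k <= D ->
  \sum_(k < N) k.+1%:R `^ (al - 1) * d k <= (1 + al^-1) * D `^ al.
Proof.
move=> al0 al1 d01 hD.
have D0 : 0 <= D by apply: le_trans hD; apply: sumr_ge0 => k _; have /andP[] := d01 k.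
pose L := Num.truncn D.
have /andP[LD DL] : L%:R <= D < L.+1%:R by exact: truncn_itv.
apply: le_trans (_ : \sum_(k < N) ((if (k < L)%N then k.+1%:R `^ (al - 1) else 0)
    + L.+1%:R `^ (al - 1) * d k) <= _).
  apply: ler_sum => k _; have /andP[dk0 dk1] := d01 k; case: ltnP => kL.
    by rewrite ler_wpDr ?mulr_ge0 ?powR_ge0// ler_piMr// powR_ge0.
  rewrite add0r ler_wpM2r//; apply: powRN_le; rewrite ?ltr0n ?ler_nat//; lra.
rewrite big_split/= -mulr_sumr addrC mulrDl mul1r lerD//.
  have [D00|Dn0] := eqVneq D 0.
    rewrite D00 powR0 ?gt_eqF//.
    by apply: le_trans (ler_wpM2l (powR_ge0 _ _) hD) _; rewrite D00 mulr0.
  have Dp : 0 < D by rewrite lt_neqAle eq_sym Dn0.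
  apply: le_trans (ler_wpM2l (powR_ge0 _ _) hD) _.
  rewrite -[leRHS](mulr_powRB1 (ltW Dp) al0) mulrC ler_wpM2l ?(ltW Dp)//.
  by apply: powRN_le => //; [exact: ltW|lra].
apply: le_trans (_ : al^-1 * L%:R `^ al <= _); last first.
  by rewrite ler_wpM2l ?invr_ge0 ?(ltW al0)// ge0_ler_powR ?nnegrE// ltW.
apply: le_trans (sum_powR_le L al0 (ltW al1)).
rewrite (big_ord_widen _ (fun k => k.+1%:R `^ (al - 1)) (leq_addl N L)) [leRHS]big_mkcond/=.
rewrite big_split_ord/= lerDl; apply: sumr_ge0 => k _.
by case: ifP => // _; exact: powR_ge0.
Qed.

Lemma tm_tonelli (F : R * R -> \bar R) : measurable_fun setT F -> (forall z, (0 <= F z)%E) ->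
  (\int[tm]_x \int[tm]_y F (x, y) = \int[tm]_y \int[tm]_x F (x, y))%E.
Proof.
move=> mF F0.
pose m : {sigma_finite_measure set (measurableTypeR R) -> \bar R} :=
  HB.pack (Measure.sort tm) (Measure_isFinite.Build _ _ _ tm (@torus_fin_num R)).
exact: (@fubini_tonelli _ _ (measurableTypeR R) (measurableTypeR R) R m m F mF F0).
Qed.

Lemma measurable_tm_int (F : R * R -> \bar R) : measurable_fun setT F -> (forall z, (0 <= F z)%E) ->
  measurable_fun setT (fun x => \int[tm]_y F (x, y))%E.
Proof.
move=> mF F0.
pose m : {sigma_finite_measure set (measurableTypeR R) -> \bar R} :=
  HB.pack (Measure.sort tm) (Measure_isFinite.Build _ _ _ tm (@torus_fin_num R)).
exact: (@measurable_fun_fubini_tonelli_F _ _ (measurableTypeR R) (measurableTypeR R) R m F mF F0).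
Qed.

Definition box N k : set R := `[k%:R / N%:R, k.+1%:R / N%:R[%classic.

Lemma measurable_box N k : measurable (box N k).
Proof. exact: measurable_itv. Qed.

Lemma sum_box N n x : (0 < N)%N ->
  \sum_(k < n) \1_(box N k) x = \1_(`[0, n%:R / N%:R[%classic : set R) x :> R.
Proof.
move=> N0; have N0' : 0 < N%:R^-1 :> R by rewrite invr_gt0 ltr0n.
elim: n => [|n IH]; first by rewrite big_ord0 mul0r set_itvco0 indic0.
rewrite big_ord_recr/= IH /box !indicE !mem_setE !in_itv/=.
have e : n%:R / N%:R < n.+1%:R / N%:R :> R by rewrite ltr_pM2r// ltr_nat.
have n0 : 0 <= n%:R / N%:R :> R by rewrite divr_ge0.
case: (leP 0 x) => x0; last first.
  by rewrite add0r leNgt (lt_le_trans x0 n0).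
case: (leP (n%:R / N%:R) x) => h /=; first by rewrite add0r.
by rewrite (lt_trans h e) addr0.
Qed.

(** A step function that stands for the Riesz kernel y^(al - 1), truncated at the
    scale 1/N. *)
Definition kappa al N (y : R) : R :=
  \sum_(k < N) (k.+1%:R `^ (al - 1) * N%:R) * \1_(box N k) y.

Lemma kappa_ge0 al N y : 0 <= kappa al N y.
Proof. by apply: sumr_ge0 => k _; rewrite !mulr_ge0 ?powR_ge0 ?indicE. Qed.

Lemma measurable_kappa al N : measurable_fun setT (kappa al N).
Proof.
apply: measurable_sum => k; apply: measurable_funM => //.
by apply: measurable_indic; exact: measurable_box.
Qed.

Lemma tm_box N k : (k < N)%N -> (tm (box N k) <= N%:R^-1%:E)%E.
Proof.
move=> kN; apply: (@le_trans _ _ (mu (box N k))).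
  have mb : measurable (box N k : set (measurableTypeR R)) by exact: measurable_itv.
  rewrite torus_measureE; apply: le_measure; rewrite ?inE; [|exact: mb|exact: subIsetl].
  by apply: measurableI => //; exact: measurable_itv.
rewrite lebesgue_measure_itv/= lte_fin.
have N0 : 0 < N%:R^-1 :> R by rewrite invr_gt0 ltr0n (leq_ltn_trans _ kN).
rewrite ltr_pM2r// ltr_nat ltnSn -EFinB lee_fin -mulrBl -natr1.
by rewrite [_ - _]addrC addKr mul1r.
Qed.

(** The bathtub principle for functions: only the masses of D on the boxes matter,
    and each is at most 1/N. *)
Lemma tm_kappa al N (D : R -> R) (s : R) : 0 < al -> al < 1 -> (0 < N)%N ->
  measurable_fun setT D -> (forall y, 0 <= D y <= 1) ->
  (\int[tm]_y (D y)%:E <= s%:E)%E ->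
  (\int[tm]_y (kappa al N y * D y)%:E <= ((1 + al^-1) * (N%:R * s) `^ al)%:E)%E.
Proof.
move=> al0 al1 N0 mD D01 hs.
have N0' : 0 < N%:R :> R by rewrite ltr0n.
have D0 y : 0 <= D y by have /andP[] := D01 y.
have mb k : measurable_fun setT (fun y : R => (\1_(box N k) y * D y)%:E).
  apply/measurable_EFinP; apply: measurable_funM => //.
  by apply: measurable_indic; exact: measurable_box.
have b0 k y : (0 <= (\1_(box N k) y * D y)%:E)%E by rewrite lee_fin mulr_ge0 ?indicE.
pose a k := (\int[tm]_y (\1_(box N k) y * D y)%:E)%E.
have a0 k : (0 <= a k)%E by exact: integral_ge0.
have aub k : (k < N)%N -> (a k <= N%:R^-1%:E)%E.
  move=> kN; apply: le_trans (tm_box kN).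
  have mbk : measurable (box N k : set (measurableTypeR R)) by exact: measurable_itv.
  have <- : (\int[tm]_y (\1_(box N k) y)%:E = tm (box N k))%E.
    by rewrite (@integral_indic _ (measurableTypeR R) R tm setT measurableT _ mbk) setIT.
  apply: le_integral_ge0 => // y _; rewrite lee_fin ler_piMr ?indicE//.
  by have /andP[] := D01 y.
pose d k := if (k < N)%N then N%:R * fine (a k) else 0.
have fa k : (k < N)%N -> a k \is a fin_num.
  by move=> kN; rewrite ge0_fin_numE// (le_lt_trans (aub _ kN))// ltry.
have -> : (\int[tm]_y (kappa al N y * D y)%:E = (\sum_(k < N) k.+1%:R `^ (al - 1) * d k)%:E)%E.
  transitivity (\int[tm]_y (\sum_(k < N) ((k.+1%:R `^ (al - 1) * N%:R)%:E * (\1_(box N k) y * D y)%:E)))%E.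
    apply: eq_integral => y _; rewrite /kappa mulr_suml -sumEFin.
    by apply: eq_bigr => k _; rewrite -EFinM mulrA.
  rewrite ge0_integral_sum//; last 2 first.
  - by move=> k; apply: emeasurable_funM => //; exact: mb.
  - by move=> k y _; rewrite mule_ge0// lee_fin mulr_ge0 ?powR_ge0.
  rewrite -sumEFin; apply: eq_bigr => k _; rewrite ge0_integralZl//; last exact: mb.
  by rewrite -/(a k) -(fineK (fa k _))// -EFinM /d ltn_ord mulrA.
rewrite lee_fin; apply: bathtub_sum => // [k|].
  rewrite /d; case: ifPn => kN; last by rewrite lexx ler01.
  rewrite mulr_ge0 ?fine_ge0//= -(ler_pM2l (_ : 0 < N%:R^-1)) ?invr_gt0//.
  by rewrite mulrA mulVf ?gt_eqF// mul1r mulr1 -lee_fin fineK ?fa// aub.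
rewrite (eq_bigr (fun k : 'I_N => N%:R * fine (a k))); last by move=> k _; rewrite /d ltn_ord.
rewrite -mulr_sumr ler_pM2l// -lee_fin -sumEFin.
rewrite (eq_bigr (fun k : 'I_N => a k)); last by move=> k _; rewrite fineK ?fa.
rewrite -ge0_integral_sum//; last by move=> k; exact: mb.
apply: le_trans hs.
apply: le_integral_ge0 => y _; first by apply: sume_ge0.
rewrite sumEFin lee_fin -mulr_suml sum_box// divff ?gt_eqF//.
by rewrite ler_piMl// indicE; case: (_ \in _).
Qed.

End bathtub.

(** * The distribution of a function in terms of its damped difference *)

Section smoothing.
Context {R : realType}.
Local Notation mu := (@lebesgue_measure R).
Local Notation tm := (@torus_measure R).
Implicit Types (p al y : R) (N : nat) (g F : R -> R).

Lemma per_seq_bound N (b : nat -> R) : (0 < N)%N -> (forall n, b (n + N)%N = b n) ->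
  exists2 B, 0 <= B & forall n, `|b n| <= B.
Proof.
move=> N0 bN.
have bM m k : b (k + m * N)%N = b k.
  by elim: m => [|m IH]; rewrite ?mul0n ?addn0// mulSn addnCA addnC bN.
exists (\sum_(k < N) `|b k|); first exact: sumr_ge0.
move=> n; rewrite (divn_eq n N) addnC bM (bigD1 (Ordinal (ltn_pmod n N0)))//= lerDl.
exact: sumr_ge0.
Qed.

Lemma per_orbit N g x : (0 < N)%N -> per g ->
  forall n, g (x - (n + N)%:R / N%:R) = g (x - n%:R / N%:R).
Proof.
move=> N0 pg n; rewrite natrD mulrDl divff ?pnatr_eq0 -?lt0n// -[RHS](pg) -[LHS]pg.
by rewrite opprD addrA subrK pg.
Qed.

(** The modulus of the damped fractional difference of step 1/N. With the damping
    the series converges at every point, for any periodic g. *)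
Definition damped_diff al N g (x : R) : R :=
  `|limn (series (fun j => binc al j * hroot N ^+ j * g (x - j%:R / N%:R)))|.

Lemma damped_diff_ge0 al N g x : 0 <= damped_diff al N g x. Proof. exact: normr_ge0. Qed.

Lemma measurable_damped_diff al N g : measurable_fun setT g -> measurable_fun setT (damped_diff al N g).
Proof.
move=> mg; apply: measurableT_comp => //; apply: measurable_limn => n; rewrite /series/=.
apply: measurable_sum => j; apply: measurable_funM => //.
exact: (measurable_comp_shift (- (j%:R / N%:R))).
Qed.

Lemma per_damped_diff al N g : per g -> per (damped_diff al N g).
Proof.
move=> pg x; rewrite /damped_diff; congr (`|limn (series _)|); apply/funext => j.
by rewrite addrAC pg.
Qed.

(** The points x - k/N run through a periodic orbit, on which
    [periodic_inversion] applies. *)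
Lemma le_damped_diff al N g x : 0 < al -> al < 1 -> (0 < N)%N -> per g ->
  `|g x| <= 2 * \sum_(k < N) k.+1%:R `^ (al - 1) * damped_diff al N g (x - k%:R / N%:R).
Proof.
move=> al0 al1 N0 pg.
have := @periodic_inversion R al N (fun n => g (x - n%:R / N%:R)) al0 al1 N0 (per_orbit x N0 pg).
rewrite mul0r subr0; congr (_ <= _ * _); apply: eq_bigr => k _; congr (_ * `|limn (series _)|).
by apply/funext => j; rewrite natrD mulrDl opprD addrA.
Qed.

(** The damped and the ordinary difference differ by a series whose coefficients have
    a total mass of order N^-al. *)
Lemma pint_damped_diff p al N g (X Y : R) : 1 <= p -> 0 < al -> al < 1 -> (0 < N)%N ->
  measurable_fun setT g -> per g -> 0 <= Y ->
  (pint p (fdiff al N%:R^-1 g) <= X%:E)%E -> (pint p g <= Y%:E)%E ->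
  (pint p (damped_diff al N g) <=
    (2 `^ p * (X + ((al^-1 + (1 - al)^-1) * N%:R `^ (- al)) `^ p * Y))%:E)%E.
Proof.
move=> p1 al0 al1 N0 mg pg Y0 hX hY.
pose th j := binc al j * (hroot N ^+ j - 1).
pose e x := limn (series (fun j => th j * g (x - j%:R / N%:R))).
have mF j : measurable_fun setT (fun x : R => g (x - j%:R / N%:R)) by exact: measurable_comp_shift.
have hF j : (pint p (fun x => g (x - j%:R / N%:R)%R) <= Y%:E)%E by rewrite pint_shift.
have hA n : \sum_(j < n) `|th j| <= (al^-1 + (1 - al)^-1) * N%:R `^ (- al).
  apply: le_trans (sum_binc_hroot_le n al0 al1 N0); apply: ler_sum => j _.
  by rewrite /th -opprB mulrN normrN.
have he : (pint p e <= (((al^-1 + (1 - al)^-1) * N%:R `^ (- al)) `^ p * Y)%:E)%E.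
  exact: (@pint_series R p th (fun j x => g (x - j%:R / N%:R)) _ Y p1 mF hF Y0 hA).
have me : measurable_fun setT e.
  apply: measurable_limn => n; rewrite /series/=.
  by apply: measurable_sum => j; apply: measurable_funM => //; exact: mF.
have p0 : 0 <= p by lra.
apply: (@le_trans _ _ (pint p (fun x => fdiff al N%:R^-1 g x + e x)%R)).
  apply: pint_le => // x; rewrite /damped_diff normr_id le_eqVlt; apply/orP; left; apply/eqP; congr `|_|.
  have [B B0 hB] := per_seq_bound N0 (per_orbit x N0 pg).
  have c1 : cvgn (series (fun j => binc al j * g (x - j%:R * N%:R^-1))).
    apply: (is_cvg_series_abs_bound (B := (2 + al^-1) * B)) => n.
    apply: le_trans (_ : \sum_(j < n) `|binc al j| * B <= _).
      by apply: ler_sum => j _; rewrite normrM ler_wpM2l.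
    by rewrite -mulr_suml ler_wpM2r// sum_norm_binc_le// ltW.
  have c2 : cvgn (series (fun j => th j * g (x - j%:R / N%:R))).
    apply: (is_cvg_series_abs_bound (B := ((al^-1 + (1 - al)^-1) * N%:R `^ (- al)) * B)) => n.
    apply: le_trans (_ : \sum_(j < n) `|th j| * B <= _).
      by apply: ler_sum => j _; rewrite normrM ler_wpM2l.
    by rewrite -mulr_suml ler_wpM2r.
  rewrite /fdiff /e -lim_seriesD//; congr (limn (series _)); apply/funext => j.
  by rewrite [RHS]/GRing.add/= /th; ring.
apply: le_trans (pint_add p0 (measurable_fdiff _ _ mg) me) _.
rewrite EFinM lee_wpmul2l ?lee_fin ?powR_ge0// EFinD; apply: leeD => //.
Qed.

Lemma tm_box_int N k F : (k < N)%N -> measurable_fun setT F -> (forall y, 0 <= F y) ->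
  (\int[tm]_y (\1_(box N k) y * F y)%:E = \int[mu]_(y in box N k) (F y)%:E)%E.
Proof.
move=> kN mF F0; have N0 : 0 < N%:R :> R by rewrite ltr0n (leq_ltn_trans _ kN).
rewrite torus_integralE; last 2 first.
- apply/measurable_EFinP; apply: measurable_funM => //.
  by apply: measurable_indic; exact: measurable_box.
- by move=> y; rewrite lee_fin mulr_ge0 ?indicE.
rewrite [LHS]integral_mkcond [RHS]integral_mkcond; apply: eq_integral => y _.
rewrite /patch indicE; case: (boolP (y \in box N k)) => yk; last by rewrite mul0r if_same.
rewrite mul1r ifT//; move: yk; rewrite !inE /box/= !in_itv/= => /andP[h1 h2].
rewrite (le_trans _ h1) ?divr_ge0 ?(ltW N0)//=; apply: lt_le_trans h2 _.
by rewrite ler_pdivrMr// mul1r ler_nat.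
Qed.

Lemma box_shift N k F : (k < N)%N -> measurable_fun setT F -> (forall y, 0 <= F y) ->
  (\int[tm]_y (\1_(box N k) y * F y)%:E =
   \int[tm]_y (\1_(box N 0) y * F (y + k%:R / N%:R)%R)%:E)%E.
Proof.
move=> kN mF F0; have N0 : 0 < N%:R :> R by rewrite ltr0n (leq_ltn_trans _ kN).
rewrite !tm_box_int//; last 2 first.
- by rewrite (leq_ltn_trans _ kN).
- exact: measurable_comp_shift.
have -> : box N 0 = (fun y : R => y + k%:R / N%:R) @^-1` box N k.
  apply/seteqP; split => y /=; rewrite /box/= !in_itv/= mul0r -(natr1 k) mulrDl => /andP[h1 h2];
    apply/andP; split; lra.
rewrite (@ge0_lebesgue_shift R _ _ (fun y => (F y)%:E))//.
- exact: measurable_box.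
- by apply/measurable_EFinP; exact: measurable_funS mF.
Qed.

Lemma tm_box0 N : (0 < N)%N -> (\int[tm]_y (N%:R * \1_(box N 0) y)%:E = 1)%E.
Proof.
move=> N0; have N0' : 0 < N%:R :> R by rewrite ltr0n.
under eq_integral do rewrite EFinM.
have mb : measurable (box N 0 : set (measurableTypeR R)) by exact: measurable_itv.
rewrite ge0_integralZl//; last first.
  by apply/measurable_EFinP; apply: measurable_indic; exact: measurable_box.
under eq_integral do rewrite -[X in X%:E]mulr1.
rewrite (@tm_box_int N 0 (cst 1))// (@integral_cst _ (measurableTypeR R) R mu _ mb 1).
rewrite [X in (_ * (1 * X))%E](_ : _ = N%:R^-1%:E); last first.
  have e : (mu (box N 0) = N%:R^-1%:E)%E.
    by rewrite lebesgue_measure_itv/= mul0r mul1r lte_fin invr_gt0 N0' oppr0 adde0.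
  exact: e.
by rewrite mul1e -EFinM divff// gt_eqF.
Qed.

Lemma tm_Zl (k : R) F : 0 <= k -> measurable_fun setT F -> (forall y, 0 <= F y) ->
  (\int[tm]_y (k%:E * (F y)%:E) = k%:E * \int[tm]_y (F y)%:E)%E.
Proof.
move=> k0 mF F0.
have mE : measurable_fun setT (fun y => (F y)%:E) by exact/measurable_EFinP.
have E0 y : (0 <= (F y)%:E)%E by rewrite lee_fin.
have K0 : (0 <= k%:E)%E by rewrite lee_fin.
by rewrite ge0_integralZl.
Qed.

Lemma tm_Zr (k : R) F : 0 <= k -> measurable_fun setT F -> (forall y, 0 <= F y) ->
  (\int[tm]_y ((F y)%:E * k%:E) = \int[tm]_y (F y)%:E * k%:E)%E.
Proof.
move=> k0 mF F0; rewrite muleC -tm_Zl//.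
by apply: eq_integral => y _; rewrite muleC.
Qed.

Section level.
Context (p al : R) (N : nat) (g : R -> R).
Context (p1 : 1 < p) (al0 : 0 < al) (al1 : al < 1) (N0 : (0 < N)%N).
Context (mg : measurable_fun setT g) (pg : per g).

Let w := damped_diff al N g.
Let mw : measurable_fun setT w. Proof. exact: measurable_damped_diff. Qed.
Let pw : per w. Proof. exact: per_damped_diff. Qed.
Let w0 x : 0 <= w x. Proof. exact: damped_diff_ge0. Qed.

(** A potential of order al of F, truncated at the scale 1/N. *)
Definition kconv F (x : R) : \bar R := (\int[tm]_y (kappa al N y * F (x - y)%R)%:E)%E.

Lemma measurable_kconv2 F : measurable_fun setT F ->
  measurable_fun setT (fun z : R * R => (kappa al N z.2 * F (z.1 - z.2)%R)%:E).
Proof.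
move=> mF; apply/measurable_EFinP; apply: measurable_funM.
  exact: (measurableT_comp (measurable_kappa al N) measurable_snd).
apply: (measurableT_comp mF); apply: measurable_funB; [exact: measurable_fst|exact: measurable_snd].
Qed.

Lemma measurable_kconv F : measurable_fun setT F -> (forall x, 0 <= F x) ->
  measurable_fun setT (kconv F).
Proof.
move=> mF F0; apply: (measurable_tm_int (measurable_kconv2 mF)) => z.
by rewrite lee_fin mulr_ge0// kappa_ge0.
Qed.

(** The mean oscillation to the power p over translations by less than 1/N. *)
Definition osc (x : R) : \bar R :=
  (\int[tm]_y (N%:R * \1_(box N 0) y * `|g x - g (x - y)| `^ p)%:E)%E.

Lemma measurable_osc2 :
  measurable_fun setT (fun z : R * R => (N%:R * \1_(box N 0) z.2 * `|g z.1 - g (z.1 - z.2)| `^ p)%:E).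
Proof.
apply/measurable_EFinP; apply: measurable_funM.
  apply: measurable_funM => //.
  have mi : measurable_fun setT (\1_(box N 0) : R -> R) by apply: measurable_indic; exact: measurable_box.
  exact: (measurableT_comp mi measurable_snd).
apply: (measurableT_comp (measurable_powR p)); apply: measurableT_comp => //.
apply: measurable_funB; first exact: (measurableT_comp mg measurable_fst).
apply: (measurableT_comp mg); apply: measurable_funB; [exact: measurable_fst|exact: measurable_snd].
Qed.

Lemma osc2_ge0 z : (0 <= (N%:R * \1_(box N 0) z.2 * `|g z.1 - g (z.1 - z.2)| `^ p)%:E)%E.
Proof. by rewrite lee_fin !mulr_ge0 ?powR_ge0 ?indicE. Qed.

Lemma osc_ge0 x : (0 <= osc x)%E.
Proof. by apply: integral_ge0 => y _; exact: (osc2_ge0 (x, y)). Qed.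

Lemma measurable_osc : measurable_fun setT osc.
Proof. exact: (measurable_tm_int measurable_osc2 osc2_ge0). Qed.

(** Tonelli's theorem: the integral of the oscillation is an average of those
    of the p-th powers of first differences. *)
Lemma integral_osc_le (X : R) : 0 <= X ->
  (forall y, 0 <= y -> y <= N%:R^-1 -> (pint p (fun x => g x - g (x - y))%R <= X%:E)%E) ->
  (\int[tm]_x osc x <= X%:E)%E.
Proof.
move=> X0 hX; rewrite /osc (tm_tonelli measurable_osc2 osc2_ge0).
apply: (@le_trans _ _ (\int[tm]_y ((N%:R * \1_(box N 0) y)%:E * X%:E)))%E.
  apply: le_integral_ge0 => y _; first by apply: integral_ge0 => x _; exact: (osc2_ge0 (x, y)).
  have mgy : measurable_fun setT (fun x : R => g x - g (x - y)).
    by apply: measurable_funB => //; exact: measurable_comp_shift.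
  have -> : (\int[tm]_x (N%:R * \1_(box N 0) y * `|g x - g (x - y)| `^ p)%:E =
     (N%:R * \1_(box N 0) y)%:E * pint p (fun x => g x - g (x - y))%R)%E.
    under eq_integral do rewrite EFinM.
    by rewrite ge0_integralZl//; exact: (measurable_pow p mgy).
  rewrite indicE; case: (boolP (y \in box N 0)) => yb; last by rewrite mulr0 !mul0e.
  apply: lee_wpmul2l; first by rewrite lee_fin mulr_ge0.
  by move: yb; rewrite inE /box/= in_itv/= mul0r => /andP[h1 h2]; apply: hX => //; rewrite -[leRHS]mul1r ltW.
have mN : measurable_fun setT (fun y : R => (N%:R * (\1_(box N 0) y : R))%:E).
  apply/measurable_EFinP; apply: measurable_funM => //.
  by apply: measurable_indic; exact: measurable_box.
have N00 (y : R) : (0 <= (N%:R * (\1_(box N 0) y : R))%:E)%E by rewrite lee_fin mulr_ge0 ?indicE.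
rewrite ge0_integralZr//.
by rewrite tm_box0// mul1e.
Qed.

(** By the triangle inequality, |g x| is at most the mean of |g (x - y)| over
    0 <= y < 1/N plus the mean of |g x - g (x - y)|. The inversion formula turns the
    first mean into the potential of w. The second is at most 2 lam by
    [le_powR_chebyshev]. *)
Lemma pointwise_level (v lam : R) x : 0 < lam -> 0 <= v ->
  (kconv w x <= v%:E)%E -> (osc x <= (lam `^ p)%:E)%E -> `|g x| <= 2 * v + 2 * lam.
Proof.
move=> l0 v0 hv ho.
have p0 : 0 < p := lt_trans ltr01 p1.
have mb : measurable_fun setT (\1_(box N 0) : R -> R) by apply: measurable_indic; exact: measurable_box.
have mgx : measurable_fun setT (fun y : R => g (x - y)).
  by apply: (measurableT_comp mg); exact: measurable_opp_shift.
have mV : measurable_fun setT (fun y : R => (\1_(box N 0) y * (N%:R * `|g (x - y)|))%:E).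
  apply/measurable_EFinP; apply: measurable_funM => //; apply: measurable_funM => //.
  exact: measurableT_comp.
have mO : measurable_fun setT (fun y : R => (N%:R * \1_(box N 0) y * `|g x - g (x - y)| `^ p)%:E).
  apply/measurable_EFinP; apply: measurable_funM; first exact: measurable_funM.
  apply: (measurableT_comp (measurable_powR p)); apply: measurableT_comp => //.
  exact: measurable_funB.
have mN : measurable_fun setT (fun y : R => (N%:R * (\1_(box N 0) y : R))%:E).
  by apply/measurable_EFinP; exact: measurable_funM.
have i0 y : 0 <= \1_(box N 0) y :> R by rewrite indicE.
have V : (\int[tm]_y (\1_(box N 0) y * (N%:R * `|g (x - y)|))%:E <= (2 * v)%:E)%E.
  apply: (@le_trans _ _ (2%:E * kconv w x)%E); last by rewrite EFinM lee_wpmul2l.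
  pose c k : R := 2 * (k.+1%:R `^ (al - 1) * N%:R).
  have c0 k : 0 <= c k by rewrite !mulr_ge0 ?powR_ge0.
  have mwk k : measurable_fun setT (fun y : R => w (x - k%:R / N%:R - y)).
    by apply: (measurableT_comp mw); exact: measurable_opp_shift.
  have mwx : measurable_fun setT (fun y : R => w (x - y)).
    by apply: (measurableT_comp mw); exact: measurable_opp_shift.
  apply: (@le_trans _ _ (\int[tm]_y \sum_(k < N) ((c k)%:E * (\1_(box N 0) y * w (x - k%:R / N%:R - y))%:E)))%E.
    apply: le_integral_ge0 => y _; first by rewrite lee_fin !mulr_ge0.
    rewrite (eq_bigr (fun k : 'I_N => (\1_(box N 0) y * (N%:R * (2 * (k.+1%:R `^ (al - 1) * w (x - y - k%:R / N%:R)))))%:E)); last first.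
      by move=> k _; rewrite -EFinM addrAC; congr EFin; rewrite /c; ring.
    rewrite sumEFin lee_fin -mulr_sumr ler_wpM2l// -!mulr_sumr ler_wpM2l//.
    exact: le_damped_diff.
  rewrite ge0_integral_sum//; last 2 first.
  - move=> k; apply: emeasurable_funM => //; apply/measurable_EFinP.
    by apply: measurable_funM => //; exact: mwk.
  - by move=> k y _; rewrite mule_ge0 ?lee_fin ?mulr_ge0.
  apply: (@le_trans _ _ (\sum_(k < N) ((c k)%:E * \int[tm]_y (\1_(box N k) y * w (x - y))%:E)))%E.
    apply: lee_sum => k _.
    have mk : measurable_fun setT (fun y : R => (\1_(box N 0) y * w (x - k%:R / N%:R - y))%:E).
      by apply/measurable_EFinP; apply: measurable_funM => //; exact: mwk.
    have k0 y : (0 <= (\1_(box N 0) y * w (x - k%:R / N%:R - y))%:E)%E by rewrite lee_fin mulr_ge0.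
    have ck0 : (0 <= (c k)%:E)%E by rewrite lee_fin.
    rewrite ge0_integralZl// lee_wpmul2l ?lee_fin// (box_shift (F := fun y => w (x - y)))//.
    apply: le_integral_ge0 => y _; first by rewrite lee_fin mulr_ge0.
    by rewrite opprD addrA addrAC.
  have mbk k : measurable_fun setT (fun y : R => (\1_(box N k) y * w (x - y))%:E).
    apply/measurable_EFinP; apply: measurable_funM => //.
    by apply: measurable_indic; exact: measurable_box.
  have bk0 k y : (0 <= (\1_(box N k) y * w (x - y))%:E)%E by rewrite lee_fin mulr_ge0 ?indicE.
  rewrite (eq_bigr (fun k : 'I_N => \int[tm]_y ((c k)%:E * (\1_(box N k) y * w (x - y))%:E)))%E; last first.
    move=> k _; have ck0 : (0 <= (c k)%:E)%E by rewrite lee_fin.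
    by rewrite ge0_integralZl//; exact: mbk.
  rewrite -ge0_integral_sum//; last 2 first.
  - by move=> k; apply: emeasurable_funM => //; exact: mbk.
  - by move=> k y _; rewrite mule_ge0 ?lee_fin ?mulr_ge0 ?indicE.
  rewrite -ge0_integralZl//; last 2 first.
  - apply/measurable_EFinP; apply: measurable_funM => //; exact: measurable_kappa.
  - by move=> y _; rewrite lee_fin mulr_ge0 ?kappa_ge0.
  apply: le_integral_ge0 => y _.
    by apply: sume_ge0 => k _; rewrite mule_ge0 ?lee_fin ?mulr_ge0 ?indicE.
  rewrite (eq_bigr (fun k : 'I_N => (2 * (k.+1%:R `^ (al - 1) * N%:R * \1_(box N k) y * w (x - y)))%:E)); last first.
    by move=> k _; rewrite -EFinM /c; congr EFin; ring.
  by rewrite sumEFin -mulr_sumr -mulr_suml EFinM.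
have young (u : R) : 0 <= u -> u <= lam + lam `^ (1 - p) * u `^ p.
  exact: le_powR_chebyshev (ltW p1) l0.
rewrite -lee_fin -[leLHS]mule1 -(tm_box0 N0).
rewrite -ge0_integralZl//.
pose V1 y : R := \1_(box N 0) y * (N%:R * `|g (x - y)|).
pose V2 y : R := N%:R * (\1_(box N 0) y : R).
pose V3 y : R := N%:R * \1_(box N 0) y * `|g x - g (x - y)| `^ p.
have V10 y : 0 <= V1 y by rewrite !mulr_ge0.
have V20 y : 0 <= V2 y by rewrite !mulr_ge0.
have V30 y : 0 <= V3 y by rewrite !mulr_ge0 ?powR_ge0.
have l1 : 0 <= lam `^ (1 - p) by rewrite powR_ge0.
apply: (@le_trans _ _ (\int[tm]_y ((V1 y)%:E + (lam%:E * (V2 y)%:E + (lam `^ (1 - p))%:E * (V3 y)%:E)))%E).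
  apply: le_integral_ge0 => y _; first by rewrite -EFinM lee_fin !mulr_ge0.
  rewrite -!EFinM -!EFinD lee_fin.
  rewrite [leRHS](_ : _ = N%:R * \1_(box N 0) y * (`|g (x - y)| +
     (lam + lam `^ (1 - p) * `|g x - g (x - y)| `^ p))); last first.
    by rewrite /V1 /V2 /V3; ring.
  rewrite mulrC ler_wpM2l ?mulr_ge0//.
  apply: le_trans (lerD (lexx _) (young _ (normr_ge0 _))).
  by rewrite -[X in `|X| <= _](subrK (g (x - y))) addrC ler_normD.
have mV1 : measurable_fun setT (fun y => (V1 y)%:E) by exact: mV.
have mV2 : measurable_fun setT (fun y => (V2 y)%:E) by exact: mN.
have mV3 : measurable_fun setT (fun y => (V3 y)%:E) by exact: mO.
have mlV2 : measurable_fun setT (fun y => lam%:E * (V2 y)%:E)%E by exact: emeasurable_funM.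
have mlV3 : measurable_fun setT (fun y => (lam `^ (1 - p))%:E * (V3 y)%:E)%E by exact: emeasurable_funM.
have p10 y : (0 <= (V1 y)%:E)%E by rewrite lee_fin.
have p20 y : (0 <= lam%:E * (V2 y)%:E)%E by rewrite -EFinM lee_fin mulr_ge0// ltW.
have p30 y : (0 <= (lam `^ (1 - p))%:E * (V3 y)%:E)%E by rewrite -EFinM lee_fin mulr_ge0.
have p230 y : (0 <= lam%:E * (V2 y)%:E + (lam `^ (1 - p))%:E * (V3 y)%:E)%E by rewrite adde_ge0.
have m23 : measurable_fun setT (fun y => lam%:E * (V2 y)%:E + (lam `^ (1 - p))%:E * (V3 y)%:E)%E by exact: emeasurable_funD.
rewrite ge0_integralD// ge0_integralD//.
have l0' : (0 <= lam%:E)%E by rewrite lee_fin ltW.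
have l1' : (0 <= (lam `^ (1 - p))%:E)%E by rewrite lee_fin.
have q20 y : (0 <= (V2 y)%:E)%E by rewrite lee_fin.
have q30 y : (0 <= (V3 y)%:E)%E by rewrite lee_fin.
rewrite ge0_integralZl// ge0_integralZl// tm_box0// mule1.
rewrite [X in (_ <= (_ + X)%:E)%E]mulr_natl mulr2n !EFinD; apply: leeD; first exact: V.
apply: leeD => //; rewrite -[X in (_ <= X%:E)%E](_ : lam `^ (1 - p) * lam `^ p = lam).
  by rewrite EFinM lee_wpmul2l.
by rewrite -powRD_pos// subrK powRr1// ltW.
Qed.

(** On the set A where the potential exceeds be, integrate it and exchange the
    integrals: each translate of A meets the kernel in at most
    (1 + 1/al) (N |A|)^al, so be |A| is at most T times this. Solving for |A| gives
    the bound, as al < 1. *)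
Lemma kconv_high (F : R -> R) (T be : R) (s : R) : measurable_fun setT F -> per F ->
  (forall x, 0 <= F x) -> 0 < T -> (\int[tm]_x (F x)%:E <= T%:E)%E -> 0 < s ->
  be = (1 + al^-1) * N%:R `^ al * T * s `^ (al - 1) ->
  (tm [set x | (be%:E < kconv F x)%E] <= s%:E)%E.
Proof.
move=> mF pF F0 T0 hT s0 beE.
have N0' : 0 < N%:R :> R by rewrite ltr0n.
have C0 : 0 < 1 + al^-1 by rewrite addr_gt0// invr_gt0.
have be0 : 0 < be by rewrite beE !mulr_gt0 ?powR_gt0.
set A := [set x | _].
have mk := measurable_kconv mF F0.
have mA : measurable (A : set (measurableTypeR R)).
  rewrite -[A]setTI; apply: emeasurable_fun_o_infty => //.
have pk : per (kconv F).
  move=> x; rewrite /kconv; apply: eq_integral => y _; rewrite addrAC pF//.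
pose t := fine (tm A).
have tE : tm A = t%:E by rewrite fineK// torus_fin_num.
have t0 : 0 <= t by rewrite fine_ge0.
have [ts|st] := leP t s; first by rewrite tE lee_fin.
have tp : 0 < t by exact: lt_trans st.
pose iA (x : R) : R := \1_A x.
have iA0 x : 0 <= iA x by rewrite /iA indicE.
have miA : measurable_fun setT iA by apply: measurable_indic.
have piA : per iA.
  move=> x; rewrite /iA !indicE.
  have -> : (x + 1 \in A) = (x \in A) by apply/idP/idP; rewrite !inE /A/= pk.
  by [].
have iiA : (\int[tm]_x (iA x)%:E = t%:E)%E.
  by rewrite -tE (@integral_indic _ (measurableTypeR R) R tm setT measurableT A mA) setIT.
have h1 : (be%:E * t%:E <= \int[tm]_x ((iA x)%:E * kconv F x))%E.
  rewrite -iiA -(tm_Zl (ltW be0) miA iA0).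
  apply: le_integral_ge0 => x _; first by rewrite mule_ge0 ?lee_fin// ltW.
  rewrite /iA indicE; case: (boolP (x \in A)) => [|_]; last by rewrite mule0 mul0e.
  by rewrite inE /A/= mule1 mul1e => /ltW.
have m2 := measurable_kconv2 mF.
have m3 : measurable_fun setT (fun z : R * R => (iA z.1 * (kappa al N z.2 * F (z.1 - z.2)))%:E).
  apply/measurable_EFinP; apply: measurable_funM; last exact/measurable_EFinP.
  exact: (measurableT_comp miA measurable_fst).
have k0 y : 0 <= kappa al N y by exact: kappa_ge0.
have p3 (z : R * R) : (0 <= (iA z.1 * (kappa al N z.2 * F (z.1 - z.2)))%:E)%E by rewrite lee_fin !mulr_ge0.
have h2 : (\int[tm]_x ((iA x)%:E * kconv F x) =
    \int[tm]_y ((kappa al N y)%:E * \int[tm]_z (iA (z + y)%R * F z)%:E))%E.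
  transitivity (\int[tm]_x \int[tm]_y (iA x * (kappa al N y * F (x - y)))%:E)%E.
    apply: eq_integral => x _; rewrite /kconv.
    have mx : measurable_fun setT (fun y : R => kappa al N y * F (x - y)).
      apply: measurable_funM; first exact: measurable_kappa.
      by apply: (measurableT_comp mF); exact: measurable_opp_shift.
    have x0 y : 0 <= kappa al N y * F (x - y) by rewrite mulr_ge0.
    by rewrite -(tm_Zl (iA0 x) mx x0).
  rewrite (tm_tonelli m3 p3); apply: eq_integral => y _ /=.
  have my : measurable_fun setT (fun z : R => (iA (z + y) * F z)%:E).
    by apply/measurable_EFinP; apply: measurable_funM => //; exact: measurable_comp_shift.
  rewrite -[in RHS](torus_shift (- y) my); last 2 first.
  - by move=> z; rewrite lee_fin mulr_ge0.
  - by move=> z; rewrite addrAC piA pF.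
  have mz : measurable_fun setT (fun z : R => iA (z - y + y) * F (z - y)).
    apply: measurable_funM; last exact: measurable_comp_shift.
    by apply: (@measurable_comp_shift R (fun z => iA (z + y)) (- y)); exact: measurable_comp_shift.
  have z0 z : 0 <= iA (z - y + y) * F (z - y) by rewrite mulr_ge0.
  rewrite -(tm_Zl (k0 y) mz z0).
  by apply: eq_integral => z _; rewrite -EFinM subrK mulrCA.
have m4 : measurable_fun setT (fun z : R * R => (kappa al N z.1 * (iA (z.2 + z.1) * F z.2))%:E).
  apply/measurable_EFinP; apply: measurable_funM.
    exact: (measurableT_comp (measurable_kappa al N) measurable_fst).
  apply: measurable_funM; last exact: (measurableT_comp mF measurable_snd).
  by apply: (measurableT_comp miA); apply: measurable_funD; [exact: measurable_snd|exact: measurable_fst].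
have p4 (z : R * R) : (0 <= (kappa al N z.1 * (iA (z.2 + z.1) * F z.2))%:E)%E by rewrite lee_fin !mulr_ge0.
have h3 : (\int[tm]_y ((kappa al N y)%:E * \int[tm]_z (iA (z + y)%R * F z)%:E) =
    \int[tm]_z ((F z)%:E * \int[tm]_y (kappa al N y * iA (z + y)%R)%:E))%E.
  transitivity (\int[tm]_y \int[tm]_z (kappa al N y * (iA (z + y) * F z))%:E)%E.
    apply: eq_integral => y _.
    have mz : measurable_fun setT (fun z : R => iA (z + y) * F z).
      by apply: measurable_funM => //; exact: measurable_comp_shift.
    have z0 z : 0 <= iA (z + y) * F z by rewrite mulr_ge0.
    by rewrite -(tm_Zl (k0 y) mz z0).
  rewrite (tm_tonelli m4 p4); apply: eq_integral => z _ /=.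
  have my : measurable_fun setT (fun y : R => kappa al N y * iA (z + y)).
    apply: measurable_funM; first exact: measurable_kappa.
    by apply: (measurableT_comp miA); apply: measurable_funD.
  have y0 y : 0 <= kappa al N y * iA (z + y) by rewrite mulr_ge0.
  rewrite -(tm_Zl (F0 z) my y0).
  by apply: eq_integral => y _; rewrite -EFinM; congr EFin; ring.
pose K := (1 + al^-1) * (N%:R * t) `^ al.
have h4 : (\int[tm]_z ((F z)%:E * \int[tm]_y (kappa al N y * iA (z + y)%R)%:E) <= T%:E * K%:E)%E.
  apply: (@le_trans _ _ (\int[tm]_z ((F z)%:E * K%:E))%E).
    apply: le_integral_ge0 => z _.
      by rewrite mule_ge0 ?lee_fin//; apply: integral_ge0 => y _; rewrite lee_fin mulr_ge0.
    rewrite lee_wpmul2l ?lee_fin//.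
    have mD : measurable_fun setT (fun y : R => iA (z + y)).
      by apply: (measurableT_comp miA); apply: measurable_funD.
    have D01 (y : R) : 0 <= iA (z + y) <= 1.
      by rewrite iA0 /iA indicE; case: (z + y \in A); rewrite ?lexx ?ler01.
    have mE : measurable_fun setT (fun y : R => (iA y)%:E) by exact/measurable_EFinP.
    have h : (\int[tm]_y (iA (z + y))%:E <= t%:E)%E.
      have -> : (\int[tm]_y (iA (z + y))%:E = \int[tm]_y (iA (y + z))%:E)%E.
        by apply: eq_integral => y _; rewrite addrC.
      rewrite (@torus_shift R z (fun y => (iA y)%:E)) ?iiA// => y.
      by rewrite piA.
    exact: (tm_kappa al0 al1 N0 mD D01 h).
  have K0 : 0 <= K by rewrite !mulr_ge0 ?powR_ge0// ltW.
  rewrite (tm_Zr K0 mF F0).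
  by rewrite lee_wpmul2r// lee_fin !mulr_ge0 ?powR_ge0// ltW.
have : be * t <= T * K by rewrite -lee_fin !EFinM; apply: le_trans h1 _; rewrite h2 h3.
rewrite beE /K powRM ?(ltW N0') ?(ltW tp)// => h5.
have h6 : s `^ (al - 1) * t <= t `^ al.
  have P0 : 0 < (1 + al^-1) * N%:R `^ al * T by rewrite !mulr_gt0 ?powR_gt0.
  by rewrite -(ler_pM2l P0); apply: le_trans (_ : T * ((1 + al^-1) * (N%:R `^ al * t `^ al)) <= _);
    [apply: le_trans h5; rewrite mulrA|apply: eq_ler; ring].
have : s `^ (al - 1) <= t `^ (al - 1).
  rewrite -(ler_pM2r tp); apply: le_trans h6 _.
  by rewrite mulrC mulr_powRB1// ltW.
rewrite leNgt => /negP[].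
rewrite -(opprK (al - 1)) opprB !powRN ltf_pV2 ?posrE ?powR_gt0//.
by apply: gt0_ltr_powR; rewrite ?nnegrE ?subr_gt0// ltW.
Qed.

Lemma tm_superlevel (F : R -> R) (c x : R) : measurable_fun setT F -> per F ->
  (\int[tm]_y (\1_[set u | (c < F u)%R] (x - y) : R)%:E = tm [set u | (c < F u)%R])%E.
Proof.
move=> mF pF; set A := [set u | _].
have mA : measurable (A : set (measurableTypeR R)).
  rewrite -[A]setTI (_ : A = F @^-1` `]c, +oo[); first by apply: mF => //; exact: measurable_itv.
  by apply/seteqP; split => u /=; rewrite /A/= in_itv/= andbT.
have pA (u : R) : (u + 1 \in A) = (u \in A) by apply/idP/idP; rewrite !inE /A/= pF.
have mi : measurable_fun setT (\1_A : R -> R) by apply: measurable_indic.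
rewrite (@torus_reflect R x (fun y => (\1_A y)%:E)); last 3 first.
- exact/measurable_EFinP.
- by move=> y; rewrite lee_fin indicE.
- by move=> y; rewrite !indicE pA.
by rewrite (@integral_indic _ (measurableTypeR R) R tm setT measurableT A mA) setIT.
Qed.

(** Below the level lam m, the function w is at most the sum of the layers
    lam k.+1 on the sets where w exceeds lam k, and the potential of each of these
    sets is bounded by the bathtub principle. *)
Lemma kconv_low (lam : nat -> R) m x : lam 0%N = 0 -> (forall k, 0 <= lam k) ->
  (forall k, (tm [set u | (lam k < w u)%R] <= (2^-1 ^+ k)%:E)%E) ->
  (kconv (fun x => if w x <= lam m then w x else 0)%R x <=
    ((1 + al^-1) * N%:R `^ al * \sum_(k < m) lam k.+1 * (2^-1 ^+ k) `^ al)%:E)%E.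
Proof.
move=> lam0 lamp hlam.
pose E k := [set u | (lam k < w u)%R].
have mE k : measurable_fun setT (\1_(E k) : R -> R).
  apply: measurable_indic; rewrite -[E k]setTI (_ : E k = w @^-1` `]lam k, +oo[).
    by apply: mw => //; exact: measurable_itv.
  by apply/seteqP; split => u /=; rewrite /E/= in_itv/= andbT.
have Ei k (u : R) : 0 <= \1_(E k) u :> R by rewrite indicE.
have wle u : (if w u <= lam m then w u else 0) <= \sum_(k < m) lam k.+1 * \1_(E k) u.
  elim: (m) => [|n IH].
    by rewrite big_ord0 lam0; case: ifP.
  rewrite big_ord_recr/=; case: ifPn => wn; last first.
    by rewrite addr_ge0 ?mulr_ge0//; apply: sumr_ge0 => k _; rewrite mulr_ge0.
  have [h|h] := leP (w u) (lam n).
    by rewrite h in IH; rewrite ler_wpDr ?mulr_ge0.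
  rewrite ler_wpDl//; first by apply: sumr_ge0 => k _; rewrite mulr_ge0.
  by rewrite indicE mem_set// mulr1.
have k0 y : 0 <= kappa al N y by exact: kappa_ge0.
have mt k : measurable_fun setT (fun y : R => kappa al N y * (\1_(E k) (x - y) : R)).
  apply: measurable_funM; first exact: measurable_kappa.
  by apply: (measurableT_comp (mE k)); exact: measurable_opp_shift.
have t0 k y : 0 <= kappa al N y * (\1_(E k) (x - y) : R) by rewrite mulr_ge0.
apply: (@le_trans _ _ (\int[tm]_y (\sum_(k < m) ((lam k.+1)%:E * (kappa al N y * (\1_(E k) (x - y) : R))%:E)))%E).
  apply: le_integral_ge0 => y _.
    by rewrite lee_fin mulr_ge0//; case: ifP.
  rewrite (eq_bigr (fun k : 'I_m => (kappa al N y * (lam k.+1 * \1_(E k) (x - y)))%:E)); last first.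
    by move=> k _; rewrite -EFinM; congr EFin; ring.
  by rewrite sumEFin lee_fin -mulr_sumr ler_wpM2l.
rewrite ge0_integral_sum//; last 2 first.
- by move=> k; apply: emeasurable_funM => //; apply/measurable_EFinP; exact: mt.
- by move=> k y _; rewrite -EFinM lee_fin mulr_ge0.
rewrite mulr_sumr -sumEFin; apply: lee_sum => k _.
rewrite (tm_Zl (lamp k.+1) (mt k) (t0 k)).
rewrite (_ : (_ * (_ * _))%:E = (lam k.+1)%:E * ((1 + al^-1) * (N%:R * (2^-1 ^+ k)) `^ al)%:E)%E; last first.
  by rewrite -EFinM powRM ?exprn_ge0 ?invr_ge0//; congr EFin; ring.
rewrite lee_wpmul2l ?lee_fin//.
have mD : measurable_fun setT (fun y : R => (\1_(E k) (x - y) : R)).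
  by apply: (measurableT_comp (mE k)); exact: measurable_opp_shift.
have D01 (y : R) : 0 <= (\1_(E k) (x - y) : R) <= 1.
  by rewrite Ei/= indicE; case: (x - y \in E k); rewrite ?lexx ?ler01.
by apply: (tm_kappa al0 al1 N0 mD D01); rewrite tm_superlevel.
Qed.

(** Split w at the level lam m. The low part has a bounded potential. The points
    where the potential of the high part is too large, and those where the
    oscillation is too large, form two exceptional sets of measure at most 2^-m
    each. Everywhere else [pointwise_level] applies. *)
Lemma level_set (lam : nat -> R) m (T l X : R) : lam 0%N = 0 -> (forall k, 0 <= lam k) ->
  (forall k, (tm [set u | (lam k < w u)%R] <= (2^-1 ^+ k)%:E)%E) ->
  0 < T -> (\int[tm]_x (if w x <= lam m then 0 else w x)%R%:E <= T%:E)%E ->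
  0 < l -> 0 <= X -> X <= l `^ p * 2^-1 ^+ m ->
  (forall y, 0 <= y -> y <= N%:R^-1 -> (pint p (fun x => g x - g (x - y))%R <= X%:E)%E) ->
  (tm [set x | ((2 * ((1 + al^-1) * N%:R `^ al *
     (\sum_(k < m) lam k.+1 * (2^-1 ^+ k) `^ al + T * (2^-1 ^+ m) `^ (al - 1))) + 2 * l) < `|g x|)%R]
   <= (2^-1 ^+ m + 2^-1 ^+ m)%:E)%E.
Proof.
move=> lam0 lamp hlam T0 hT l0 X0 hX hd.
set s := 2^-1 ^+ m in hX *; have s0 : 0 < s by rewrite exprn_gt0// invr_gt0.
pose Fl x := if w x <= lam m then w x else 0; pose Fh x := if w x <= lam m then 0 else w x.
have mle : measurable_fun setT (fun x => w x <= lam m) by apply: measurable_fun_ler.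
have mFl : measurable_fun setT Fl by apply: measurable_fun_ifT.
have mFh : measurable_fun setT Fh by apply: measurable_fun_ifT.
have Fl0 x : 0 <= Fl x by rewrite /Fl; case: ifP.
have Fh0 x : 0 <= Fh x by rewrite /Fh; case: ifP.
have pFh : per Fh by move=> x; rewrite /Fh pw.
pose lo := (1 + al^-1) * N%:R `^ al * \sum_(k < m) lam k.+1 * (2^-1 ^+ k) `^ al.
pose be := (1 + al^-1) * N%:R `^ al * T * s `^ (al - 1).
have lo0 : 0 <= lo.
  rewrite !mulr_ge0 ?powR_ge0 ?addr_ge0 ?invr_ge0 ?(ltW al0)//.
  by apply: sumr_ge0 => k _; rewrite mulr_ge0 ?powR_ge0.
have be0 : 0 <= be by rewrite !mulr_ge0 ?powR_ge0 ?addr_ge0 ?invr_ge0 ?(ltW al0) ?(ltW T0).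
have hA := kconv_high mFh pFh Fh0 T0 hT s0 erefl.
rewrite -/be in hA.
set A := [set x | _] in hA.
have mA : measurable (A : set (measurableTypeR R)).
  by rewrite -[A]setTI; apply: emeasurable_fun_o_infty => //; exact: measurable_kconv.
pose B := [set x | ((l `^ p)%:E < osc x)%E].
have mB : measurable (B : set (measurableTypeR R)).
  by rewrite -[B]setTI; apply: emeasurable_fun_o_infty => //; exact: measurable_osc.
have lp0 : 0 < l `^ p by rewrite powR_gt0.
have hB : (tm B <= s%:E)%E.
  have h := integral_osc_le X0 hd.
  have := @le_integral_abse _ (measurableTypeR R) R tm setT measurableT osc (l `^ p) measurable_osc lp0.
  rewrite setTI => h2.
  have h3 : ((l `^ p)%:E * tm B <= (l `^ p * s)%:E)%E.
    apply: (@le_trans _ _ X%:E); last by rewrite lee_fin.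
    apply: le_trans h; under [leRHS]eq_integral => x _ do rewrite -(gee0_abs (osc_ge0 x)).
    apply: le_trans h2; rewrite lee_wpmul2l ?lee_fin ?(ltW lp0)//.
    apply: le_measure; rewrite ?inE.
    - exact: mB.
    - rewrite -[X in measurable X]setTI; apply: emeasurable_fun_c_infty => //.
      by apply: measurableT_comp => //; exact: measurable_osc.
    - by move=> x; rewrite /B/= => /ltW h4; apply: le_trans h4 _; rewrite gee0_abs// osc_ge0.
  have fB : tm B \is a fin_num by exact: torus_fin_num.
  by move: h3; rewrite -(fineK fB) -EFinM !lee_fin ler_pM2l.
rewrite EFinD; apply: (@le_trans _ _ (tm (A `|` B))); last first.
  by apply: le_trans (measureU2 _ _ _) _ => //; apply: leeD.
have mG : measurable ([set x | ((2 * ((1 + al^-1) * N%:R `^ al *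
     (\sum_(k < m) lam k.+1 * (2^-1 ^+ k) `^ al + T * s `^ (al - 1))) + 2 * l) < `|g x|)%R] : set (measurableTypeR R)).
  set c := (_ + _)%R.
  rewrite -[X in measurable X]setTI (_ : [set x | _] = (fun x => `|g x|) @^-1` `]c, +oo[).
    have mn : measurable_fun setT (fun x => `|g x|) by exact: measurableT_comp.
    by apply: mn => //; exact: measurable_itv.
  by apply/seteqP; split => u /=; rewrite in_itv/= andbT.
apply: le_measure; rewrite ?inE; [exact: mG|exact: measurableU|].
move=> x /= hx; apply: contrapT => /not_orP[nA nB].
move: hx; apply/negP; rewrite -leNgt.
move/negP: nA; rewrite /A/= -leNgt => nA.
move/negP: nB; rewrite /B/= -leNgt => nB.
rewrite (_ : 2 * _ = 2 * (lo + be)); last by rewrite /lo /be; ring.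
apply: pointwise_level => //; first exact: addr_ge0.
have k0 y : 0 <= kappa al N y by exact: kappa_ge0.
have mx F : measurable_fun setT F -> measurable_fun setT (fun y : R => (kappa al N y * F (x - y))%:E).
  move=> mF; apply/measurable_EFinP; apply: measurable_funM; first exact: measurable_kappa.
  by apply: (measurableT_comp mF); exact: measurable_opp_shift.
have -> : kconv w x = (kconv Fl x + kconv Fh x)%E.
  rewrite /kconv -ge0_integralD//; [|by move=> y _; rewrite lee_fin mulr_ge0|exact: mx|by move=> y _; rewrite lee_fin mulr_ge0|exact: mx].
  apply: eq_integral => y _; rewrite -EFinD -mulrDr; congr (_ * _)%:E.
  by rewrite /Fl /Fh; case: ifP; rewrite ?addr0 ?add0r.
by rewrite EFinD; apply: leeD => //; exact: kconv_low.
Qed.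

End level.
End smoothing.

(** * Schur test and dyadic levels *)

Section schur.
Context {R : realType}.
Implicit Types (rho p C : R) (m k n : nat).

(** The exponent is the distance of m and k, as one of the truncated differences
    vanishes. *)
Lemma sum_dist_le rho m n : 0 <= rho -> rho < 1 ->
  \sum_(k < n) rho ^+ ((m - k) + (k - m)) <= 2 / (1 - rho).
Proof.
move=> r0 r1; have d0 : 0 < 1 - rho by rewrite subr_gt0.
have low j : (j <= m)%N -> \sum_(k < j) rho ^+ ((m - k) + (k - m)) <= rho ^+ (m.+1 - j) / (1 - rho).
  elim: j => [|j IH] jm; first by rewrite big_ord0 divr_ge0 ?exprn_ge0// ltW.
  rewrite big_ord_recr/=; apply: le_trans (lerD (IH (ltnW jm)) (lexx _)) _.
  rewrite (_ : (j - m = 0)%N); last by apply/eqP; rewrite subn_eq0 ltnW.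
  rewrite addn0 subSS subSn ?(ltnW jm)// ler_pdivlMr// mulrDl divfK ?gt_eqF//.
  by rewrite exprS mulrBr mulr1 [_ * rho]mulrC addrC subrK.
have high j : \sum_(k < m + j) rho ^+ ((m - k) + (k - m)) <= (2 - rho ^+ j) / (1 - rho).
  elim: j => [|j IH].
    rewrite addn0 expr0; apply: le_trans (low _ (leqnn m)) _.
    rewrite subSnn expr1 ler_pM2r ?invr_gt0//; lra.
  rewrite addnS big_ord_recr/=; apply: le_trans (lerD IH (lexx _)) _.
  rewrite addKn (_ : (m - (m + j) = 0)%N); last by apply/eqP; rewrite subn_eq0 leq_addr.
  rewrite add0n ler_pdivlMr// mulrDl divfK ?gt_eqF// exprS.
  by rewrite mulrBr mulr1 [_ * rho]mulrC addrA subrK.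
have [nm|mn] := leqP n m.
  apply: le_trans (low _ nm) _; rewrite ler_pM2r ?invr_gt0//.
  have := exprn_ile1 (m.+1 - n) r0 (ltW r1); lra.
rewrite -(subnKC (ltnW mn)); apply: le_trans (high _) _.
by rewrite ler_pM2r ?invr_gt0// lerBlDr lerDl exprn_ge0.
Qed.

(** Schur's test: Jensen's inequality in each row, then the column sums. *)
Lemma schur_le p C (th : nat -> nat -> R) (nu : nat -> R) n : 1 <= p ->
  (forall m k, 0 <= th m k) -> (forall k, 0 <= nu k) ->
  (forall m, \sum_(k < n) th m k <= C) -> (forall k, \sum_(m < n) th m k <= C) ->
  \sum_(m < n) (\sum_(k < n) th m k * nu k) `^ p <= C `^ p * \sum_(k < n) nu k `^ p.
Proof.
move=> p1 th0 nu0 row col.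
have C0 : 0 <= C by apply: le_trans (row 0%N); apply: sumr_ge0.
apply: (@le_trans _ _ (\sum_(m < n) C `^ (p - 1) * \sum_(k < n) th m k * nu k `^ p)).
  apply: ler_sum => m _.
  apply: le_trans (@powR_sum_le R _ _ xpredT (fun k : 'I_n => th m k) (fun k : 'I_n => nu k) p p1 _ _) _ => //.
  rewrite ler_wpM2r//; first by apply: sumr_ge0 => k _; rewrite mulr_ge0 ?powR_ge0.
  by apply: ge0_ler_powR; rewrite ?nnegrE ?subr_ge0//; exact: sumr_ge0.
rewrite -mulr_sumr exchange_big/= -[C `^ p]mulr_powRB1 ?(lt_le_trans ltr01 p1)//.
rewrite [C * _]mulrC -mulrA ler_wpM2l ?powR_ge0// mulr_sumr; apply: ler_sum => k _.
by rewrite -mulr_suml ler_wpM2r ?powR_ge0.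
Qed.

Lemma abel_half (t : nat -> R) n :
  \sum_(k < n) (t k.+1 - t k) * 2^-1 ^+ k.+1 =
  2^-1 ^+ n * t n + \sum_(k < n) 2^-1 ^+ k.+1 * t k - t 0%N.
Proof.
elim: n => [|j IH]; first by rewrite !big_ord0 expr0 mul1r addr0 subrr.
by rewrite !big_ord_recr/= IH exprS; field.
Qed.

(** The sum telescopes up to the last level below x. *)
Lemma sum_layers_le p (s : nat -> R) (x : R) n : 0 <= x -> 0 < p -> (forall k, 0 <= s k) ->
  s 0%N = 0 -> (forall k m, (k <= m)%N -> s k <= s m) ->
  \sum_(k < n) (s k.+1 `^ p - s k `^ p) * (s k.+1 < x)%R%:R <= x `^ p.
Proof.
move=> x0 p0 s0 s00 sle.
suff : \sum_(k < n) (s k.+1 `^ p - s k `^ p) * (s k.+1 < x)%R%:R <= x `^ p /\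
    (s n < x -> \sum_(k < n) (s k.+1 `^ p - s k `^ p) * (s k.+1 < x)%R%:R = s n `^ p) by case.
elim: n => [|j [IH1 IH2]].
  by rewrite big_ord0 s00 powR_ge0 powR0 ?gt_eqF.
rewrite !big_ord_recr/=; have [h|h] := ltP (s j.+1) x; last by rewrite mulr0 addr0.
rewrite mulr1 IH2; last by apply: le_lt_trans h; rewrite sle.
rewrite addrC subrK; split=> //.
by rewrite ge0_ler_powR ?nnegrE ?(ltW p0) ?s0 ?(ltW h).
Qed.

End schur.

Section levels.
Context {R : realType}.
Local Notation tm := (@torus_measure R).
Implicit Types (w : R -> R) (p : R).

Lemma measurable_superlevel w (s : R) : measurable_fun setT w ->
  measurable ([set x | (s < w x)%R] : set (measurableTypeR R)).
Proof.
move=> mw; rewrite -[X in measurable X]setTI (_ : [set x | _] = w @^-1` `]s, +oo[).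
  by apply: mw => //; exact: measurable_itv.
by apply/seteqP; split => u /=; rewrite in_itv/= andbT.
Qed.

Lemma le_superlevel w (s t : R) : measurable_fun setT w -> s <= t ->
  (tm [set x | (t < w x)%R] <= tm [set x | (s < w x)%R])%E.
Proof.
move=> mw st; apply: le_measure; rewrite ?inE; do ?exact: measurable_superlevel.
by move=> x /=; exact: le_lt_trans.
Qed.

Lemma markov_superlevel p w (B s : R) : 0 < p -> measurable_fun setT w -> (forall x, 0 <= w x) ->
  (pint p w <= B%:E)%E -> 0 < s -> ((s `^ p)%:E * tm [set x | (s < w x)%R] <= B%:E)%E.
Proof.
move=> p0 mw w0 hB s0; apply: le_trans hB.
have mE := measurable_superlevel s mw.
have sp0 : 0 <= s `^ p by exact: powR_ge0.
have -> : ((s `^ p)%:E * tm [set x | (s < w x)%R] =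
   \int[tm]_x ((s `^ p)%:E * (\1_[set x | (s < w x)%R] x : R)%:E))%E.
  have mI : measurable_fun setT (fun x : R => \1_[set x | (s < w x)%R] x : R).
    by apply: measurable_indic.
  rewrite (tm_Zl sp0 mI)//.
  by rewrite (@integral_indic _ (measurableTypeR R) R tm setT measurableT _ mE) setIT.
apply: le_integral_ge0 => x _; first by rewrite mule_ge0 ?lee_fin.
rewrite -EFinM lee_fin indicE; case: (boolP (x \in _)) => h; last by rewrite mulr0 powR_ge0.
rewrite mulr1 ger0_norm//; apply: ge0_ler_powR; rewrite ?nnegrE ?(ltW p0) ?(ltW s0)//.
by move: h; rewrite inE/= => /ltW.
Qed.

Let S w k := [set s : R | 0 <= s /\ (tm [set x | (s < w x)%R] <= (2^-1 ^+ k)%:E)%E].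

(** The decreasing rearrangement of w at 2^-k. *)
Definition lev w k : R := inf (S w k).

Section lev.
Context p w (B : R) (p1 : 1 <= p) (mw : measurable_fun setT w) (w0 : forall x, 0 <= w x).
Context (hB : (pint p w <= B%:E)%E).

Let p0 : 0 < p. Proof. exact: lt_le_trans p1. Qed.
Let B0 : 0 <= B. Proof. by rewrite -lee_fin (le_trans _ hB)// pint_ge0. Qed.

Let hasS k : has_inf (S w k).
Proof.
split; last by exists 0 => s [].
have h0 : 0 < 2^-1 ^+ k :> R by rewrite exprn_gt0// invr_gt0.
pose s : R := ((B + 1) / 2^-1 ^+ k) `^ p^-1.
have s0 : 0 < s by rewrite powR_gt0// divr_gt0// ltr_wpDl.
exists s; split; first exact: ltW.
have := markov_superlevel p0 mw w0 hB s0.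
have f : tm [set x | (s < w x)%R] \is a fin_num.
  by apply: torus_fin_num; exact: measurable_superlevel.
rewrite -(fineK f) -EFinM !lee_fin /s -powRrM mulVf ?gt_eqF// powRr1; last first.
  by rewrite divr_ge0 ?addr_ge0// ltW.
move=> h; rewrite -(@ler_pM2l _ ((B + 1) / 2^-1 ^+ k)) ?divr_gt0 ?ltr_wpDl//.
by rewrite divfK ?gt_eqF//; apply: le_trans h _; rewrite lerDl.
Qed.

Lemma lev_ge0 k : 0 <= lev w k.
Proof. by apply: lb_le_inf; [exact: (hasS k).1|move=> s []]. Qed.

Lemma lev0 : lev w 0 = 0.
Proof.
apply/eqP; rewrite eq_le lev_ge0 andbT; apply: (ge_inf (hasS 0).2).
split => //; rewrite expr0 -torus_measureT; apply: le_measure; rewrite ?inE//.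
exact: measurable_superlevel.
Qed.

Lemma lev_le k m : (k <= m)%N -> lev w k <= lev w m.
Proof.
move=> km; apply: lb_le_inf; first exact: (hasS m).1.
move=> s [s0 hs]; apply: (ge_inf (hasS k).2); split => //; apply: le_trans hs _.
by rewrite lee_fin ler_wiXn2l// ?invr_ge0// invf_le1 ?ler1n.
Qed.

Lemma lev_superlevel k : (tm [set x | (lev w k < w x)%R] <= (2^-1 ^+ k)%:E)%E.
Proof.
pose F n := [set x : R | (lev w k + n.+1%:R^-1 < w x)%R].
have -> : [set x | (lev w k < w x)%R] = \bigcup_n F n.
  apply/seteqP; split => x /=.
    move=> h; have [n hn] : exists n : nat, n.+1%:R^-1 < w x - lev w k.
      have := @near_infty_natSinv_lt R (PosNum (etrans (subr_gt0 _ _) h)).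
      by move=> [n _ /(_ _ (leqnn n))] /= hn; exists n.
    by exists n => //; rewrite /F/= -ltrBrDl.
  by move=> [n _]; rewrite /F/=; apply: lt_trans; rewrite ltrDl invr_gt0.
have mF n : measurable (F n : set (measurableTypeR R)) by exact: measurable_superlevel.
have mU : measurable (\bigcup_n F n : set (measurableTypeR R)) by exact: bigcup_measurable.
have nd : nondecreasing_seq F.
  apply/nondecreasing_seqP => n; apply/subsetPset => x; rewrite /F/=; apply: le_lt_trans.
  by rewrite lerD2l lef_pV2 ?posrE// ler_nat.
have cv := @nondecreasing_cvg_mu _ (measurableTypeR R) R tm F mF mU nd.
rewrite -(cvg_lim _ cv)//; apply: lime_le; first by apply/cvg_ex; eexists; exact: cv.
apply: nearW => n /=.
have [s [s0 hs] sl] := @inf_adherent R (S w k) n.+1%:R^-1 (eqbRL (invr_gt0 _) (ltr0Sn _ _)) (hasS k).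
apply: le_trans hs; apply: le_superlevel => //.
by rewrite -/(lev w k) in sl; exact: ltW.
Qed.

(** Half of a positive level is strictly below the infimum that defines it, so the
    set where w exceeds it has measure more than 2^-k. The integral of w^p is
    at least the sum of the increments of the p-th powers of the half levels times
    these measures, and Abel summation brings it to the stated form. *)
Lemma sum_lev_le n : \sum_(k < n) 2^-1 ^+ k * lev w k `^ p <= 2 * 2 `^ p * B.
Proof.
pose s k := 2^-1 * lev w k.
have s0 k : 0 <= s k by rewrite mulr_ge0 ?invr_ge0 ?lev_ge0.
have sle k m : (k <= m)%N -> s k <= s m by move=> km; rewrite ler_wpM2l ?invr_ge0 ?lev_le.
pose c k := s k.+1 `^ p - s k `^ p.
have c0 k : 0 <= c k by rewrite subr_ge0 ge0_ler_powR ?nnegrE ?(ltW p0) ?sle.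
have ss00 : s 0%N = 0 by rewrite /s lev0 mulr0.
have ss0 : s 0%N `^ p = 0 by rewrite ss00 powR0 ?gt_eqF.
pose E k := [set x | (s k.+1 < w x)%R].
have mE k : measurable (E k : set (measurableTypeR R)) by exact: measurable_superlevel.
have mI k : measurable_fun setT (\1_(E k) : R -> R) by apply: measurable_indic; exact: mE.
have pt x := sum_layers_le n (w0 x) p0 s0 ss00 sle.
have tE k : c k * 2^-1 ^+ k.+1 <= c k * fine (tm (E k)).
  have [c00|cn] := eqVneq (c k) 0; first by rewrite c00 !mul0r.
  rewrite ler_wpM2l// -lee_fin fineK ?torus_fin_num//.
  have sk : s k.+1 < lev w k.+1.
    suff l0 : 0 < lev w k.+1 by rewrite /s; lra.
    rewrite lt_neqAle lev_ge0 andbT; apply: contra cn => /eqP l0.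
    have lk : lev w k = 0 by apply/eqP; rewrite eq_le lev_ge0 andbT l0 lev_le.
    by rewrite /c /s -l0 lk subrr.
  rewrite leNgt; apply/negP => /ltW h; move: sk; apply/negP; rewrite -leNgt.
  by apply: (ge_inf (hasS k.+1).2).
have hI : \sum_(k < n) c k * 2^-1 ^+ k.+1 <= B.
  apply: le_trans (ler_sum _ (fun (k : 'I_n) _ => tE k)) _.
  rewrite -lee_fin; apply: le_trans hB; rewrite -sumEFin.
  have -> : (\sum_(k < n) (c k * fine (tm (E k)))%:E = \int[tm]_x \sum_(k < n) ((c k)%:E * (\1_(E k) x : R)%:E))%E.
    rewrite ge0_integral_sum//; last 2 first.
    - by move=> k; apply: emeasurable_funM => //; apply/measurable_EFinP.
    - by move=> k x _; rewrite mule_ge0 ?lee_fin ?indicE.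
    apply: eq_bigr => k _; rewrite (tm_Zl (c0 k) (mI k)); last by move=> y; rewrite indicE.
    rewrite (@integral_indic _ (measurableTypeR R) R tm setT measurableT _ (mE k)) setIT.
    by rewrite EFinM fineK ?torus_fin_num.
  apply: le_integral_ge0 => x _.
    by apply: sume_ge0 => k _; rewrite mule_ge0 ?lee_fin ?indicE.
  rewrite (eq_bigr (fun k : 'I_n => (c k * \1_(E k) x)%:E))// sumEFin lee_fin ger0_norm//.
  apply: le_trans (pt x); apply: eq_ler; apply: eq_bigr => k _.
  rewrite indicE; congr (_ * (nat_of_bool _)%:R); apply/idP/idP => [/set_mem//|h].
  exact: (@mem_set _ (E k) x h).
move: hI; rewrite (abel_half (fun k => s k `^ p)) ss0 subr0 => hI.
have hs : \sum_(k < n) 2^-1 ^+ k.+1 * s k `^ p <= B.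
  by apply: le_trans hI; rewrite lerDr mulr_ge0 ?powR_ge0 ?exprn_ge0 ?invr_ge0.
have -> : \sum_(k < n) 2^-1 ^+ k * lev w k `^ p = 2 * 2 `^ p * \sum_(k < n) 2^-1 ^+ k.+1 * s k `^ p.
  rewrite mulr_sumr; apply: eq_bigr => k _.
  rewrite /s powRM ?invr_ge0 ?lev_ge0// exprS.
  have -> : 2^-1 `^ p = (2 `^ p)^-1 :> R by rewrite -powR_inv1// -powRrM mulN1r powRN.
  by field; rewrite gt_eqF ?powR_gt0.
by rewrite ler_wpM2l ?mulr_ge0 ?powR_ge0.
Qed.

End lev.
End levels.

(** * The sum over dyadic levels *)

Section dyadic_powers.
Context {R : realType}.
Local Notation D k := (2^-1 ^+ k : R).
Implicit Types (s t rho : R) (j k m n : nat).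

Lemma dy_gt0 k : 0 < D k. Proof. by rewrite exprn_gt0// invr_gt0. Qed.

Lemma dy_ge0 k : 0 <= D k. Proof. exact: ltW (dy_gt0 k). Qed.

Lemma dyD j k : D (j + k)%N = D j * D k. Proof. exact: exprD. Qed.

Lemma dyV k : (2 ^ k)%:R^-1 = D k. Proof. by rewrite exprVn natrX. Qed.

Lemma dy_powR s k : D k `^ s = (2^-1 `^ s) ^+ k.
Proof. by rewrite -[D k]powR_mulrn ?invr_ge0// -powRrM mulrC powRrM powR_mulrn// powR_ge0. Qed.

Lemma half_powR_lt1 s : 0 < s -> (2^-1 : R) `^ s < 1.
Proof.
move=> s0; have e : (1 : R) `^ s = 1 by rewrite powR1.
rewrite -[X in _ < X]e gt0_ltr_powR ?nnegrE//.
by rewrite invf_lt1// ltr1n.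
Qed.

Lemma half_powR_le s t : s <= t -> (2^-1 : R) `^ t <= 2^-1 `^ s.
Proof.
move=> st; rewrite -[t](subrK s) addrC powRD_pos ?invr_gt0// ler_piMr ?powR_ge0//.
have e : (1 : R) `^ (t - s) = 1 by rewrite powR1.
rewrite -[X in _ <= X]e ge0_ler_powR ?nnegrE ?subr_ge0//.
by rewrite invf_le1// ler1n.
Qed.

(** A scale k coarser than m contributes to the level m with a geometric loss in
    the distance of the scales. *)
Lemma dy_low_le al a d k m : 0 < d -> d <= a -> (k <= m)%N ->
  D m `^ a * D k `^ al <= (2^-1 `^ d) ^+ ((m - k) + (k - m)) * D k `^ (a + al).
Proof.
move=> d0 da km; have -> : (k - m = 0)%N by apply/eqP; rewrite subn_eq0.
rewrite addn0 -[in D m `^ a](subnK km) dyD powRM ?(ltW (dy_gt0 _))//.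
rewrite powRD_pos ?dy_gt0// mulrA ler_wpM2r ?powR_ge0// ler_wpM2r ?powR_ge0//.
by rewrite dy_powR lerXn2r ?nnegrE ?powR_ge0// half_powR_le.
Qed.

(** The same loss for the scales finer than m. *)
Lemma dy_high_le al a d k m : 0 < d -> d <= 1 - (a + al) -> (m <= k)%N ->
  D m `^ a * (D k * D m `^ (al - 1)) <= (2^-1 `^ d) ^+ ((m - k) + (k - m)) * D k `^ (a + al).
Proof.
move=> d0 da mk; have -> : (m - k = 0)%N by apply/eqP; rewrite subn_eq0.
rewrite add0n mulrCA -powRD_pos ?dy_gt0// addrA.
have e : D k = D k `^ (1 - (a + al)) * D k `^ (a + al).
  by rewrite -powRD_pos ?dy_gt0// subrK powRr1// ltW// dy_gt0.
rewrite {1}e mulrAC ler_wpM2r ?powR_ge0//.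
rewrite -[in D k `^ _](subnK mk) dyD powRM ?(ltW (dy_gt0 _))// -mulrA -powRD_pos ?dy_gt0//.
rewrite (_ : 1 - (a + al) + (a + al - 1) = 0) ?powRr0 ?mulr1; last by ring.
by rewrite dy_powR lerXn2r ?nnegrE ?powR_ge0// half_powR_le.
Qed.

(** Either x exceeds all the levels up to n, or the first level above it occurs
    in the sum. *)
Lemma layers_or (lam : nat -> R) (x : R) m n : (forall k, 0 <= lam k) -> lam m < x -> (m <= n)%N ->
  x <= \sum_(k < n) (m <= k)%:R * lam k.+1 * (lam k < x)%R%:R \/ lam n < x.
Proof.
move=> l0 lm; elim: n => [|n IH]; first by rewrite leqn0 => /eqP <-; right.
rewrite leq_eqVlt => /predU1P[<-|]; first by right.
rewrite ltnS => mn; case: (IH mn) => h.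
  by left; rewrite big_ord_recr/= ler_wpDr// !mulr_ge0.
have [h1|h1] := ltP (lam n.+1) x; [by right|left].
rewrite big_ord_recr/= mn h mul1r mulr1 ler_wpDl//.
by apply: sumr_ge0 => k _; rewrite !mulr_ge0.
Qed.

(** The bound given by [level_set] at the level m is a sum over the scales k. After
    multiplication by D m ^ (p^-1 - al), the coefficient of D k ^ (p^-1) mu k decays
    like a power of 2^-|m - k|, by [dy_low_le] and [dy_high_le], so that Schur's test
    applies. The remaining terms l m form a geometric sum dominated by m = M. *)
Lemma level_sum_le p al : 1 < p -> 0 < al -> al < p^-1 ->
  exists2 C : R, 0 < C & forall (Q A B E : R) (M : nat) (mu l : nat -> R),
   0 <= Q -> 0 <= A -> 0 <= B -> 0 <= E -> (forall k, 0 <= mu k) -> (forall m, 0 <= l m) ->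
   \sum_(k < M.+1) D k * mu k `^ p <= E * Q ->
   (forall m, l m `^ p * D m <= B * Q) ->
   \sum_(m < M.+1) (D m `^ (p^-1 - al) *
     (A * D M `^ (- al) * (\sum_(k < M.+1) (k < m)%:R * (mu k * D k `^ al) +
       (\sum_(k < M.+1) (m <= k)%:R * (mu k * D k)) * D m `^ (al - 1)) + l m)) `^ p <=
   C * (A `^ p * E + B) * (D M `^ (- (al * p)) * Q).
Proof.
move=> p1 al0 alp; have p0 : 0 < p by exact: lt_trans p1.
have pV1 : p^-1 < 1 by rewrite invf_lt1.
pose a := p^-1 - al; have a0 : 0 < a by rewrite subr_gt0.
(* the geometric losses are positive because al < p^-1 and p > 1 *)
pose d := Num.min a (1 - p^-1).
have d0 : 0 < d by rewrite lt_min a0 subr_gt0.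
have da : d <= a by rewrite ge_min lexx.
have dp : d <= 1 - (a + al) by rewrite /a subrK ge_min lexx orbT.
pose rho := (2^-1 : R) `^ d; pose tau := (2^-1 : R) `^ (al * p).
have r0 : 0 <= rho by exact: powR_ge0.
have r1 : rho < 1 by exact: half_powR_lt1.
have t0 : 0 <= tau by exact: powR_ge0.
have t1 : tau < 1 by apply: half_powR_lt1; rewrite mulr_gt0.
pose K := (2 / (1 - rho)) `^ p; pose L := 2 / (1 - tau).
have K0 : 0 < K by rewrite powR_gt0// divr_gt0// subr_gt0.
have L0 : 0 < L by rewrite divr_gt0// subr_gt0.
exists (2 `^ p * (K + L)); first by rewrite mulr_gt0 ?powR_gt0// addr_gt0.
move=> Q A B E M mu l Q0 A0 B0 E0 mu0 l0 hmu hl.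
pose nu k := D k `^ p^-1 * mu k.
have nu0 k : 0 <= nu k by rewrite mulr_ge0 ?powR_ge0.
pose S m := \sum_(k < M.+1) rho ^+ ((m - k) + (k - m)) * nu k.
have S0 m : 0 <= S m by apply: sumr_ge0 => k _; rewrite mulr_ge0 ?exprn_ge0.
have dM0 : 0 <= D M `^ (- al) by exact: powR_ge0.
pose G := A * D M `^ (- al); have G0 : 0 <= G by rewrite mulr_ge0.
have hS m : D m `^ a * (\sum_(k < M.+1) (k < m)%:R * (mu k * D k `^ al) +
       (\sum_(k < M.+1) (m <= k)%:R * (mu k * D k)) * D m `^ (al - 1)) <= S m.
  rewrite mulr_suml -big_split/= mulr_sumr; apply: ler_sum => k _.
  rewrite /nu; have [km|mk] := ltnP k m.
    rewrite mul1r !mul0r addr0 mulrCA [leRHS]mulrA [leRHS]mulrC ler_wpM2l//.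
    by have := dy_low_le al d0 da (ltnW km); rewrite /a subrK.
  rewrite mul0r add0r mul1r -[mu k * _ * _]mulrA mulrCA [leRHS]mulrA [leRHS]mulrC ler_wpM2l//.
  by have := dy_high_le d0 dp mk; rewrite /a subrK.
have T0 m : 0 <= \sum_(k < M.+1) (k < m)%:R * (mu k * D k `^ al) +
       (\sum_(k < M.+1) (m <= k)%:R * (mu k * D k)) * D m `^ (al - 1).
  rewrite addr_ge0 ?mulr_ge0 ?powR_ge0//; by apply: sumr_ge0 => k _; rewrite !mulr_ge0 ?powR_ge0 ?exprn_ge0 ?invr_ge0.
apply: (@le_trans _ _ (\sum_(m < M.+1) 2 `^ p * (G `^ p * S m `^ p + (D m `^ a * l m) `^ p))).
  apply: ler_sum => m _; rewrite mulrDr.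
  apply: le_trans (powR_add_le (ltW p0) _ _) _; rewrite ?mulr_ge0 ?powR_ge0//.
  rewrite ler_wpM2l ?powR_ge0// lerD2r -powRM// mulrCA -/G.
  apply: ge0_ler_powR; rewrite ?nnegrE ?(ltW p0) ?mulr_ge0 ?powR_ge0//.
  by rewrite ler_wpM2l.
have Z0 : 0 <= D M `^ (- (al * p)) * Q by rewrite mulr_ge0 ?powR_ge0.
have h1 : \sum_(m < M.+1) G `^ p * S m `^ p <= K * (A `^ p * E) * (D M `^ (- (al * p)) * Q).
  rewrite -mulr_sumr; apply: le_trans (_ : G `^ p * (K * (E * Q)) <= _).
    rewrite ler_wpM2l ?powR_ge0//.
    apply: le_trans (@schur_le R p (2 / (1 - rho)) (fun m k => rho ^+ ((m - k) + (k - m))) nu M.+1 (ltW p1) _ nu0 _ _) _.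
    - by move=> m k; exact: exprn_ge0.
    - by move=> m; exact: sum_dist_le.
    - move=> k; rewrite (eq_bigr (fun m : 'I_M.+1 => rho ^+ ((k - m) + (m - k)))).
        exact: sum_dist_le.
      by move=> m _; rewrite addnC.
    rewrite -/K ler_wpM2l ?(ltW K0)//; apply: le_trans hmu; apply: ler_sum => k _.
    by rewrite /nu powRM ?powR_ge0// -powRrM mulVf ?gt_eqF// powRr1// ltW// dy_gt0.
  rewrite /G powRM// -powRrM mulNr; apply: eq_ler; ring.
have h2 : \sum_(m < M.+1) (D m `^ a * l m) `^ p <= L * B * (D M `^ (- (al * p)) * Q).
  apply: (@le_trans _ _ (\sum_(m < M.+1) tau ^+ ((M - m) + (m - M)) * (B * (D M `^ (- (al * p)) * Q)))).
    apply: ler_sum => m _; have mM : (m <= M)%N by rewrite -ltnS.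
    have -> : (m - M = 0)%N by apply/eqP; rewrite subn_eq0.
    rewrite addn0 powRM ?powR_ge0// -powRrM /a mulrBl mulVf ?gt_eqF//.
    have -> : D m `^ (1 - al * p) * l m `^ p = D m `^ (- (al * p)) * (l m `^ p * D m).
      by rewrite powRD_pos ?dy_gt0// powRr1 ?(ltW (dy_gt0 _))//; ring.
    apply: le_trans (_ : D m `^ (- (al * p)) * (B * Q) <= _).
      by rewrite ler_wpM2l ?powR_ge0.
    rewrite mulrCA [leRHS]mulrCA ler_wpM2l// mulrA ler_wpM2r//.
    rewrite /tau -dy_powR -[in D M](subnK mM) dyD powRM ?(ltW (dy_gt0 _))// mulrA -powRD_pos ?dy_gt0//.
    by rewrite subrr powRr0 mul1r.
  rewrite -mulr_suml -mulrA ler_wpM2r ?mulr_ge0 ?powR_ge0//.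
  exact: sum_dist_le.
rewrite -mulr_sumr big_split/= -!mulrA ler_wpM2l ?powR_ge0// mulrA.
apply: le_trans (lerD h1 h2) _; rewrite -mulrDl ler_wpM2r//.
rewrite mulrDl !mulrDr -addrA lerD2l addrA lerDr.
exact: addr_ge0 (mulr_ge0 (ltW K0) B0) (mulr_ge0 (ltW L0) (mulr_ge0 (powR_ge0 _ _) E0)).
Qed.

End dyadic_powers.

Section core.
Context {R : realType}.
Local Notation tm := (@torus_measure R).
Local Notation D k := (2^-1 ^+ k : R).

(** Between the levels m and M the function is at most a sum of layers; above the
    level M, its integral over a set of measure D M is bounded by
    [le_powR_chebyshev], with the threshold s that balances both terms. *)
Lemma integral_tail_le p (w : R -> R) (lam : nat -> R) (m M : nat) (s Q C : R) :
  1 < p -> measurable_fun setT w -> (forall x, 0 <= w x) -> (forall k, 0 <= lam k) ->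
  (forall k, (tm [set u | (lam k < w u)%R] <= (D k)%:E)%E) ->
  (pint p w <= (C * Q)%:E)%E -> 0 <= C -> 0 < s -> s `^ p * D M = Q -> (m <= M)%N ->
  (\int[tm]_x (if w x <= lam m then 0 else w x)%R%:E <=
    (\sum_(k < M) (m <= k)%:R * lam k.+1 * D k + (1 + C) * s * D M)%:E)%E.
Proof.
move=> p1 mw w0 lam0 hlam hw C0 s0 sQ mM.
have p0 : 0 < p by exact: lt_trans p1.
pose E k := [set u | (lam k < w u)%R].
have mE k : measurable (E k : set (measurableTypeR R)) by exact: measurable_superlevel.
have mI k : measurable_fun setT (\1_(E k) : R -> R) by apply: measurable_indic; exact: mE.
have I0 k x : 0 <= (\1_(E k) x : R) by rewrite indicE.
have IE k : (\int[tm]_x (\1_(E k) x : R)%:E = tm (E k))%E.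
  by rewrite (@integral_indic _ (measurableTypeR R) R tm setT measurableT _ (mE k)) setIT.
have i1 k x : (lam k < w x)%R%:R = (\1_(E k) x : R).
  rewrite indicE; congr ((nat_of_bool _)%:R); apply/idP/idP => [h|/set_mem//].
  exact: (@mem_set _ (E k) x h).
have mw2 : measurable_fun setT (fun x => `|w x| `^ p).
  by apply/measurable_EFinP; exact: measurable_pow.
pose c (k : nat) : R := (m <= k)%:R * lam k.+1.
have c0 k : 0 <= c k by rewrite mulr_ge0.
have s1 : 0 <= s `^ (1 - p) by exact: powR_ge0.
pose F1 x := (\sum_(k < M) (c k)%:E * (\1_(E k) x : R)%:E)%E.
pose F2 (x : R) := (s%:E * (\1_(E M) x : R)%:E)%E.
pose F3 (x : R) := ((s `^ (1 - p))%:E * (`|w x| `^ p)%:E)%E.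
have mF1 : measurable_fun setT F1.
  by apply: emeasurable_sum => k; apply: emeasurable_funM => //; exact/measurable_EFinP.
have mF2 : measurable_fun setT F2 by apply: emeasurable_funM => //; exact/measurable_EFinP.
have mF3 : measurable_fun setT F3 by apply: emeasurable_funM => //; exact/measurable_EFinP.
have F10 x : (0 <= F1 x)%E by apply: sume_ge0 => k _; rewrite mule_ge0 ?lee_fin.
have F20 x : (0 <= F2 x)%E by rewrite mule_ge0 ?lee_fin// ltW.
have F30 x : (0 <= F3 x)%E by rewrite mule_ge0 ?lee_fin ?powR_ge0.
apply: (@le_trans _ _ (\int[tm]_x (F1 x + F2 x + F3 x))%E).
  apply: le_integral_ge0 => x _; first by rewrite lee_fin; case: ifP.
  have eF1 : F1 x = (\sum_(k < M) c k * (lam k < w x)%R%:R)%:E.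
    by rewrite -sumEFin; apply: eq_bigr => k _; rewrite i1 EFinM.
  rewrite eF1 /F2 /F3 -i1 -!EFinM -!EFinD lee_fin ger0_norm//.
  have S0 : 0 <= \sum_(k < M) c k * (lam k < w x)%R%:R.
    by apply: sumr_ge0 => k _; rewrite mulr_ge0.
  case: ifPn => [_|]; first by rewrite !addr_ge0 ?mulr_ge0 ?powR_ge0// ltW.
  rewrite -ltNge => h; have [h1|h1] := layers_or lam0 h mM.
    by rewrite -addrA ler_wpDr// addr_ge0 ?mulr_ge0 ?powR_ge0// ltW.
  rewrite h1 mulr1 -addrA ler_wpDl//.
  exact: le_powR_chebyshev (ltW p1) s0 (w0 x).
rewrite ge0_integralD//; [|by move=> x _; rewrite adde_ge0|exact: emeasurable_funD].
rewrite ge0_integralD//.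
rewrite ge0_integral_sum//; last 2 first.
- by move=> k; apply: emeasurable_funM => //; exact/measurable_EFinP.
- by move=> k x _; rewrite mule_ge0 ?lee_fin.
rewrite (tm_Zl (ltW s0) (mI M) (I0 M)) IE (tm_Zl s1 mw2); last by move=> y; exact: powR_ge0.
have -> : (1 + C) * s * D M = s * D M + s `^ (1 - p) * (C * Q).
  rewrite -sQ mulrCA [s `^ (1 - p) * _]mulrA -powRD_pos// subrK powRr1 ?(ltW s0)//; ring.
rewrite addrA 2!EFinD; apply: leeD; first apply: leeD.
- rewrite -sumEFin; apply: lee_sum => k _.
  rewrite (tm_Zl (c0 k) (mI k) (I0 k)) IE [leRHS](EFinM (c k)).
  by apply: lee_wpmul2l; [rewrite lee_fin; exact: c0|exact: hlam].
- rewrite EFinM; apply: lee_wpmul2l; [by rewrite lee_fin ltW|exact: hlam].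
- by rewrite [leRHS]EFinM; apply: lee_wpmul2l; [rewrite lee_fin|exact: hw].
Qed.

(** The central estimate for real functions. The values Lam m are the levels that
    [level_set] attaches to the levels of the damped difference of step D M;
    [level_sum_le] sums them. *)
Lemma sum_level_powR_le (p al : R) : 1 < p -> 0 < al -> al < p^-1 ->
  exists2 C : R, 0 < C & forall (M : nat) (g : R -> R) (W V : R),
    measurable_fun setT g -> per g -> 0 <= W -> 0 <= V -> 0 < D M `^ (- al) * W + V ->
    (forall y, 0 <= y -> y <= D M -> (pint p (fdiff al y g) <= (W `^ p)%:E)%E) ->
    (pint p g <= (V `^ p)%:E)%E ->
    exists Lam : nat -> R,
      [/\ forall m, 0 <= Lam m,
         forall m, (m <= M)%N -> (tm [set x | (Lam m < `|g x|)%R] <= (2 * D m)%:E)%E &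
         \sum_(m < M.+1) (D m `^ (p^-1 - al) * Lam m) `^ p <= C * (D M `^ (- al) * W + V) `^ p].
Proof.
move=> p1 al0 alp; have p0 : 0 < p by exact: lt_trans p1.
have al1 : al < 1 by apply: lt_trans alp _; rewrite invf_lt1.
have [C C0 hC] := level_sum_le p1 al0 alp.
pose c1 : R := 2 `^ p * (1 + (al^-1 + (1 - al)^-1) `^ p).
have c10 : 0 < c1 by rewrite mulr_gt0 ?powR_gt0// ltr_wpDr ?powR_ge0.
pose c2 : R := (2 + (1 - al)^-1) `^ p.
have c20 : 0 < c2 by rewrite powR_gt0// ltr_wpDr// invr_ge0 subr_ge0 ltW.
pose A : R := 2 * (1 + al^-1) * (1 + c1).
have A0 : 0 < A by rewrite !mulr_gt0 ?addr_gt0 ?invr_gt0.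
pose E : R := 2 * (2 * 2 `^ p * c1) + 1.
have p2 : 0 < (2 : R) `^ p by rewrite powR_gt0.
have t0 : 0 < 2 :> R by [].
have E0 : 0 < E := addr_gt0 (mulr_gt0 t0 (mulr_gt0 (mulr_gt0 t0 p2) c10)) ltr01.
exists (C * (A `^ p * E + 2 `^ p * c2)).
  exact: mulr_gt0 C0 (addr_gt0 (mulr_gt0 (powR_gt0 p A0) E0) (mulr_gt0 p2 c20)).
move=> M g W V mg pg W0 V0 Z0 hW hV.
set Z := D M `^ (- al) * W + V in Z0 *.
have DM0 : 0 < D M by exact: dy_gt0.
(* Q is chosen so that the p-th powers of the norms of both the differences and the
   damped difference are at most a multiple of Q *)
pose Q := D M `^ (al * p) * Z `^ p.
have Q0 : 0 < Q by rewrite mulr_gt0 ?powR_gt0.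
have QE : D M `^ (- (al * p)) * Q = Z `^ p.
  by rewrite mulrA -powRD_pos// addNr powRr0 mul1r.
have WQ : W `^ p <= Q.
  rewrite /Q powRrM -powRM ?powR_ge0 ?(ltW Z0)//.
  apply: ge0_ler_powR; rewrite ?nnegrE ?(ltW p0) ?mulr_ge0 ?powR_ge0 ?(ltW Z0)//.
  rewrite /Z mulrDr mulrA -powRD_pos// addrN powRr0 mul1r.
  by rewrite lerDl mulr_ge0 ?powR_ge0.
have VZ : V `^ p <= Z `^ p.
  apply: ge0_ler_powR; rewrite ?nnegrE ?(ltW p0) ?(ltW Z0)//.
  by rewrite /Z lerDr mulr_ge0 ?powR_ge0.
pose N := (2 ^ M)%N; have N0 : (0 < N)%N by rewrite expn_gt0.
have NV : N%:R^-1 = D M by exact: dyV.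
have Nal : N%:R `^ (- al) = D M `^ al.
  by rewrite -NV -[N%:R^-1]powR_inv1 ?ler0n// -powRrM mulN1r.
have Nal' : N%:R `^ al = D M `^ (- al).
  by rewrite -NV -[N%:R^-1]powR_inv1 ?ler0n// -powRrM mulrN mulN1r opprK.
pose w := damped_diff al N g.
have mw : measurable_fun setT w by exact: measurable_damped_diff.
have w0 x : 0 <= w x by exact: damped_diff_ge0.
have hw : (pint p w <= (c1 * Q)%:E)%E.
  have h1 : (pint p (fdiff al N%:R^-1 g) <= Q%:E)%E.
    by apply: le_trans (hW _ _ _) _; rewrite ?NV ?(ltW DM0) ?lee_fin.
  have h2 : (pint p g <= (Z `^ p)%:E)%E by apply: le_trans hV _; rewrite lee_fin.
  apply: le_trans (pint_damped_diff (ltW p1) al0 al1 N0 mg pg (powR_ge0 _ _) h1 h2) _.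
  rewrite lee_fin Nal powRM ?powR_ge0 ?addr_ge0 ?invr_ge0 ?subr_ge0 ?(ltW al0) ?(ltW al1)//.
  by rewrite -powRrM; apply: eq_ler; rewrite /c1 /Q; ring.
pose lam := lev w.
have lam0 : lam 0%N = 0 by exact: (lev0 (ltW p1) mw w0 hw).
have lamp k : 0 <= lam k by exact: (lev_ge0 (ltW p1) mw w0 hw).
have hlam k : (tm [set u | (lam k < w u)%R] <= (D k)%:E)%E by exact: (lev_superlevel (ltW p1) mw w0 hw).
pose s := (Q / D M) `^ p^-1.
have s0 : 0 < s by rewrite powR_gt0// divr_gt0.
have sQ : s `^ p * D M = Q.
  by rewrite /s -powRrM mulVf ?gt_eqF// powRr1 ?divfK ?gt_eqF// divr_ge0 ?ltW.
(* the last entry s accounts for the part of w above the level lam M *)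
pose mu k := if (k < M)%N then lam k.+1 else s.
have mu0 k : 0 <= mu k by rewrite /mu; case: ifP => // _; exact: ltW.
pose l m := (c2 * Q / D m) `^ p^-1.
have l0 m : 0 < l m by rewrite powR_gt0// divr_gt0 ?dy_gt0// mulr_gt0.
have lQ m : l m `^ p * D m = c2 * Q.
  rewrite /l -powRrM mulVf ?gt_eqF// powRr1 ?divfK ?gt_eqF ?dy_gt0//.
  exact: ltW (divr_gt0 (mulr_gt0 c20 Q0) (dy_gt0 m)).
have Emu : \sum_(k < M.+1) D k * mu k `^ p <= E * Q.
  rewrite big_ord_recr/= /mu ltnn [D M * _]mulrC sQ /E mulrDl mul1r lerD2r.
  rewrite (eq_bigr (fun k : 'I_M => 2 * (D k.+1 * lam k.+1 `^ p))); last first.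
    by move=> k _; rewrite ltn_ord exprS; field.
  rewrite -mulr_sumr -mulrA ler_wpM2l// -mulrA.
  apply: le_trans (sum_lev_le (ltW p1) mw w0 hw M.+1).
  by rewrite big_ord_recl/= lerDr mulr_ge0 ?powR_ge0.
pose T m := (1 + c1) * \sum_(k < M.+1) (m <= k)%:R * (mu k * D k).
have TE m : (m <= M)%N -> \sum_(k < M) (m <= k)%:R * lam k.+1 * D k + (1 + c1) * s * D M <= T m.
  move=> mM; rewrite /T big_ord_recr/= mM mul1r mulrDr {2}/mu ltnn -[X in _ + X <= _]mulrA lerD2r.
  rewrite -[X in X <= _]mul1r; apply: ler_pM => //.
  - by apply: sumr_ge0 => k _; rewrite !mulr_ge0 ?dy_ge0.
  - by rewrite lerDl ltW.
  - by apply: ler_sum => k _; rewrite /mu ltn_ord mulrA.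
have T0 m : (m <= M)%N -> 0 < T m.
  move=> mM; apply: lt_le_trans (TE m mM); rewrite ltr_wpDl ?mulr_gt0 ?addr_gt0//.
  by apply: sumr_ge0 => k _; rewrite !mulr_ge0 ?dy_ge0.
exists (fun m => 2 * ((1 + al^-1) * N%:R `^ al *
             (\sum_(k < m) lam k.+1 * D k `^ al + T m * D m `^ (al - 1))) + 2 * l m).
have a10 : 0 <= 1 + al^-1 by rewrite addr_ge0// invr_ge0 ltW.
have tt0 m k : 0 <= (m <= k)%:R * (mu k * D k) by rewrite !mulr_ge0 ?dy_ge0.
have Tm0 m : 0 <= T m.
  by rewrite mulr_ge0 ?addr_ge0 ?(ltW c10)//; apply: sumr_ge0.
have U0 m : 0 <= \sum_(k < m) lam k.+1 * D k `^ al + T m * D m `^ (al - 1).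
  apply: addr_ge0; last exact: mulr_ge0 (Tm0 m) (powR_ge0 _ _).
  by apply: sumr_ge0 => k _; rewrite mulr_ge0 ?powR_ge0.
have L0 m : 0 <= 2 * ((1 + al^-1) * N%:R `^ al *
             (\sum_(k < m) lam k.+1 * D k `^ al + T m * D m `^ (al - 1))) + 2 * l m.
  apply: addr_ge0 (mulr_ge0 (ltW t0) (mulr_ge0 (mulr_ge0 a10 (powR_ge0 _ _)) (U0 m))) _.
  exact: mulr_ge0 (ltW t0) (ltW (l0 m)).
split => //.
- move=> m mM; rewrite (_ : 2 * D m = D m + D m); last by rewrite mulr_natl mulr2n.
  have hT : (\int[tm]_x (if w x <= lam m then 0 else w x)%R%:E <= (T m)%:E)%E.
    apply: le_trans (integral_tail_le p1 mw w0 lamp hlam hw (ltW c10) s0 sQ mM) _.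
    by rewrite lee_fin TE.
  apply: (level_set p1 al0 al1 N0 mg pg lam0 lamp hlam (T0 m mM) hT (l0 m) (X := c2 * Q)).
  + exact: mulr_ge0 (ltW c20) (ltW Q0).
  + by rewrite lQ.
  + move=> y y0; rewrite NV => yM; have h := hW y y0 yM.
    apply: le_trans (pint_diff_le (ltW p1) al0 al1 (powR_ge0 _ _) mg pg hV h) _.
    by rewrite lee_fin ler_wpM2l ?(ltW c20).
- rewrite -QE; apply: le_trans (hC Q A (2 `^ p * c2) E M mu (fun m => 2 * l m) (ltW Q0) (ltW A0) _ (ltW E0) mu0 _ Emu _).
  + apply: ler_sum => m _; have mM : (m <= M)%N by rewrite -ltnS.
    apply: ge0_ler_powR; rewrite ?nnegrE ?(ltW p0)//.
    * exact: mulr_ge0 (powR_ge0 _ _) (L0 m).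
    * apply: mulr_ge0 (powR_ge0 _ _) (addr_ge0 (mulr_ge0 (mulr_ge0 (ltW A0) (powR_ge0 _ _)) (addr_ge0 _ _)) _).
      - by apply: sumr_ge0 => k _; rewrite !mulr_ge0 ?powR_ge0.
      - by apply: mulr_ge0 (powR_ge0 _ _); apply: sumr_ge0.
      - exact: mulr_ge0 (ltW t0) (ltW (l0 m)).
    rewrite ler_wpM2l ?powR_ge0// lerD2r Nal'.
    have -> : A * D M `^ (- al) = 2 * ((1 + al^-1) * D M `^ (- al)) * (1 + c1) by rewrite /A; ring.
    rewrite mulrA -[leRHS]mulrA ler_wpM2l ?mulr_ge0 ?powR_ge0// mulrDr; apply: lerD.
      rewrite -[leLHS]mul1r; apply: ler_pM => //.
      - by apply: sumr_ge0 => k _; rewrite mulr_ge0 ?powR_ge0.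
      - by rewrite lerDl ltW.
      rewrite (big_ord_widen_cond M.+1 xpredT (fun k => lam k.+1 * D k `^ al)) ?leqW//.
      rewrite big_mkcond/=; apply: ler_sum => k _.
      case: ifP => km; last by rewrite mul0r.
      by rewrite mul1r /mu (leq_trans km mM).
    by rewrite /T mulrA.
  + exact: mulr_ge0 (ltW p2) (ltW c20).
  + by move=> m; rewrite mulr_ge0 ?(ltW (l0 _)).
  + by move=> m; rewrite powRM ?(ltW (l0 _))// -mulrA lQ mulrA.
Qed.

End core.

(** * Discretization of the norms *)

Section discretization.
Context {R : realType}.
Local Notation mu := (@lebesgue_measure R).
Local Notation D k := (2^-1 ^+ k : R).
Implicit Types (g : R -> \bar R) (a : nat -> R) (K : R).

Lemma le_poweR (x y : \bar R) (r : R) : 0 <= r -> (0 <= x -> x <= y -> x `^ r <= y `^ r)%E.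
Proof.
move=> r0 x0 xy; apply: gt0_ler_poweR => //; rewrite in_itv/= ?x0 ?(le_trans x0 xy)/= leey//.
Qed.

Lemma dy_lt k m : (k < m)%N -> D m < D k.
Proof. by move=> km; rewrite ltr_iXn2l ?invr_gt0// invf_lt1// ltr1n. Qed.

Lemma dy_le k m : (k <= m)%N -> D m <= D k.
Proof. by move=> km; rewrite ler_wiXn2l// ?invr_ge0// invf_le1 ?ler1n. Qed.

Lemma dy_halfS k : D k.+1 = 2^-1 * D k. Proof. exact: exprS. Qed.

Lemma dy_interval (t : R) : 0 < t -> t < 1 -> exists m, D m.+1 <= t /\ t < D m.
Proof.
move=> t0 t1.
have [n hn] : exists n, D n <= t.
  have [n hn] : exists n : nat, t^-1 <= n.+1%:R.
    exists (Num.truncn t^-1); apply: ltW; exact: truncnS_gt.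
  exists n; rewrite exprVn -[t]invrK lef_pV2 ?posrE ?invr_gt0 ?exprn_gt0//.
  apply: le_trans hn _; rewrite -natrX ler_nat; exact: ltn_expl.
elim: n hn => [|n IH] hn; first by move: t1; rewrite ltNge; move: hn; rewrite expr0 => ->.
by have [h|h] := leP (D n) t; [exact: IH|exists n].
Qed.

Let I n : set R := `[D n.+1, D n[.

Let mI n : measurable (I n : set (measurableTypeR R)). Proof. exact: measurable_itv. Qed.

Let I01 n : I n `<=` `]0, 1[.
Proof.
move=> t; rewrite /I/= !in_itv/= => /andP[h1 h2].
rewrite (lt_le_trans (dy_gt0 n.+1) h1)/= (lt_le_trans h2)//.
by rewrite -[leRHS](expr0 (2^-1)) dy_le.
Qed.

Let muI n : (mu (I n) = (D n.+1)%:E)%E.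
Proof.
rewrite lebesgue_measure_itv/= lte_fin dy_lt// -EFinB; congr EFin.
by rewrite exprS; field.
Qed.

Let intI n c : 0 <= c -> (\int[mu]_(t in `]0%R, 1%R[) (c * \1_(I n) t)%:E = (c * D n.+1)%:E)%E.
Proof.
move=> c0; under eq_integral do rewrite EFinM.
have mE : measurable_fun (`]0%R, 1%R[ : set (measurableTypeR R)) (fun t => (\1_(I n) t : R)%:E).
  by apply/measurable_EFinP; apply: measurable_indic; exact: mI.
have E0 t : `]0%R, 1%R[%classic t -> (0 <= (\1_(I n) t : R)%:E)%E by rewrite lee_fin indicE.
have m1 : measurable (`]0%R, 1%R[ : set (measurableTypeR R)) by exact: measurable_itv.
rewrite ge0_integralZl// (@integral_indic _ (measurableTypeR R) R mu _ m1 _ (mI n)).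
have h : I n `&` `]0, 1[ = I n by apply: setIidl; exact: I01.
by rewrite h EFinM; congr (_ * _)%E; exact: muI.
Qed.

Let in_I n t : (\1_(I n) t : R) = ((D n.+1 <= t) && (t < D n))%R%:R.
Proof.
rewrite indicE; congr ((nat_of_bool _)%:R); apply/idP/idP => [/set_mem|h].
  by rewrite /I/= in_itv.
by apply: mem_set; rewrite /I/= in_itv.
Qed.

Let I_uniq (m n : nat) t : D n.+1 <= t -> t < D n -> D m.+1 <= t -> t < D m -> m = n.
Proof.
move=> a1 a2 b1 b2; have [mn|nm|//] := ltngtP m n.
- by move: a2; rewrite ltNge (le_trans _ b1)// dy_le.
- by move: b2; rewrite ltNge (le_trans _ a1)// dy_le.
Qed.

(** The intervals [D m.+1, D m[ have measure log 2 for dt/t, which is at least 1/2. *)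
Lemma dtt_ge s g a n : 0 < s -> (forall m, 0 <= a m) ->
  (forall m t, (m < n)%N -> D m.+1 <= t -> t < D m -> ((a m)%:E <= g t)%E) ->
  ((\sum_(m < n) a m `^ s)%:E <=
    2%:E * \int[mu]_(t in `]0%R, 1%R[) (g t `^ s * (t^-1)%:E))%E.
Proof.
move=> s0 a0 ag.
pose c m := a m `^ s / D m; have c0 m : 0 <= c m by rewrite divr_ge0 ?powR_ge0 ?dy_ge0.
rewrite [X in (X <= _)%E](_ : _ = (2%:E * (\sum_(m < n) c m * D m.+1)%:E)%E); last first.
  rewrite -EFinM; congr EFin; rewrite mulr_sumr; apply: eq_bigr => m _.
  by rewrite /c dy_halfS; field; rewrite gt_eqF ?dy_gt0.
apply: lee_wpmul2l => //.
have mE m : measurable_fun (`]0%R, 1%R[ : set (measurableTypeR R)) (fun t => (c m * \1_(I m) t)%:E).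
  apply/measurable_EFinP; apply: measurable_funM; first exact: measurable_cst.
  by apply: measurable_indic; exact: mI.
have E0 m t : `]0%R, 1%R[%classic t -> (0 <= (c m * \1_(I m) t)%:E)%E by rewrite lee_fin mulr_ge0// indicE.
have m1 : measurable (`]0%R, 1%R[ : set (measurableTypeR R)) by exact: measurable_itv.
rewrite -sumEFin (eq_bigr (fun m : 'I_n => \int[mu]_(t in `]0%R, 1%R[) (c m * \1_(I m) t)%:E)%E); last first.
  by move=> m _; rewrite intI.
rewrite -ge0_integral_sum//; last by move=> m t; exact: E0.
apply: le_integral_ge0 => t; rewrite /= in_itv/= => /andP[t0 t1].
  by apply: sume_ge0 => m _; rewrite lee_fin mulr_ge0// indicE.
have [m [h1 h2]] := dy_interval t0 t1.
have [mn|nm] := ltnP m n; last first.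
  rewrite big1 ?mule_ge0 ?poweR_ge0 ?lee_fin ?invr_ge0 ?(ltW t0)// => k _.
  rewrite in_I; case: (boolP ((D k.+1 <= t) && (t < D k))) => [/andP[k1 k2]|_]; last by rewrite mulr0.
  by move: (I_uniq h1 h2 k1 k2) nm => <-; rewrite leqNgt ltn_ord.
rewrite (bigD1 (Ordinal mn))//= big1 ?adde0; last first.
  move=> k kn; rewrite in_I; case: (boolP ((D k.+1 <= t) && (t < D k))) => [/andP[k1 k2]|_]; last by rewrite mulr0.
  by move/eqP: kn => []; apply: val_inj; exact: (I_uniq h1 h2 k1 k2).
rewrite in_I h1 h2 mulr1 /c EFinM; apply: lee_pmul; rewrite ?lee_fin ?powR_ge0 ?invr_ge0 ?dy_ge0//.
  rewrite -poweR_EFin; apply: le_poweR; rewrite ?lee_fin ?(ltW s0)//; exact: ag.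
by rewrite lef_pV2 ?posrE ?dy_gt0// ltW.
Qed.

Lemma dtt_le s g a K : 0 < s -> (forall m, 0 <= a m) ->
  (forall m t, D m.+1 <= t -> t < D m -> (0 <= g t <= (a m)%:E)%E) ->
  (forall n, \sum_(m < n) a m `^ s <= K) ->
  (\int[mu]_(t in `]0%R, 1%R[) (g t `^ s * (t^-1)%:E) <= K%:E)%E.
Proof.
move=> s0 a0 ag hK.
pose c m := a m `^ s / D m.+1; have c0 m : 0 <= c m by rewrite divr_ge0 ?powR_ge0 ?dy_ge0.
have mE m : measurable_fun (`]0%R, 1%R[ : set (measurableTypeR R)) (fun t => (c m * \1_(I m) t)%:E).
  apply/measurable_EFinP; apply: measurable_funM; first exact: measurable_cst.
  by apply: measurable_indic; exact: mI.
have E0 m t : `]0%R, 1%R[%classic t -> (0 <= (c m * \1_(I m) t)%:E)%E by rewrite lee_fin mulr_ge0// indicE.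
have m1 : measurable (`]0%R, 1%R[ : set (measurableTypeR R)) by exact: measurable_itv.
apply: (@le_trans _ _ (\int[mu]_(t in `]0%R, 1%R[) \sum_(m <oo) (c m * \1_(I m) t)%:E)%E).
  apply: le_integral_ge0 => t; rewrite /= in_itv/= => /andP[t0 t1].
    by rewrite mule_ge0 ?poweR_ge0// lee_fin invr_ge0 ltW.
  have [m [h1 h2]] := dy_interval t0 t1.
  apply: (@le_trans _ _ (c m * \1_(I m) t)%:E).
    have /andP[g0 gm] := ag m t h1 h2.
    rewrite in_I h1 h2 mulr1 /c EFinM; apply: lee_pmul; rewrite ?poweR_ge0 ?lee_fin ?invr_ge0 ?(ltW t0)//.
      by rewrite -poweR_EFin; apply: le_poweR => //; exact: ltW.
    by rewrite lef_pV2 ?posrE ?dy_gt0.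
  apply: le_trans (nneseries_lim_ge m.+1 _); last first.
    by move=> k _ _; rewrite lee_fin mulr_ge0// indicE.
  rewrite big_mkord big_ord_recr/= leeDr//; apply: sume_ge0 => k _.
  by rewrite lee_fin mulr_ge0// indicE.
rewrite integral_nneseries//.
apply: lime_le; first by apply: is_cvg_nneseries => m _ _; apply: integral_ge0 => t; exact: E0.
apply: nearW => n; rewrite big_mkord (eq_bigr (fun m : 'I_n => (a m `^ s)%:E)).
  by rewrite sumEFin lee_fin; exact: hK.
by move=> m _; rewrite intI// /c divfK ?gt_eqF ?dy_gt0.
Qed.

(** The l_u norm of a is at most K. Bounding the partial sums avoids any question
    of summability; the branch -oo is never used. *)
Definition lq_le (u : \bar R) a K : Prop :=
  match u with
  | s%:E => forall n, \sum_(m < n) a m `^ s <= K `^ s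
  | +oo%E => forall m, a m <= K
  | -oo%E => True
  end.

Lemma Lq_dtt_ge0 (u : \bar R) g : (forall t, 0 < t -> (0 <= g t)%E) -> (0 <= Lq_dtt u g)%E.
Proof.
case: u => [s||] g0 //=; first exact: poweR_ge0.
apply: (@le_trans _ _ (g 2^-1)); first by apply: g0; rewrite invr_gt0.
apply: ereal_sup_ubound; exists 2^-1 => //=.
by rewrite in_itv/= invr_gt0 ltr0n/= invf_lt1// ltr1n.
Qed.

Lemma Lq_dtt_le (u : \bar R) g a K : (0 < u)%E -> 0 <= K -> (forall m, 0 <= a m) ->
  (forall m t, D m.+1 <= t -> t < D m -> (0 <= g t <= (a m)%:E)%E) ->
  lq_le u a K -> (Lq_dtt u g <= K%:E)%E.
Proof.
case: u => [s||] // u0 K0 a0 ag hK /=.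
  rewrite lte_fin in u0.
  have h := dtt_le u0 a0 ag hK.
  have KE : K = (K `^ s) `^ s^-1 by rewrite -powRrM mulfV ?gt_eqF// powRr1.
  rewrite [in leRHS]KE -poweR_EFin.
  apply: le_poweR => //; first by rewrite invr_ge0 ltW.
  apply: integral_ge0 => t; rewrite /= in_itv/= => /andP[t0 t1].
  by rewrite mule_ge0 ?poweR_ge0// lee_fin invr_ge0 ltW.
apply: ge_ereal_sup => y [t]; rewrite /= in_itv/= => /andP[t0 t1] <-.
have [m [h1 h2]] := dy_interval t0 t1.
by have /andP[_ h] := ag m t h1 h2; apply: le_trans h _; rewrite lee_fin; exact: hK.
Qed.

Lemma Lq_dtt_ge (u : \bar R) : (0 < u)%E -> exists2 C : R, 0 < C &
  forall g a K n, 0 <= K -> (forall m, 0 <= a m) ->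
    (forall m t, (m < n)%N -> D m.+1 <= t -> t < D m -> ((a m)%:E <= g t)%E) ->
    (Lq_dtt u g <= K%:E)%E -> lq_le u (fun m => if (m < n)%N then a m else 0) (C * K).
Proof.
case: u => [s||] // u0 /=; last first.
  exists 1 => // g a K n K0 a0 ag hK m; rewrite mul1r; case: ifP => // mn.
  rewrite -lee_fin; apply: le_trans hK; apply: le_trans (ag m (D m.+1) mn _ _) _ => //.
    exact: dy_lt.
  apply: ereal_sup_ubound; exists (D m.+1) => //=.
  by rewrite in_itv/= dy_gt0/= -[ltRHS](expr0 (2^-1)) dy_lt.
rewrite lte_fin in u0; exists (2 `^ s^-1); first by rewrite powR_gt0.
move=> g a K n K0 a0 ag hK k.
have h := dtt_ge u0 a0 ag.
set J := (\int[_]_(_ in _) _)%E in h hK.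
have J0 : (0 <= J)%E.
  apply: integral_ge0 => t; rewrite /= in_itv/= => /andP[t0 t1].
  by rewrite mule_ge0 ?poweR_ge0// lee_fin invr_ge0 ltW.
have JK : (J <= (K `^ s)%:E)%E.
  rewrite -[J](poweRe1 J0) -(mulVf (lt0r_neq0 u0)) poweRrM -poweR_EFin.
  by apply: le_poweR => //; rewrite ?poweR_ge0 ?ltW.
rewrite powRM ?powR_ge0// -powRrM mulVf ?gt_eqF// powRr1//.
apply: (@le_trans _ _ (\sum_(m < n) a m `^ s)); last first.
  rewrite -lee_fin; apply: le_trans h _; rewrite EFinM lee_wpmul2l//.
rewrite (eq_bigr (fun m : 'I_k => if (m < n)%N then a m `^ s else 0)); last first.
  by move=> m _; case: ifP => // _; rewrite powR0// gt_eqF.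
rewrite -big_mkcond/=; have [kn|nk] := leqP k n.
  rewrite [leLHS](_ : _ = \sum_(i < k) a i `^ s); last first.
    by apply: eq_bigl => i; rewrite (leq_trans (ltn_ord i) kn).
  rewrite (big_ord_widen n (fun m => a m `^ s) kn) big_mkcond/=.
  by apply: ler_sum => i _; case: ifP => // _; exact: powR_ge0.
rewrite [leRHS](big_ord_widen k (fun m => a m `^ s) (ltnW nk)).
exact: lexx.
Qed.

Lemma lq_leW u a a' K K' : (0 < u)%E -> (forall m, 0 <= a m) -> (forall m, a m <= a' m) -> 0 <= K -> K <= K' ->
  lq_le u a' K -> lq_le u a K'.
Proof.
case: u => [s||] //= u0 a0 aa K0 KK h; rewrite ?lte_fin in u0.
  move=> n; apply: (@le_trans _ _ (K `^ s)).
    apply: le_trans (h n); apply: ler_sum => m _.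
    by apply: ge0_ler_powR; rewrite ?nnegrE ?(ltW u0)// (le_trans (a0 m)).
  by apply: ge0_ler_powR; rewrite ?nnegrE ?(ltW u0)// (le_trans K0).
by move=> m; apply: le_trans (aa m) _; apply: le_trans (h m) KK.
Qed.

(** A factor 2 in the argument costs a factor depending only on the exponent; it
    allows logarithms to be replaced by indices. *)
Lemma powR_weight c (x y : R) : 0 < y -> y / 2 <= x -> x <= 2 * y ->
  (2 `^ `|c|)^-1 * y `^ c <= x `^ c <= 2 `^ `|c| * y `^ c.
Proof.
move=> y0 yx xy; have x0 : 0 < x by apply: lt_le_trans yx; rewrite divr_gt0.
have P0 : 0 < (2 : R) `^ `|c| by rewrite powR_gt0.
wlog c0 : c P0 / 0 <= c.
  move=> H; have [|/ltW cN] := leP 0 c; first exact: H.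
  have := H (- c); rewrite normrN oppr_ge0 => /(_ P0 cN).
  rewrite !powRN => /andP[h1 h2]; apply/andP; split.
  - by move: h2; rewrite ler_pdivlMr ?powR_gt0// ler_pdivrMl ?powR_gt0// => h; rewrite ler_pdivrMl// mulrC.
  - by move: h1; rewrite ler_pdivrMr ?powR_gt0// ler_pdivlMl ?powR_gt0// ler_pdivrMr// mulrC.
rewrite ger0_norm//; apply/andP; split.
  rewrite ler_pdivrMl ?powR_gt0// -powRM ?(ltW x0)//.
  apply: ge0_ler_powR; rewrite ?nnegrE ?mulr_ge0 ?(ltW x0) ?(ltW y0)//.
  by move: yx; rewrite ler_pdivrMr// mulrC.
by rewrite -powRM ?(ltW y0)//; apply: ge0_ler_powR; rewrite ?nnegrE ?mulr_ge0 ?(ltW x0) ?(ltW y0).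
Qed.

Lemma ln_dy_bounds m t : D m.+1 <= t -> t < D m ->
  m.+1%:R / 2 <= 1 - ln t <= 2 * m.+1%:R /\ 1 + `|ln t| = 1 - ln t.
Proof.
move=> h1 h2; have t0 : 0 < t by apply: lt_le_trans h1; exact: dy_gt0.
have lnd k : ln (D k) = - (k%:R * ln 2) by rewrite exprVn lnV ?posrE ?exprn_gt0// lnXn// mulr_natl.
have l1 : - (m.+1%:R * ln 2) <= ln t by rewrite -lnd ler_ln ?posrE ?dy_gt0.
have l2 : ln t <= - (m%:R * ln 2) by rewrite -lnd ler_ln ?posrE ?dy_gt0// ltW.
have ln2 : (ln 2 : R) <= 1 by have := @le_ln1Dx R 1; rewrite (_ : 1 + 1 = 2)//; apply.
have ln2' : 2^-1 <= (ln 2 : R).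
  have := @le_ln1Dx R (- 2^-1); rewrite (_ : 1 + - 2^-1 = 2^-1); last by field.
  by rewrite lnV ?posrE//; lra.
have m0 : 0 <= m%:R :> R by [].
have a1 : m%:R * 2^-1 <= m%:R * (ln 2 : R) by rewrite ler_wpM2l.
have a2 : m.+1%:R * (ln 2 : R) <= m.+1%:R * 1 by rewrite ler_wpM2l.
have a0 : 0 <= m%:R * (ln 2 : R) by apply: le_trans a1; rewrite mulr_ge0.
split; last by rewrite ler0_norm//; lra.
by rewrite -natr1 in a2 l1 *; apply/andP; split; lra.
Qed.

End discretization.

(** * Weighted inequalities for sequences *)

Section sequences.
Context {R : realType}.
Implicit Types (p s v b e : R) (F Z h : nat -> R).

Lemma recipE s : 0 < s -> recip s%:E = s^-1.
Proof. by move=> s0; rewrite /recip inver gt_eqF. Qed.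

Lemma recipy : recip +oo%E = 0 :> R.
Proof. by rewrite /recip invey. Qed.

Lemma sum_powR_superadd e h n : 1 <= e -> (forall k, 0 <= h k) ->
  \sum_(k < n) h k `^ e <= (\sum_(k < n) h k) `^ e.
Proof.
move=> e1 h0; set S := \sum_(k < n) h k.
have S0 : 0 <= S by exact: sumr_ge0.
have e0 : 0 < e by lra.
rewrite -[S `^ e]mulr_powRB1// [in leRHS]/S mulr_suml.
apply: ler_sum => k _; rewrite -[h k `^ e]mulr_powRB1// ler_wpM2l//.
apply: ge0_ler_powR; rewrite ?nnegrE ?subr_ge0//.
by rewrite /S (bigD1 k)//= lerDl; exact: sumr_ge0.
Qed.

Lemma sum_indic_le h n k : (forall i, 0 <= h i) ->
  \sum_(m < n) (m < k)%:R * h m <= \sum_(m < k) h m.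
Proof.
move=> h0; elim: n => [|n IH]; first by rewrite big_ord0 sumr_ge0.
have [nk|kn] := leqP n.+1 k; last first.
  by rewrite big_ord_recr/= ltnNge -ltnS kn mul0r addr0.
rewrite (big_ord_widen k (fun m => (m < k)%:R * h m) nk) big_mkcond/=.
by apply: ler_sum => i _; rewrite ltn_ord mul1r; case: ifP.
Qed.

Lemma sum_indic_window h m k : \sum_(M < m + k) (m <= M)%:R * h M = \sum_(j < k) h (m + j)%N.
Proof.
elim: k => [|k IH].
  by rewrite addn0 big_ord0 big1// => i _; rewrite leqNgt ltn_ord mul0r.
by rewrite addnS !big_ord_recr/= IH leq_addr mul1r.
Qed.

Lemma ler_powR_inv s (x y : R) : 0 < s -> 0 <= x -> 0 <= y -> x `^ s <= y `^ s -> x <= y.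
Proof.
move=> s0 x0 y0 h2; rewrite leNgt; apply/negP => h3; move: h2; apply/negP; rewrite -ltNge.
by apply: gt0_ltr_powR; rewrite ?nnegrE.
Qed.

(** There are m + 1 summands, each of size (m + 1)^(e - 1). *)
Lemma powR_window e m : e <= 1 ->
  m.+1%:R `^ e <= 2 `^ (1 - e) * \sum_(j < m.+1) (m + j).+1%:R `^ (e - 1) :> R.
Proof.
move=> e1; have m0 : 0 < m.+1%:R :> R by rewrite ltr0n.
apply: le_trans (_ : 2 `^ (1 - e) * \sum_(j < m.+1) (2 * m.+1%:R) `^ (e - 1) <= _); last first.
  rewrite ler_wpM2l ?powR_ge0//; apply: ler_sum => j _.
  apply: powRN_le; rewrite ?ltr0n ?subr_le0// -natrM ler_nat.
  by have := ltn_ord j; lia.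
have e3 : m.+1%:R `^ e = m.+1%:R * m.+1%:R `^ (e - 1) :> R.
  rewrite -[in X in X * _](@powRr1 R m.+1%:R)// -powRD_pos//; congr (_ `^ _); ring.
have e4 : 2 `^ (1 - e) * 2 `^ (e - 1) = 1 :> R.
  by rewrite -powRD_pos// (_ : 1 - e + (e - 1) = 0) ?powRr0//; ring.
rewrite sumr_const card_ord -[X in _ * X]mulr_natl powRM// e3; apply: eq_ler.
by rewrite [RHS]mulrCA; congr (_ * _); rewrite mulrA e4 mul1r.
Qed.

(** Each term of index m is spread over the window from m to 2 m, and the sums are
    exchanged. Thus a weighted sum is bounded by a weighted sum of partial sums. *)
Lemma sum_window_le e h n : e <= 1 -> (forall m, 0 <= h m) ->
  \sum_(m < n) m.+1%:R `^ e * h m <=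
  2 `^ (1 - e) * \sum_(M < n + n) M.+1%:R `^ (e - 1) * \sum_(m < M.+1) h m.
Proof.
move=> e1 h0.
apply: (@le_trans _ _ (\sum_(m < n) 2 `^ (1 - e) * (\sum_(M < n + n) (m <= M)%:R * (M.+1%:R `^ (e - 1) * h m)))).
  apply: ler_sum => m _.
  apply: le_trans (ler_wpM2r (h0 m) (powR_window m e1)) _.
  rewrite -mulrA ler_wpM2l ?powR_ge0// mulr_suml.
  rewrite -(sum_indic_window (fun M => M.+1%:R `^ (e - 1) * h m)).
  have mn : (m + m.+1 <= n + n)%N by have := ltn_ord m; lia.
  rewrite (big_ord_widen (n + n) (fun M => (m <= M)%:R * (M.+1%:R `^ (e - 1) * h m)) mn) big_mkcond/=.
  by apply: ler_sum => i _; case: ifP => // _; rewrite !mulr_ge0 ?powR_ge0.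
rewrite -mulr_sumr ler_wpM2l ?powR_ge0// exchange_big/=; apply: ler_sum => M _.
apply: le_trans (_ : \sum_(i < n) (i < M.+1)%:R * (M.+1%:R `^ (e - 1) * h i) <= _) => //.
rewrite mulr_sumr; apply: (@sum_indic_le (fun i => M.+1%:R `^ (e - 1) * h i)) => i.
by rewrite mulr_ge0 ?powR_ge0.
Qed.

Section real_q.
Context p s b F Z (S : R) (p0 : 0 < p) (s0 : 0 < s) (sb : s^-1 < b).
Context (F0 : forall m, 0 <= F m) (Z0 : forall m, 0 <= Z m) (S0 : 0 <= S).
Context (FZ : forall M, \sum_(m < M.+1) F m `^ p <= Z M `^ p).
Context (ZS : forall n, \sum_(M < n) (M.+1%:R `^ (- b) * Z M) `^ s <= S `^ s).

Let G M := (\sum_(m < M.+1) F m `^ p) `^ p^-1.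

Let G0 M : 0 <= G M. Proof. exact: powR_ge0. Qed.

Let SF0 M : 0 <= \sum_(m < M) F m `^ p.
Proof. by apply: sumr_ge0 => m _; exact: powR_ge0. Qed.

Let b0 : 0 < b. Proof. by apply: lt_trans sb; rewrite invr_gt0. Qed.

Let bs1 : 1 < b * s.
Proof. by rewrite -(mulVf (lt0r_neq0 s0)) ltr_pM2r. Qed.

Let GZ M : G M <= Z M.
Proof.
have e : Z M = (Z M `^ p) `^ p^-1 by rewrite -powRrM mulfV ?gt_eqF// powRr1.
by rewrite e /G; apply: ge0_ler_powR; rewrite ?nnegrE ?invr_ge0 ?powR_ge0 ?(ltW p0)//.
Qed.

Let Gle M j : G M <= G (M + j)%N.
Proof.
apply: ge0_ler_powR; rewrite ?nnegrE ?invr_ge0 ?(ltW p0)//.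
have h : (M.+1 <= (M + j).+1)%N by rewrite ltnS leq_addr.
rewrite (big_ord_widen _ (fun m => F m `^ p) h) big_mkcond/=.
by apply: ler_sum => m _; case: ifP => // _; exact: powR_ge0.
Qed.

Let FG v M : p <= v -> \sum_(m < M.+1) F m `^ v <= G M `^ v.
Proof.
move=> pv; have v1 : 1 <= v / p by rewrite ler_pdivlMr// mul1r.
rewrite /G -powRrM mulrC.
apply: le_trans (@sum_powR_superadd (v / p) (fun m => F m `^ p) M.+1 v1 (fun m => powR_ge0 _ _)).
by apply: ler_sum => m _; rewrite -powRrM mulrCA mulfV ?gt_eqF// mulr1.
Qed.

(** The partial norms G increase and the weights vary slowly, so each of the M + 1
    terms of index between M and 2 M is bounded below in terms of G M. *)
Lemma weighted_sup_le M : M.+1%:R `^ (- b + s^-1) * G M <= 2 `^ b * S.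
Proof.
have y0 : 0 <= M.+1%:R `^ (- b + s^-1) * G M by rewrite mulr_ge0 ?powR_ge0.
apply: (ler_powR_inv s0 y0); first by rewrite mulr_ge0 ?powR_ge0.
rewrite !powRM ?powR_ge0// -[(_ `^ (- b + s^-1)) `^ s]powRrM -[(2 `^ b) `^ s]powRrM mulrDl mulVf ?gt_eqF// mulNr.
have e1 : - (b * s) + 1 <= 1 by rewrite gerDr oppr_le0; exact: ltW (lt_trans ltr01 bs1).
apply: le_trans (ler_wpM2r (powR_ge0 _ _) (powR_window M e1)) _.
rewrite (_ : 1 - (- (b * s) + 1) = b * s); last by ring.
rewrite (_ : - (b * s) + 1 - 1 = - (b * s)); last by ring.
rewrite -mulrA ler_wpM2l ?powR_ge0//.
apply: le_trans (ZS (M + M.+1)); rewrite mulr_suml.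
rewrite -(sum_indic_window (fun K => K.+1%:R `^ (- (b * s)) * G M `^ s)).
apply: ler_sum => K _; case: (leqP M K) => MK; last by rewrite mul0r powR_ge0.
rewrite mul1r powRM ?powR_ge0// -powRrM mulNr ler_wpM2l ?powR_ge0//.
apply: ge0_ler_powR; rewrite ?nnegrE ?(ltW s0)//.
by apply: le_trans (GZ K); rewrite -(subnKC MK).
Qed.

(** After [sum_window_le] and the inclusion of l_p in l_v, a term is
    (M + 1)^(e - 1) G M ^ v. Its factor G M ^ (v - s) is absorbed by
    [weighted_sup_le], and what is left is the s-th power of the given norm. *)
Lemma weighted_sum_le_large v n : p <= v -> s <= v ->
  \sum_(m < n) (m.+1%:R `^ (- b + s^-1) * F m) `^ v <=
  (2 `^ (1 - (- b + s^-1) * v) * 2 `^ (b * (v - s))) * S `^ v.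
Proof.
move=> pv sv; have v0 : 0 < v by exact: lt_le_trans sv.
set e := (- b + s^-1) * v.
have e0 : e <= 0 by rewrite /e mulr_le0_ge0 ?(ltW v0)// addrC subr_le0 ltW.
rewrite (eq_bigr (fun m : 'I_n => m.+1%:R `^ e * F m `^ v)); last first.
  by move=> m _; rewrite powRM ?powR_ge0// -powRrM.
have e1 : e <= 1 by lra.
apply: le_trans (@sum_window_le e (fun m => F m `^ v) n e1 _) _.
  by move=> m; exact: powR_ge0.
rewrite -mulrA ler_wpM2l ?powR_ge0//.
apply: le_trans (_ : \sum_(M < n + n) (2 `^ b * S) `^ (v - s) * (M.+1%:R `^ (- b) * Z M) `^ s <= _); last first.
  rewrite -mulr_sumr powRM ?powR_ge0// -powRrM -mulrA ler_wpM2l ?powR_ge0//.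
  apply: le_trans (ler_wpM2l (powR_ge0 _ _) (ZS _)) _.
  have [->|vs] := eqVneq v s; first by rewrite subrr powRr0 mul1r.
  have [->|Sn] := eqVneq S 0.
    by rewrite [0 `^ s]powR0 ?gt_eqF// mulr0 powR_ge0.
  by rewrite -powRD_pos ?subrK// lt_neqAle eq_sym Sn.
apply: ler_sum => M _.
have M0 : 0 < M.+1%:R :> R by rewrite ltr0n.
apply: le_trans (ler_wpM2l (powR_ge0 _ _) (FG M pv)) _.
apply: le_trans (_ : (M.+1%:R `^ (- b + s^-1) * G M) `^ (v - s) * (M.+1%:R `^ (- b) * G M) `^ s <= _).
  rewrite !powRM ?powR_ge0// -[(_ `^ (- b + s^-1)) `^ _]powRrM -[(_ `^ (- b)) `^ s]powRrM mulrACA -powRD_pos//.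
  have -> : (- b + s^-1) * (v - s) + - b * s = e - 1.
    by rewrite /e; field; rewrite gt_eqF.
  rewrite ler_wpM2l ?powR_ge0//.
  have [->|vs] := eqVneq v s; first by rewrite subrr powRr0 mul1r.
  have [->|Gn] := eqVneq (G M) 0.
    by rewrite [0 `^ v]powR0 ?gt_eqF// mulr_ge0 ?powR_ge0.
  have Gp : 0 < G M by rewrite lt_neqAle eq_sym Gn G0.
  by rewrite -powRD_pos// subrK.
apply: ler_pM; rewrite ?powR_ge0//.
  apply: ge0_ler_powR; rewrite ?nnegrE ?subr_ge0 ?mulr_ge0 ?powR_ge0//.
  exact: weighted_sup_le.
apply: ge0_ler_powR; rewrite ?nnegrE ?(ltW s0) ?mulr_ge0 ?powR_ge0//.
by rewrite ler_wpM2l ?powR_ge0.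
Qed.

(** When s < p, Hoelder's inequality bounds the partial l_s norm by the partial
    l_p norm with a power of M + 1, which is why the weight has exponent 1/p here
    and not 1/s. *)
Lemma weighted_sum_le_small n : s < p ->
  \sum_(m < n) (m.+1%:R `^ (- b + p^-1) * F m) `^ s <=
  2 `^ (1 - (- b + p^-1) * s) * S `^ s.
Proof.
move=> sp; set e := (- b + p^-1) * s.
have e1 : e <= 1.
  have : s / p <= 1 by rewrite ler_pdivrMr// mul1r ltW.
  rewrite /e mulrDl [p^-1 * s]mulrC mulNr; apply: le_trans.
  by rewrite gerDr oppr_le0 (mulr_ge0 (ltW b0) (ltW s0)).
rewrite (eq_bigr (fun m : 'I_n => m.+1%:R `^ e * F m `^ s)); last first.
  by move=> m _; rewrite powRM ?powR_ge0// -powRrM.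
apply: le_trans (@sum_window_le e (fun m => F m `^ s) n e1 _) _.
  by move=> m; exact: powR_ge0.
rewrite ler_wpM2l ?powR_ge0//; apply: le_trans (ZS (n + n)); apply: ler_sum => M _.
have M0 : 0 < M.+1%:R :> R by rewrite ltr0n.
rewrite powRM ?powR_ge0// -powRrM.
rewrite (_ : - b * s = (e - 1) + (1 - s / p)); last by rewrite /e; field; rewrite gt_eqF.
rewrite [X in _ <= X * _]powRD_pos// -mulrA ler_wpM2l ?powR_ge0//.
have ps1 : 1 <= p / s by rewrite ler_pdivlMr// mul1r ltW.
have := @powR_sum_le R _ (index_enum 'I_M.+1) xpredT (fun=> 1) (fun m => F m `^ s) (p / s) ps1 _ _.
move=> /(_ (fun _ _ => ler01) (fun _ _ => powR_ge0 _ _)).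
move=> h'; have h : (\sum_(m < M.+1) F m `^ s) `^ (p / s) <=
    M.+1%:R `^ (p / s - 1) * \sum_(m < M.+1) F m `^ p.
  move: h'; rewrite sumr_const card_ord; congr (is_true (_ `^ _ <= _ * _)).
    by apply: eq_bigr => m _; rewrite mul1r.
  by apply: eq_bigr => m _; rewrite mul1r -powRrM mulrCA mulfV ?gt_eqF// mulr1.
have SF : 0 <= \sum_(m < M.+1) F m `^ s by apply: sumr_ge0 => m _; exact: powR_ge0.
have e2 : \sum_(m < M.+1) F m `^ s = ((\sum_(m < M.+1) F m `^ s) `^ (p / s)) `^ (s / p).
  by rewrite -powRrM mulrA divfK ?gt_eqF// divff ?gt_eqF// powRr1.
rewrite e2.
have e3 : M.+1%:R `^ (1 - s / p) * Z M `^ s = (M.+1%:R `^ (p / s - 1) * Z M `^ p) `^ (s / p).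
  rewrite powRM ?powR_ge0// -!powRrM; congr (_ `^ _ * _ `^ _); field; by rewrite ?gt_eqF.
rewrite e3; apply: ge0_ler_powR; rewrite ?nnegrE ?divr_ge0 ?mulr_ge0 ?powR_ge0 ?(ltW p0) ?(ltW s0)//.
by apply: le_trans h _; rewrite ler_wpM2l ?powR_ge0.
Qed.

End real_q.

(** What the central estimate gives for a function of norm at most S: F stands for
    the weighted rearrangement and Z for the weighted modulus of smoothness. *)
Definition level_control p (q : \bar R) b F Z (S : R) := [/\ forall m, 0 <= F m, forall m, 0 <= Z m, 0 <= S,
  forall M, \sum_(m < M.+1) F m `^ p <= Z M `^ p & lq_le q (fun M => M.+1%:R `^ (- b) * Z M) S].

Lemma level_control_le p q b F Z (S : R) M : 0 < p -> level_control p q b F Z S -> F M <= Z M.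
Proof.
move=> p0 [F0 Z0 S0 FZ _]; apply: (ler_powR_inv p0) => //.
have := FZ M; rewrite big_ord_recr/=; apply: le_trans.
by rewrite lerDr; apply: sumr_ge0 => m _; exact: powR_ge0.
Qed.

Lemma weighted_embed_upper p (q : \bar R) b (u : \bar R) : 0 < p -> (0 < q)%E -> recip q < b -> (Order.max p%:E q <= u)%E ->
  exists2 C, 0 < C & forall F Z S, level_control p q b F Z S ->
    lq_le u (fun m => m.+1%:R `^ (- b + recip q) * F m) (C * S).
Proof.
move=> p0; case: q => [s||] //=; rewrite ?lte_fin => s0; last first.
  rewrite recipy => b0; case: u => [u||]; [by rewrite ge_max leye_eq andbF|move=> _|by rewrite ge_max leeNy_eq andbF].
  exists 1 => // F Z S h m; rewrite mul1r addr0.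
  case: (h) => F0 Z0 S0 _ /(_ m); apply: le_trans.
  by rewrite ler_wpM2l ?powR_ge0// (level_control_le _ p0 h).
rewrite recipE// => sb; rewrite ge_max; case: u => [v||] // /andP[].
  rewrite !lee_fin => pv sv; have v0 : 0 < v by exact: lt_le_trans pv.
  pose K : R := 2 `^ (1 - (- b + s^-1) * v) * 2 `^ (b * (v - s)).
  have K0 : 0 < K by rewrite mulr_gt0 ?powR_gt0.
  exists (K `^ v^-1); first by rewrite powR_gt0.
  move=> F Z S [F0 Z0 S0 hFZ hZ] n.
  rewrite powRM ?powR_ge0// -powRrM mulVf ?gt_eqF// powRr1 ?(ltW K0)//.
  exact: (weighted_sum_le_large p0 s0 sb F0 Z0 S0 hFZ hZ).
move=> _ _; exists (2 `^ b); first by rewrite powR_gt0.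
move=> F Z S [F0 Z0 S0 hFZ hZ] m.
apply: le_trans (weighted_sup_le p0 s0 sb Z0 S0 hFZ hZ m); rewrite ler_wpM2l ?powR_ge0//.
have e : F m = (F m `^ p) `^ p^-1 by rewrite -powRrM mulfV ?gt_eqF// powRr1.
rewrite {1}e; apply: ge0_ler_powR; rewrite ?nnegrE ?invr_ge0 ?powR_ge0 ?(ltW p0)//.
  by apply: sumr_ge0 => k _; exact: powR_ge0.
by rewrite big_ord_recr/= lerDr; apply: sumr_ge0 => k _; exact: powR_ge0.
Qed.

Lemma weighted_embed_same p (q : \bar R) b (xi : R) : 0 < p -> (0 < q)%E -> recip q < b -> xi <= recip (Order.max p%:E q) ->
  exists2 C, 0 < C & forall F Z S, level_control p q b F Z S ->
    lq_le q (fun m => m.+1%:R `^ (- b + xi) * F m) (C * S).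
Proof.
move=> p0 q0 hb hxi.
suff [C C0 hC] : exists2 C, 0 < C & forall F Z S, level_control p q b F Z S ->
    lq_le q (fun m => m.+1%:R `^ (- b + recip (Order.max p%:E q)) * F m) (C * S).
  exists C => // F Z S h; have [F0 Z0 S0 _ _] := h.
  apply: (lq_leW q0 _ _ _ (lexx _) (hC F Z S h)).
  - by move=> m; rewrite mulr_ge0 ?powR_ge0.
  - move=> m; rewrite ler_wpM2r// ler_powR ?ler1n// lerD2l//.
  - by rewrite mulr_ge0 ?(ltW C0).
have [qp|pq] := ltP q p%:E; last by apply: weighted_embed_upper => //; rewrite ge_max pq lexx.
case: q q0 hb hxi qp => [s||] //= s0 sb _ sp; rewrite !lte_fin in s0 sp.
rewrite recipE//.
pose K : R := 2 `^ (1 - (- b + p^-1) * s).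
exists (K `^ s^-1); first by rewrite !powR_gt0.
move=> F Z S [F0 Z0 S0 hFZ hZ] n.
rewrite powRM ?powR_ge0// -powRrM mulVf ?gt_eqF// powRr1 ?powR_ge0//.
rewrite recipE// in sb; exact: (weighted_sum_le_small p0 s0 sb F0 Z0 hFZ hZ).
Qed.

End sequences.

(** * Sufficiency *)

Section norms.
Context {R : realType}.
Local Notation tm := (@torus_measure R).
Local Notation D k := (2^-1 ^+ k : R).
Local Notation re f := (fun x => complex.Re (f x)).
Local Notation im f := (fun x => complex.Im (f x)).
Implicit Types (p al t W V : R) (f : R -> R[i]).

Lemma cabs_ge0 (z : R[i]) : 0 <= cabs z.
Proof. by case: z => a b; exact: sqrtr_ge0. Qed.

Lemma re_le_cabs (z : R[i]) : `|complex.Re z| <= cabs z.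
Proof.
case: z => a b /=; rewrite -sqrtr_sqr; apply: ler_wsqrtr.
by rewrite lerDl sqr_ge0.
Qed.

Lemma im_le_cabs (z : R[i]) : `|complex.Im z| <= cabs z.
Proof.
case: z => a b /=; rewrite -sqrtr_sqr; apply: ler_wsqrtr.
by rewrite lerDr sqr_ge0.
Qed.

Lemma cabs_le (z : R[i]) : cabs z <= `|complex.Re z| + `|complex.Im z|.
Proof.
case: z => a b /=; rewrite -[leRHS]ger0_norm ?addr_ge0// -sqrtr_sqr; apply: ler_wsqrtr.
rewrite sqrrD !real_normK ?num_real// addrAC lerDl.
by rewrite mulrn_wge0// mulr_ge0.
Qed.

Lemma Lp_normE p f : Lp_norm p f = (pint p (fun x => cabs (f x)) `^ p^-1)%E.
Proof.
by rewrite /Lp_norm unlock /pint; congr (_ `^ _)%E.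
Qed.

Lemma Lp_norm_ge0 p f : (0 <= Lp_norm p f)%E.
Proof. by rewrite Lp_normE poweR_ge0. Qed.

Lemma pint_Lp_norm p f V : 0 < p -> 0 <= V ->
  (Lp_norm p f <= V%:E)%E -> (pint p (fun x => cabs (f x)) <= (V `^ p)%:E)%E.
Proof.
move=> p0 V0 h.
rewrite -[leLHS](poweRe1 (pint_ge0 _ _)) -(mulVf (lt0r_neq0 p0)) poweRrM -Lp_normE -poweR_EFin.
by apply: le_poweR => //; [exact: ltW|exact: Lp_norm_ge0].
Qed.

Lemma Lp_norm_pint p f V : 0 < p -> 0 <= V ->
  (pint p (fun x => cabs (f x)) <= (V `^ p)%:E)%E -> (Lp_norm p f <= V%:E)%E.
Proof.
move=> p0 V0 h; rewrite Lp_normE.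
have e : V = (V `^ p) `^ p^-1 by rewrite -powRrM mulfV ?gt_eqF// powRr1.
rewrite [in leRHS]e -poweR_EFin; apply: le_poweR => //; last exact: pint_ge0.
by rewrite invr_ge0 ltW.
Qed.

Lemma modulus_ge0 p al f t : 0 <= t -> (0 <= modulus al p f t)%E.
Proof.
move=> t0; apply: (@le_trans _ _ (Lp_norm p (frac_diff al 0 f))); first exact: Lp_norm_ge0.
by apply: ereal_sup_ubound; exists 0 => //=; rewrite normr0.
Qed.

Lemma modulus_le p al f t t' : t <= t' -> (modulus al p f t <= modulus al p f t')%E.
Proof.
by move=> tt; apply: ereal_sup_le => _ [h /= ht] <-; exists h => //=; exact: le_trans tt.
Qed.

(** The L_p norm of a fractional difference does not see the translation by
    al * y, so [fdiff] may be used for it. *)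
Lemma modulus_pint_re p al f t W y : 0 < p -> torus_fun f -> 0 <= W -> 0 <= y -> y <= t ->
  (modulus al p f t <= W%:E)%E -> (pint p (fdiff al y (re f)) <= (W `^ p)%:E)%E.
Proof.
move=> p0 [pf mr mi] W0 y0 yt hW; rewrite -pint_frac_diff_re//; last by move=> x; rewrite pf.
have h : (Lp_norm p (frac_diff al y f) <= W%:E)%E.
  by apply: le_trans hW; apply: ereal_sup_ubound; exists y => //=; rewrite ger0_norm.
apply: le_trans (pint_Lp_norm p0 W0 h); apply: pint_le; first exact: ltW.
by move=> x; rewrite [leRHS]ger0_norm ?cabs_ge0//; exact: (re_le_cabs (frac_diff al y f x)).
Qed.

Lemma modulus_pint_im p al f t W y : 0 < p -> torus_fun f -> 0 <= W -> 0 <= y -> y <= t ->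
  (modulus al p f t <= W%:E)%E -> (pint p (fdiff al y (im f)) <= (W `^ p)%:E)%E.
Proof.
move=> p0 [pf mr mi] W0 y0 yt hW; rewrite -pint_frac_diff_re//; last by move=> x; rewrite pf.
have h : (Lp_norm p (frac_diff al y f) <= W%:E)%E.
  by apply: le_trans hW; apply: ereal_sup_ubound; exists y => //=; rewrite ger0_norm.
apply: le_trans (pint_Lp_norm p0 W0 h); apply: pint_le; first exact: ltW.
by move=> x; rewrite [leRHS]ger0_norm ?cabs_ge0//; exact: (im_le_cabs (frac_diff al y f x)).
Qed.

Lemma measurable_cabs f : torus_fun f -> measurable_fun setT (fun x => cabs (f x)).
Proof.
move=> [_ mr mi].
rewrite (_ : (fun x => _) = (fun x => (complex.Re (f x) ^+ 2 + complex.Im (f x) ^+ 2) `^ 2^-1)); last first.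
  by apply/funext => x; rewrite powR12_sqrt ?addr_ge0 ?sqr_ge0//; case: (f x).
apply: (measurableT_comp (measurable_powR _)).
by apply: measurable_funD; exact: measurable_funX.
Qed.

Lemma rearrangement_ge0 f t : (0 <= rearrangement f t)%E.
Proof. by apply: le_ereal_inf_tmp => _ [s [s0 _] <-]; rewrite lee_fin. Qed.

Lemma rearrangement_lbound f t (s : R) : 0 <= s ->
  (tm [set x | (s < cabs (f x))%R] <= t%:E)%E -> (rearrangement f t <= s%:E)%E.
Proof. by move=> s0 h; apply: ereal_inf_lbound; exists s. Qed.

Lemma rearrangement_le f t t' : t <= t' -> (rearrangement f t' <= rearrangement f t)%E.
Proof.
move=> tt; apply: ereal_inf_le_tmp => _ [s [s0 h] <-]; exists s => //; split=> //.
by apply: le_trans h _; rewrite lee_fin.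
Qed.

(** Apply [sum_level_powR_le] to the real and imaginary parts, two dyadic steps
    further: the exceptional sets of the two parts then have total measure
    4 D m.+2 = D m. *)
Lemma sum_rearrangement_powR_le p al : 1 < p -> 0 < al -> al < p^-1 ->
  exists2 C : R, 0 < C & forall (M : nat) f W V,
    torus_fun f -> 0 <= W -> 0 < V ->
    (modulus al p f (D M) <= W%:E)%E -> (Lp_norm p f <= V%:E)%E ->
    exists phi : nat -> R,
      [/\ forall m, 0 <= phi m,
         forall m, (m <= M)%N -> (rearrangement f (D m) <= (phi m)%:E)%E &
         \sum_(m < M.+1) (D m `^ (p^-1 - al) * phi m) `^ p <= C * (D M `^ (- al) * W + V) `^ p].
Proof.
move=> p1 al0 alp; have p0 : 0 < p by exact: lt_trans p1.
have [C C0 hC] := sum_level_powR_le p1 al0 alp.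
set a := p^-1 - al; pose k : R := D 2 `^ (- al); pose c : R := D 2 `^ (- a).
have k1 : 1 <= k.
  rewrite /k powRN invf_ge1 ?powR_gt0 ?dy_gt0//.
  by rewrite dy_powR exprn_ile1 ?powR_ge0// ltW// half_powR_lt1.
have c0 : 0 < c by rewrite powR_gt0 ?dy_gt0.
exists (c `^ p * (2 `^ p * (C + C)) * k `^ p).
  by rewrite !mulr_gt0 ?powR_gt0 ?addr_gt0// (lt_le_trans ltr01 k1).
move=> M f W V tf W0 V0 hW hV; have [pf mr mi] := tf.
have Z0 : 0 < D M.+2 `^ (- al) * W + V by rewrite ltr_wpDl// mulr_ge0 ?powR_ge0.
have DM : D M.+2 <= D M by exact: (dy_le (leqW (leqnSn M))).
have hre y : 0 <= y -> y <= D M.+2 -> (pint p (fdiff al y (re f)) <= (W `^ p)%:E)%E.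
  by move=> y0 yM; apply: (modulus_pint_re p0 tf W0 y0 _ hW); exact: le_trans DM.
have him y : 0 <= y -> y <= D M.+2 -> (pint p (fdiff al y (im f)) <= (W `^ p)%:E)%E.
  by move=> y0 yM; apply: (modulus_pint_im p0 tf W0 y0 _ hW); exact: le_trans DM.
have hV1 := pint_Lp_norm p0 (ltW V0) hV.
have vre : (pint p (re f) <= (V `^ p)%:E)%E.
  apply: le_trans hV1; apply: pint_le; first exact: ltW.
  by move=> x; rewrite [leRHS]ger0_norm ?cabs_ge0 ?re_le_cabs.
have vim : (pint p (im f) <= (V `^ p)%:E)%E.
  apply: le_trans hV1; apply: pint_le; first exact: ltW.
  by move=> x; rewrite [leRHS]ger0_norm ?cabs_ge0 ?im_le_cabs.
have pre : per (re f) by move=> x; rewrite pf.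
have pim : per (im f) by move=> x; rewrite pf.
have [L1 [L10 L1h L1s]] := hC M.+2 _ W V mr pre W0 (ltW V0) Z0 hre vre.
have [L2 [L20 L2h L2s]] := hC M.+2 _ W V mi pim W0 (ltW V0) Z0 him vim.
exists (fun m => L1 m.+2 + L2 m.+2); split.
- by move=> m; rewrite addr_ge0.
- move=> m mM; apply: rearrangement_lbound; first by rewrite addr_ge0.
  have mM2 : (m.+2 <= M.+2)%N by [].
  have mnr : measurable_fun setT (fun x => `|re f x|) by exact: measurableT_comp.
  have mni : measurable_fun setT (fun x => `|im f x|) by exact: measurableT_comp.
  pose A := [set x : R | (L1 m.+2 < `|re f x|)%R]; pose B := [set x : R | (L2 m.+2 < `|im f x|)%R].
  have mA : measurable (A : set (measurableTypeR R)) by exact: (measurable_superlevel _ mnr).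
  have mB : measurable (B : set (measurableTypeR R)) by exact: (measurable_superlevel _ mni).
  apply: (@le_trans _ _ (tm (A `|` B))).
    apply: le_measure; rewrite ?inE.
    + exact: (measurable_superlevel _ (measurable_cabs tf)).
    + exact: measurableU.
    + move=> x /= hx; apply: contrapT => /not_orP[/negP nA /negP nB].
      move: hx; apply/negP; rewrite -leNgt; apply: le_trans (cabs_le _) _.
      by rewrite -!leNgt in nA nB; exact: lerD.
  apply: le_trans (measureU2 _ mA mB) _; apply: le_trans (leeD (L1h _ mM2) (L2h _ mM2)) _.
  by rewrite -EFinD lee_fin !dy_halfS; apply: eq_ler; field.
have kZ : D M.+2 `^ (- al) * W + V <= k * (D M `^ (- al) * W + V).
  rewrite -(addn2 M) dyD powRM ?dy_ge0// -/k mulrDr [_ * k]mulrC mulrA lerD2l.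
  by rewrite ler_peMl// ltW.
have hk : (D M.+2 `^ (- al) * W + V) `^ p <= k `^ p * (D M `^ (- al) * W + V) `^ p.
  rewrite -powRM ?powR_ge0 ?addr_ge0 ?mulr_ge0 ?powR_ge0 ?(ltW V0)//.
  apply: ge0_ler_powR; rewrite ?nnegrE ?(ltW p0) ?(ltW Z0)//.
  by rewrite mulr_ge0 ?powR_ge0// addr_ge0 ?mulr_ge0 ?powR_ge0 ?(ltW V0).
have drop2 (L : nat -> R) : \sum_(m < M.+1) (D m.+2 `^ a * L m.+2) `^ p <=
    \sum_(m < M.+3) (D m `^ a * L m) `^ p.
  rewrite [leRHS]big_ord_recl [X in _ + X]big_ord_recl/= addrA lerDr.
  by rewrite addr_ge0 ?powR_ge0.
rewrite -[X in _ <= X]mulrA; apply: le_trans (ler_wpM2l _ hk); last first.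
  by rewrite !mulr_ge0 ?powR_ge0 ?addr_ge0 ?(ltW C0).
rewrite -!mulrA mulrDl mulrDr.
apply: le_trans (_ : \sum_(m < M.+1) c `^ p * (2 `^ p * ((D m.+2 `^ a * L1 m.+2) `^ p + (D m.+2 `^ a * L2 m.+2) `^ p)) <= _).
  apply: ler_sum => m _.
  have -> : D m `^ a * (L1 m.+2 + L2 m.+2) = c * (D m.+2 `^ a * L1 m.+2 + D m.+2 `^ a * L2 m.+2).
    rewrite -mulrDr mulrA; congr (_ * _).
    rewrite -(addn2 m) dyD powRM ?dy_ge0// mulrC -mulrA /c -powRD_pos ?dy_gt0//.
    by rewrite addrN powRr0 mulr1.
  rewrite powRM ?powR_ge0 ?addr_ge0 ?mulr_ge0 ?powR_ge0//.
  by rewrite ler_wpM2l ?powR_ge0// powR_add_le ?mulr_ge0 ?powR_ge0// ltW.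
rewrite -mulr_sumr ler_wpM2l ?powR_ge0// -mulr_sumr -mulrDr ler_wpM2l ?powR_ge0// big_split/=.
by apply: lerD; [exact: le_trans (drop2 _) L1s|exact: le_trans (drop2 _) L2s].
Qed.

End norms.

Section lq.
Context {R : realType}.
Implicit Types (a : nat -> R) (K c : R) (u : \bar R).

Lemma lq_le_term u a K m : (0 < u)%E -> (forall m, 0 <= a m) -> 0 <= K -> u != -oo%E -> lq_le u a K -> a m <= K.
Proof.
case: u => [s||] //= s0 a0 K0 _ h; rewrite ?lte_fin in s0.
apply: (ler_powR_inv s0) => //; apply: le_trans (h m.+1).
by rewrite big_ord_recr/= lerDr; apply: sumr_ge0 => k _; exact: powR_ge0.
Qed.

Lemma lq_le_trunc u a K : (0 < u)%E -> (forall n, lq_le u (fun m => if (m < n)%N then a m else 0) K) -> lq_le u a K.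
Proof.
case: u => [s||] //= s0 h.
  move=> n; apply: le_trans (h n n); apply: ler_sum => m _; by rewrite ltn_ord.
by move=> m; have := h m.+1 m; rewrite ltnSn.
Qed.

Lemma lq_le_scale u a K c : (0 < u)%E -> (forall m, 0 <= a m) -> 0 <= K -> 0 <= c -> lq_le u a K -> lq_le u (fun m => c * a m) (c * K).
Proof.
case: u => [s||] //= s0 a0 K0 c0 h.
  move=> n; rewrite powRM//; under eq_bigr do rewrite powRM//.
  by rewrite -mulr_sumr ler_wpM2l ?powR_ge0.
by move=> m; rewrite ler_wpM2l.
Qed.

Lemma lq_le_add u : (0 < u)%E -> exists2 C : R, 0 < C & forall a a' K, (forall m, 0 <= a m) -> (forall m, 0 <= a' m) -> 0 <= K ->
  lq_le u a K -> lq_le u a' K -> lq_le u (fun m => a m + a' m) (C * K).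
Proof.
case: u => [s||] //= s0; last first.
  exists 2 => // a a' K _ _ _ h h' m.
  by rewrite mulr_natl mulr2n lerD.
rewrite lte_fin in s0; exists (2 * 2 `^ s^-1); first by rewrite mulr_gt0 ?powR_gt0.
move=> a a' K a0 a0' K0 h h' n; rewrite !powRM ?mulr_ge0 ?powR_ge0// -powRrM mulVf ?gt_eqF// powRr1//.
apply: le_trans (_ : \sum_(m < n) 2 `^ s * (a m `^ s + a' m `^ s) <= _).
  by apply: ler_sum => m _; apply: powR_add_le => //; exact: ltW.
rewrite -mulr_sumr -mulrA ler_wpM2l ?powR_ge0// big_split/= mulr_natl mulr2n.
exact: lerD.
Qed.

Lemma lq_le_const u (b : R) : (0 < u)%E -> recip u < b ->
  exists2 C : R, 0 < C & forall K, 0 <= K -> lq_le u (fun m => m.+1%:R `^ (- b) * K) (C * K).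
Proof.
case: u => [s||] //= s0; last first.
  rewrite recipy => b0; exists 1 => // K K0 m; rewrite ler_wpM2r//.
  rewrite -[X in _ <= X](@powRr0 R m.+1%:R) ler_powR ?ler1n// oppr_le0 ltW//.
rewrite lte_fin in s0; rewrite recipE// => sb.
have bs : 0 < b * s - 1 by rewrite subr_gt0 -(mulVf (lt0r_neq0 s0)) ltr_pM2r.
pose K0 : R := 1 + (b * s - 1)^-1.
have K00 : 0 < K0 by rewrite addr_gt0 ?invr_gt0.
exists (K0 `^ s^-1); first by rewrite powR_gt0.
move=> K Kp n; rewrite powRM ?powR_ge0// -powRrM mulVf ?gt_eqF// powRr1 ?(ltW K00)//.
under eq_bigr do rewrite powRM ?powR_ge0// -powRrM.
rewrite -mulr_suml ler_wpM2r ?powR_ge0//.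
have [->|n0] := posnP n; first by rewrite big_ord0 ltW.
rewrite -(big_mkord xpredT (fun m => m.+1%:R `^ (- b * s))) big_ltn// powR1 lerD2l.
have := sum_powRN_le n bs (ltnSn 0); rewrite powR1 mulr1.
by rewrite (_ : - (b * s - 1) - 1 = - b * s)//; ring.
Qed.

End lq.

Section sufficiency.
Context {R : realType}.
Local Notation D k := (2^-1 ^+ k : R).
Context (p al b r : R) (q : \bar R).
Context (p1 : 1 < p) (al0 : 0 < al) (alp : al < p^-1) (rE : r^-1 = p^-1 - al).
Context (q0 : (0 < q)%E) (hb : recip q < b).

Let p0 : 0 < p. Proof. exact: lt_trans p1. Qed.

Let b0 : 0 < b.
Proof.
apply: le_lt_trans hb; case: q q0 => [s||] // s0.
by rewrite recipE// invr_ge0 ltW.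
Qed.

Let qN : q != -oo%E. Proof. by case: q q0. Qed.

(** The modulus may a priori be infinite at some points, so the statement is made for
    real sequences below it. *)
Lemma lip_modulus_seq : exists2 C : R, 0 < C & forall f (S : R) (w : nat -> R),
  0 <= S -> (lip_norm p q al b f <= S%:E)%E -> (forall m, 0 <= w m) ->
  (forall m, ((w m)%:E <= modulus al p f (D m.+1))%E) ->
  lq_le q (fun m => m.+1%:R `^ (- b) * (D m.+1 `^ (- al) * w m)) (C * S).
Proof.
have [C C0 hC] := Lq_dtt_ge q0.
pose c : R := (2 `^ `|- b|)^-1 * 2^-1 `^ al.
have c0 : 0 < c by rewrite mulr_gt0 ?invr_gt0 ?powR_gt0.
exists (c^-1 * C); first by rewrite mulr_gt0 ?invr_gt0.
move=> f S w S0 hS w0 hw.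
pose a m := c * (m.+1%:R `^ (- b) * (D m.+1 `^ (- al) * w m)).
have a0 m : 0 <= a m by rewrite !mulr_ge0 ?powR_ge0 ?(ltW c0).
have hL : (Lq_dtt q (fun t => (t `^ (- al) * (1 - ln t) `^ (- b))%:E * modulus al p f t) <= S%:E)%E.
  by apply: le_trans hS; rewrite /lip_norm leeDr// Lp_norm_ge0.
have ha : lq_le q a (C * S).
  apply: lq_le_trunc => // n; apply: hC => //; last exact: hL.
  move=> m t _ h1 h2; have t0 : 0 < t by apply: lt_le_trans h1; exact: dy_gt0.
  have [/andP[l1 l2] _] := ln_dy_bounds h1 h2.
  have m0 : 0 < m.+1%:R :> R by rewrite ltr0n.
  have /andP[w1 _] := powR_weight (- b) m0 l1 l2.
  rewrite (_ : a m = 2^-1 `^ al * D m.+1 `^ (- al) * ((2 `^ `|- b|)^-1 * m.+1%:R `^ (- b)) * w m); last first.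
    by rewrite /a /c; ring.
  rewrite EFinM; apply: lee_pmul; rewrite ?lee_fin ?mulr_ge0 ?powR_ge0 ?invr_ge0 ?powR_ge0//.
    apply: ler_pM; rewrite ?mulr_ge0 ?powR_ge0 ?invr_ge0 ?powR_ge0//.
    rewrite dy_halfS powRM ?dy_ge0// mulrA -powRD_pos// addrN powRr0 mul1r.
    by apply: powRN_le; rewrite ?oppr_le0 ?(ltW al0) ?(ltW h2).
  by apply: le_trans (hw m) _; exact: modulus_le.
have := lq_le_scale q0 a0 (mulr_ge0 (ltW C0) S0) (ltW (eqbRL (invr_gt0 c) c0)) ha.
rewrite mulrA; congr (lq_le _ _ _); apply/funext => m.
by rewrite /a mulrA mulVf ?mul1r ?gt_eqF.
Qed.

(** Otherwise the sequence in [lip_modulus_seq] could be arbitrarily large at one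
    index. *)
Lemma lip_modulus_fin f (S : R) m : 0 <= S -> (lip_norm p q al b f <= S%:E)%E ->
  (modulus al p f (D m.+1) < +oo)%E.
Proof.
move=> S0 hS; rewrite ltey; apply/eqP => e.
have [C C0 hC] := lip_modulus_seq.
pose k : R := m.+1%:R `^ (- b) * D m.+1 `^ (- al).
have k0 : 0 < k by rewrite mulr_gt0 ?powR_gt0 ?dy_gt0.
pose w j := if j == m then (C * S + 1) / k else 0.
have w0 j : 0 <= w j by rewrite /w; case: ifP => // _; rewrite divr_ge0 ?addr_ge0 ?mulr_ge0 ?(ltW C0) ?(ltW k0).
have hw j : ((w j)%:E <= modulus al p f (D j.+1))%E.
  rewrite /w; case: eqP => [->|_]; first by rewrite e leey.
  by apply: modulus_ge0; exact: dy_ge0.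
have h := hC f S w S0 hS w0 hw.
have h2 j : 0 <= j.+1%:R `^ (- b) * (D j.+1 `^ (- al) * w j) by rewrite !mulr_ge0 ?powR_ge0.
have := lq_le_term m q0 h2 (mulr_ge0 (ltW C0) S0) qN h.
rewrite /w eqxx mulrA -/k [k * _]mulrC divfK ?gt_eqF//; apply/negP.
by rewrite -ltNge ltrDl.
Qed.

Lemma lip_level_control : exists2 C : R, 0 < C & forall f (S : R),
  torus_fun f -> 0 < S -> (lip_norm p q al b f <= S%:E)%E ->
  exists Z : nat -> R, (forall m, (rearrangement f (D m.+1) < +oo)%E) /\
    level_control p q b (fun m => D m.+1 `^ r^-1 * fine (rearrangement f (D m.+1))) Z (C * S).
Proof.
have [C1 C10 h1] := lip_modulus_seq.
have [C2 C20 h2] := lq_le_const q0 hb.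
have [C3 C30 h3] := lq_le_add q0.
have [C4 C40 h4] := sum_rearrangement_powR_le p1 al0 alp.
pose k : R := C4 `^ p^-1.
have k0 : 0 < k by rewrite powR_gt0.
exists (k * (C3 * (C1 + C2))); first by rewrite !mulr_gt0 ?addr_gt0.
move=> f S tf S0 hS.
have hV : (Lp_norm p f <= S%:E)%E.
  apply: le_trans hS; rewrite /lip_norm leeDl// Lq_dtt_ge0// => t t0.
  by rewrite mule_ge0 ?lee_fin ?mulr_ge0 ?powR_ge0// modulus_ge0// ltW.
pose w m := fine (modulus al p f (D m.+1)).
have wE m : ((w m)%:E = modulus al p f (D m.+1))%E.
  rewrite fineK// ge0_fin_numE; first exact: (lip_modulus_fin m (ltW S0) hS).
  by apply: modulus_ge0; exact: dy_ge0.
have w0 m : 0 <= w m by rewrite fine_ge0// modulus_ge0// dy_ge0.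
pose Z m := k * (D m.+1 `^ (- al) * w m + S).
have Z0 m : 0 <= Z m by rewrite mulr_ge0 ?(ltW k0)// addr_ge0 ?mulr_ge0 ?powR_ge0 ?(ltW S0).
have core M : exists phi : nat -> R,
      [/\ forall m, 0 <= phi m,
         forall m, (m <= M.+1)%N -> (rearrangement f (D m) <= (phi m)%:E)%E &
         \sum_(m < M.+2) (D m `^ (p^-1 - al) * phi m) `^ p <= C4 * (D M.+1 `^ (- al) * w M + S) `^ p].
  by apply: h4 => //; rewrite wE.
have rf m : (rearrangement f (D m.+1) < +oo)%E.
  have [phi [_ hphi _]] := core m.
  by apply: le_lt_trans (hphi m.+1 (leqnn _)) _; rewrite ltry.
exists Z; split=> //; split.
- by move=> m; rewrite mulr_ge0 ?powR_ge0// fine_ge0// rearrangement_ge0.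
- exact: Z0.
- by rewrite !mulr_ge0 ?addr_ge0 ?ltW.
- move=> M; have [phi [phi0 hphi hs]] := core M.
  rewrite /Z powRM ?(ltW k0) ?addr_ge0 ?mulr_ge0 ?powR_ge0 ?(ltW S0)//.
  rewrite /k -powRrM mulVf ?gt_eqF// powRr1 ?(ltW C40)//; apply: le_trans hs.
  rewrite [leRHS]big_ord_recl; apply: le_trans (_ : \sum_(i < M.+1) (D i.+1 `^ (p^-1 - al) * phi i.+1) `^ p <= _); last first.
    by rewrite lerDr powR_ge0.
  apply: ler_sum => m _; rewrite rE; apply: ge0_ler_powR; rewrite ?nnegrE ?(ltW p0) ?mulr_ge0 ?powR_ge0//.
    by rewrite fine_ge0// rearrangement_ge0.
  rewrite ler_wpM2l ?powR_ge0// -lee_fin fineK; first by apply: hphi.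
  by rewrite ge0_fin_numE ?rf ?rearrangement_ge0.
- have wle m : ((w m)%:E <= modulus al p f (D m.+1))%E by rewrite wE.
  have e1 := h1 f S w (ltW S0) hS w0 wle.
  have e2 := h2 S (ltW S0).
  have CS : 0 <= (C1 + C2) * S by rewrite mulr_ge0 ?addr_ge0 ?ltW.
  have A0 m : 0 <= m.+1%:R `^ (- b) * (D m.+1 `^ (- al) * w m) by rewrite !mulr_ge0 ?powR_ge0.
  have B0 m : 0 <= m.+1%:R `^ (- b) * S by rewrite mulr_ge0 ?powR_ge0 ?ltW.
  have e1' : lq_le q (fun m => m.+1%:R `^ (- b) * (D m.+1 `^ (- al) * w m)) ((C1 + C2) * S).
    apply: (lq_leW q0 A0 (fun m => lexx _) _ _ e1).
    + by rewrite mulr_ge0 ?ltW.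
    + by rewrite mulrDl lerDl mulr_ge0 ?ltW.
  have e2' : lq_le q (fun m => m.+1%:R `^ (- b) * S) ((C1 + C2) * S).
    apply: (lq_leW q0 B0 (fun m => lexx _) _ _ e2).
    + by rewrite mulr_ge0 ?ltW.
    + by rewrite mulrDl lerDr mulr_ge0 ?ltW.
  have e3 := h3 _ _ _ A0 B0 CS e1' e2'.
  have AB0 m : 0 <= m.+1%:R `^ (- b) * (D m.+1 `^ (- al) * w m) + m.+1%:R `^ (- b) * S by rewrite addr_ge0.
  have := lq_le_scale q0 AB0 (mulr_ge0 (ltW C30) CS) (ltW k0) e3.
  rewrite (_ : k * (C3 * ((C1 + C2) * S)) = k * (C3 * (C1 + C2)) * S); last by ring.
  by congr (lq_le _ _ _); apply/funext => m; rewrite /Z; ring.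
Qed.

Lemma lz_norm_le (u : \bar R) (c : R) : (0 < u)%E -> exists2 C : R, 0 < C & forall f (K : R),
  0 <= K -> (forall m, (rearrangement f (D m.+1) < +oo)%E) ->
  lq_le u (fun m => m.+1%:R `^ c * (D m.+1 `^ r^-1 * fine (rearrangement f (D m.+1)))) K ->
  (lz_norm r u c f <= (C * K)%:E)%E.
Proof.
move=> u0; pose k : R := 2 `^ `|c| * 2 `^ r^-1.
have k0 : 0 < k by rewrite mulr_gt0 ?powR_gt0.
exists k => // f K K0 rf hK.
pose a m := m.+1%:R `^ c * (D m.+1 `^ r^-1 * fine (rearrangement f (D m.+1))).
have a0 m : 0 <= a m by rewrite !mulr_ge0 ?powR_ge0// fine_ge0// rearrangement_ge0.
apply: (Lq_dtt_le u0 _ _ _ (lq_le_scale u0 a0 K0 (ltW k0) hK)).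
- by rewrite mulr_ge0 ?(ltW k0).
- by move=> m; rewrite mulr_ge0 ?(ltW k0) ?a0.
move=> m t t1 t2; have t0 : 0 < t by apply: lt_le_trans t1; exact: dy_gt0.
have [/andP[l1 l2] lE] := ln_dy_bounds t1 t2.
have m0 : 0 < m.+1%:R :> R by rewrite ltr0n.
have /andP[_ w2] := powR_weight c m0 l1 l2.
apply/andP; split; first by rewrite mule_ge0 ?rearrangement_ge0// lee_fin mulr_ge0 ?powR_ge0.
have rp : 0 <= r^-1 by rewrite rE subr_ge0 ltW.
rewrite (_ : k * a m = ((2 * D m.+1) `^ r^-1 * (2 `^ `|c| * m.+1%:R `^ c)) * fine (rearrangement f (D m.+1))); last first.
  by rewrite /k /a powRM ?dy_ge0//; ring.
rewrite [leRHS]EFinM; apply: lee_pmul; rewrite ?lee_fin ?mulr_ge0 ?powR_ge0 ?rearrangement_ge0//.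
  apply: ler_pM; rewrite ?powR_ge0//; last by rewrite lE.
  apply: ge0_ler_powR; rewrite ?nnegrE ?(ltW t0) ?mulr_ge0 ?dy_ge0//.
  by rewrite dy_halfS mulrA divff// mul1r ltW.
rewrite fineK; first exact: rearrangement_le.
by rewrite ge0_fin_numE ?rf ?rearrangement_ge0.
Qed.

(** Continuity at f only involves the norms of the differences g - f, so that a
    bound on the norms suffices. *)
Lemma embeds_of_bound (u : \bar R) (c C : R) : 0 < C ->
  (forall f (S : R), torus_fun f -> 0 < S -> (lip_norm p q al b f <= S%:E)%E ->
     (lz_norm r u c f <= (C * S)%:E)%E) ->
  lip_embeds_lz p q al b r u c.
Proof.
move=> C0 h; split.
  move=> f [tf _ fin]; split=> //.
  pose S := fine (lip_norm p q al b f) + 1.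
  have L0 : (0 <= lip_norm p q al b f)%E.
    rewrite /lip_norm adde_ge0 ?Lp_norm_ge0// Lq_dtt_ge0// => t t0.
    by rewrite mule_ge0 ?lee_fin ?mulr_ge0 ?powR_ge0// modulus_ge0// ltW.
  have S0 : 0 < S by rewrite ltr_wpDl// fine_ge0.
  apply: le_lt_trans (h f S tf S0 _) (ltry _).
  by rewrite /S -[leLHS]fineK ?ge0_fin_numE// lee_fin lerDl.
move=> f [tf _ _] e e0; exists (e / (2 * C)); first by rewrite divr_gt0 ?mulr_gt0.
move=> g [tg _ _] hg.
have tgf : torus_fun (fun x => g x - f x).
  case: tf => pf mrf mif; case: tg => pg mrg mig; split.
  - by move=> x; rewrite pf pg.
  - rewrite (_ : (fun x => _) = (fun x => complex.Re (g x) - complex.Re (f x))); first exact: measurable_funB.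
    by apply/funext => x; case: (g x) => ? ?; case: (f x).
  - rewrite (_ : (fun x => _) = (fun x => complex.Im (g x) - complex.Im (f x))); first exact: measurable_funB.
    by apply/funext => x; case: (g x) => ? ?; case: (f x).
apply: le_lt_trans (h _ _ tgf _ (ltW hg)) _; first by rewrite divr_gt0 ?mulr_gt0.
have -> : C * (e / (2 * C)) = e / 2 by field; rewrite gt_eqF.
by rewrite lte_fin ltr_pdivrMr// ltr_pMr// ltr1n.
Qed.

Lemma embeds_same (xi : R) : xi <= recip (Order.max p%:E q) ->
  lip_embeds_lz p q al b r q (- b + xi).
Proof.
move=> hxi; have [C1 C10 h1] := lip_level_control.
have [C2 C20 h2] := weighted_embed_same p0 q0 hb hxi.
have [C3 C30 h3] := lz_norm_le (- b + xi) q0.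
apply: (@embeds_of_bound _ _ (C3 * (C2 * C1))); first by rewrite !mulr_gt0.
move=> f S tf S0 hS; have [Z [rf hZ]] := h1 f S tf S0 hS.
rewrite -!mulrA; apply: h3 => //; first by rewrite !mulr_ge0 ?ltW.
exact: h2 hZ.
Qed.

Lemma embeds_upper (u : \bar R) : (Order.max p%:E q <= u)%E ->
  lip_embeds_lz p q al b r u (- b + recip q).
Proof.
move=> hu; have [C1 C10 h1] := lip_level_control.
have u0 : (0 < u)%E by apply: lt_le_trans hu; rewrite lt_max q0 orbT.
have [C2 C20 h2] := weighted_embed_upper p0 q0 hb hu.
have [C3 C30 h3] := lz_norm_le (- b + recip q) u0.
apply: (@embeds_of_bound _ _ (C3 * (C2 * C1))); first by rewrite !mulr_gt0.
move=> f S tf S0 hS; have [Z [rf hZ]] := h1 f S tf S0 hS.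
rewrite -!mulrA; apply: h3 => //; first by rewrite !mulr_ge0 ?ltW.
exact: h2 hZ.
Qed.

End sufficiency.

(** * Differences of Lipschitz functions and the distance to the integers *)

Section lipschitz_differences.
Context {R : realType}.
Local Notation tm := (@torus_measure R).
Implicit Types (al h x B L : R) (g : R -> R).

Lemma norm_lim_le (u : R ^nat) (E : R) N : cvgn u -> (forall n, (N <= n)%N -> `|u n| <= E) -> `|limn u| <= E.
Proof.
move=> cu hu; rewrite -lim_norm//; apply: limr_le; first exact: is_cvg_norm.
by near=> n; apply: hu; near: n; exact: nbhs_infty_ge.
Unshelve. all: by end_near. Qed.

Lemma cvg_fdiff al h g x B : 0 < al -> al <= 1 -> (forall y, `|g y| <= B) ->
  cvgn (series (fun j => binc al j * g (x - j%:R * h))).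
Proof.
move=> al0 al1 gB; have B0 : 0 <= B by exact: le_trans (gB 0).
apply: (is_cvg_series_abs_bound (B := (2 + al^-1) * B)) => n.
apply: le_trans (_ : \sum_(j < n) `|binc al j| * B <= _).
  by apply: ler_sum => j _; rewrite normrM ler_wpM2l.
by rewrite -mulr_suml ler_wpM2r// sum_norm_binc_le.
Qed.

(** The terms up to J are compared with g x by the Lipschitz bound. The
    coefficients left in front of g x add up to a coefficient of
    (1 - z)^(al - 1), which is small, as is the sum of the coefficients after J. *)
Lemma fdiff_lip al h g x B L (J : nat) : 0 < al -> al < 1 -> (forall y, `|g y| <= B) ->
  (forall y z, `|g y - g z| <= L * `|y - z|) -> 0 <= L -> 0 <= h -> (0 < J)%N ->
  `|fdiff al h g x| <= h * L * ((1 - al)^-1 * J%:R `^ (1 - al)) + (1 + al^-1) * B * J%:R `^ (- al).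
Proof.
move=> al0 al1 gB gL L0 h0 J0; have B0 : 0 <= B by exact: le_trans (gB 0).
have al1' : 0 < 1 - al by rewrite subr_gt0.
apply: (@norm_lim_le _ _ J.+1); first exact: (@cvg_fdiff al h g x B al0 (ltW al1) gB).
move=> n Jn; rewrite /series/= (@big_cat_nat _ _ _ J.+1)//=.
have e1 : \sum_(0 <= j < J.+1) binc al j * g (x - j%:R * h) =
    \sum_(0 <= j < J.+1) binc al j * (g (x - j%:R * h) - g x) + (\sum_(0 <= j < J.+1) binc al j) * g x.
  by rewrite mulr_suml -big_split/=; apply: eq_bigr => j _; rewrite mulrBr subrK.
have b1 : `|\sum_(0 <= j < J.+1) binc al j * (g (x - j%:R * h) - g x)| <=
    h * L * ((1 - al)^-1 * J%:R `^ (1 - al)).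
  rewrite big_nat_recl// mul0r subr0 subrr mulr0 add0r big_mkord.
  apply: le_trans (ler_norm_sum _ _ _) _.
  apply: le_trans (_ : \sum_(j < J) h * L * j.+1%:R `^ ((1 - al) - 1) <= _); last first.
    by rewrite -mulr_sumr ler_wpM2l ?mulr_ge0// sum_powR_le// gerBl ltW.
  apply: ler_sum => j _; rewrite normrM.
  have j0 : 0 < j.+1%:R :> R by rewrite ltr0n.
  apply: le_trans (_ : j.+1%:R `^ (- al - 1) * (L * (j.+1%:R * h)) <= _).
    apply: ler_pM => //; first exact: (norm_binc_le j al0 (ltW al1)).
    apply: le_trans (gL _ _) _; rewrite ler_wpM2l// addrAC subrr add0r normrN ger0_norm ?mulr_ge0//.
  rewrite (_ : 1 - al - 1 = (- al - 1) + 1); last by ring.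
  by rewrite [X in _ <= _ * X]powRD_pos// powRr1 ?(ltW j0)//; apply: eq_ler; ring.
have b2 : `|(\sum_(0 <= j < J.+1) binc al j) * g x| <= J%:R `^ (- al) * B.
  rewrite normrM; apply: ler_pM => //.
  rewrite big_mkord sum_binc (_ : al - 1 = - (1 - al)); last by ring.
  have al1'' : 1 - al <= 1 by rewrite gerBl ltW.
  have /andP[p0 p1] := bincN_bounds J al1' al1''.
  rewrite ger0_norm//; apply: le_trans p1 _.
  rewrite (_ : 1 - al - 1 = - al); last by ring.
  by apply: powRN_le; rewrite ?ltr0n ?oppr_le0 ?(ltW al0)// ler_nat.
have b3 : `|\sum_(J.+1 <= j < n) binc al j * g (x - j%:R * h)| <= al^-1 * J%:R `^ (- al) * B.
  apply: le_trans (ler_norm_sum _ _ _) _.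
  apply: le_trans (_ : (\sum_(J <= j < n.-1) `|binc al j.+1|) * B <= _); last first.
    by rewrite ler_wpM2r// sum_tail_binc_le// ltW.
  have n1 : n = n.-1.+1 by rewrite prednK// (leq_trans _ Jn).
  rewrite {1}n1 big_add1/= mulr_suml; apply: ler_sum => j _.
  by rewrite normrM ler_wpM2l.
rewrite e1; apply: le_trans (ler_normD _ _) _; apply: le_trans (lerD (ler_normD _ _) (lexx _)) _.
apply: le_trans (lerD (lerD b1 b2) b3) _.
rewrite -addrA lerD2l; apply: eq_ler; ring.
Qed.

(** The case J = a / h (rounded down), for a function of size B that varies at the scale a. *)
Lemma fdiff_lip_scale al h g x B (a : R) : 0 < al -> al < 1 -> (forall y, `|g y| <= B) ->
  (forall y z, `|g y - g z| <= B / a * `|y - z|) -> 0 < h -> h <= a ->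
  `|fdiff al h g x| <= ((1 - al)^-1 + (1 + al^-1) * 2 `^ al) * B * (a / h) `^ (- al).
Proof.
move=> al0 al1 gB gL h0 ha; have B0 : 0 <= B by exact: le_trans (gB 0).
have a0 : 0 < a by exact: lt_le_trans ha.
have al1' : 0 < 1 - al by rewrite subr_gt0.
pose J := Num.truncn (a / h).
have r0 : 0 < a / h by rewrite divr_gt0.
have /andP[J1 J2] := truncn_itv (ltW r0).
rewrite -/J in J1 J2.
have J0 : (0 < J)%N by rewrite truncn_gt0 ler_pdivlMr// mul1r.
have Jp : 0 < J%:R :> R by rewrite ltr0n.
have L0 : 0 <= B / a by rewrite divr_ge0// ltW.
apply: le_trans (fdiff_lip x al0 al1 gB gL L0 (ltW h0) J0) _.
rewrite [leRHS](_ : _ = (1 - al)^-1 * (B * (a / h) `^ (- al)) + (1 + al^-1) * B * (2 `^ al * (a / h) `^ (- al))); last by ring.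
apply: lerD.
  rewrite mulrCA ler_wpM2l ?invr_ge0 ?(ltW al1')//.
  have -> : h * (B / a) = B * (a / h)^-1 by rewrite invfM invrK; ring.
  rewrite -mulrA ler_wpM2l// ler_pdivrMl//.
  rewrite -[X in _ <= X * _](powRr1 (ltW r0)) -powRD_pos//.
  by apply: ge0_ler_powR; rewrite ?nnegrE ?(ltW al1') ?(ltW r0) ?(ltW Jp).
rewrite ler_wpM2l ?mulr_ge0 ?addr_ge0 ?invr_ge0 ?(ltW al0)//.
have -> : 2 `^ al * (a / h) `^ (- al) = (a / h / 2) `^ (- al).
  rewrite [in RHS]powRM ?(ltW r0) ?invr_ge0// mulrC; congr (_ * _).
  by rewrite -powR_inv1// -powRrM mulN1r opprK.
apply: powRN_le; rewrite ?oppr_le0 ?(ltW al0) ?divr_gt0// ler_pdivrMr// mulr_natr mulr2n.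
apply: ltW; apply: lt_le_trans J2 _.
by rewrite -natr1 lerD2l ler1n.
Qed.

(** The coefficients of (1 - z)^al add up to 0. Letting J tend to infinity in
    [fdiff_lip] avoids a separate proof of this. *)
Lemma fdiff0 al g x B L : 0 < al -> al < 1 -> (forall y, `|g y| <= B) ->
  (forall y z, `|g y - g z| <= L * `|y - z|) -> 0 <= L -> fdiff al 0 g x = 0.
Proof.
move=> al0 al1 gB gL L0; have B0 : 0 <= B by exact: le_trans (gB 0).
apply/eqP; rewrite -normr_le0 leNgt; apply/negP; set F := `|_| => F0.
pose K := (1 + al^-1) * B; have K0 : 0 <= K by rewrite mulr_ge0 ?addr_ge0 ?invr_ge0 ?(ltW al0).
pose J := (Num.truncn ((K / F) `^ al^-1)).+1.
have := fdiff_lip x al0 al1 gB gL L0 (lexx 0) (ltn0Sn _ : (0 < J)%N).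
rewrite !mul0r add0r -/F -/K; apply/negP; rewrite -ltNge.
have Jp : 0 < J%:R `^ al by rewrite powR_gt0// ltr0n.
rewrite powRN ltr_pdivrMr// mulrC -ltr_pdivrMr//.
have KF : 0 <= K / F by rewrite divr_ge0// ltW.
have e : K / F = ((K / F) `^ al^-1) `^ al by rewrite -powRrM mulVf ?gt_eqF// powRr1.
rewrite e; apply: gt0_ltr_powR; rewrite ?nnegrE ?powR_ge0//.
exact: truncnS_gt.
Qed.

Lemma fdiff_sum al h (T : nat -> R -> R) (c B : nat -> R) K x : 0 < al -> al <= 1 ->
  (forall k y, `|T k y| <= B k) ->
  fdiff al h (fun x => \sum_(k < K) c k * T k x) x = \sum_(k < K) c k * fdiff al h (T k) x.
Proof.
move=> al0 al1 TB; elim: K => [|K IH].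
  rewrite big_ord0 /fdiff (_ : (fun j => _) = (fun=> 0)).
    rewrite (_ : series _ = cst 0) ?lim_cst//.
    by apply/funext => n; rewrite /series/= big1.
  by apply/funext => j; rewrite big_ord0 mulr0.
rewrite big_ord_recr/= -IH /fdiff.
have B0 k : 0 <= B k by exact: le_trans (TB k 0).
have c1 : cvgn (series (fun j => binc al j * T K (x - j%:R * h))).
  exact: (@cvg_fdiff al h (T K) x (B K) al0 al1 (TB K)).
have c2 : cvgn (series (fun j => binc al j * \sum_(k < K) c k * T k (x - j%:R * h))).
  apply: (@cvg_fdiff al h (fun x => \sum_(k < K) c k * T k x) x (\sum_(k < K) `|c k| * B k) al0 al1).
  move=> y; apply: le_trans (ler_norm_sum _ _ _) _; apply: ler_sum => k _.
  by rewrite normrM ler_wpM2l.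
have c3 := @is_cvg_seriesZ _ _ (c K) c1.
rewrite -[c K * limn _](lim_seriesZ (c K) c1) -lim_seriesD//; congr (limn (series _)); apply/funext => j.
by rewrite big_ord_recr/= [RHS]/GRing.add/= mulrDr [in X in _ + X]mulrCA /GRing.scale/=.
Qed.

End lipschitz_differences.

Section distance_to_integers.
Context {R : realType}.
Local Notation tm := (@torus_measure R).
Local Notation mu := (@lebesgue_measure R).
Implicit Types (x y s : R).

Definition distZ x : R := `|x - (Num.floor (x + 2^-1))%:~R|.

Lemma distZ_le x (n : int) : distZ x <= `|x - n%:~R|.
Proof.
rewrite /distZ; set m := Num.floor _.
have /andP[h1 h2] := floor_itv (x + 2^-1); rewrite -/m rmorphD/= in h1 h2.
have h3 : `|x - m%:~R| <= 2^-1 by rewrite ler_norml; apply/andP; split; lra.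
have [->//|mn] := eqVneq n m.
have h4 : 1 <= `|m%:~R - n%:~R : R|.
  rewrite -intrB -intr_norm ler1z; have : m - n != 0 by rewrite subr_eq0 eq_sym.
  by lia.
have := ler_normD (x - n%:~R) (m%:~R - x).
rewrite addrC subrKA distrC [`|m%:~R - x|]distrC => h5.
have h6 : `|n%:~R - m%:~R : R| = `|m%:~R - n%:~R| by rewrite distrC.
lra.
Qed.

Lemma distZ_ex x : exists n : int, distZ x = `|x - n%:~R|.
Proof. by eexists. Qed.

Lemma distZ_ge0 x : 0 <= distZ x. Proof. exact: normr_ge0. Qed.

Lemma distZ_le_half x : distZ x <= 2^-1.
Proof.
have /andP[h1 h2] := floor_itv (x + 2^-1); rewrite rmorphD/= in h1 h2.
by rewrite /distZ ler_norml; apply/andP; split; lra.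
Qed.

Lemma per_distZ : per distZ.
Proof.
move=> x; apply/eqP; rewrite eq_le; apply/andP; split.
  have [n ->] := distZ_ex x; apply: le_trans (distZ_le _ (n + 1)) _.
  by rewrite rmorphD/= opprD addrACA subrr addr0.
have [n ->] := distZ_ex (x + 1); apply: le_trans (distZ_le _ (n - 1)) _.
by rewrite rmorphB/= opprB addrA addrAC.
Qed.

Lemma distZN x : distZ (- x) = distZ x.
Proof.
have H y : distZ (- y) <= distZ y.
  have [n ->] := distZ_ex y; apply: le_trans (distZ_le _ (- n)) _.
  by rewrite rmorphN/= -opprD normrN.
by apply/eqP; rewrite eq_le H -{1}[x]opprK H.
Qed.

Lemma distZ_lip x y : `|distZ x - distZ y| <= `|x - y|.
Proof.
have H u v : distZ u <= distZ v + `|u - v|.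
  have [n ->] := distZ_ex v; apply: le_trans (distZ_le _ n) _.
  have -> : u - n%:~R = (v - n%:~R) + (u - v) by ring.
  exact: ler_normD.
rewrite ler_norml; apply/andP; split; last by rewrite lerBlDl H.
by rewrite lerNl opprB lerBlDl distrC H.
Qed.

Lemma continuous_distZ : continuous distZ.
Proof.
move=> x; apply/cvgrPdist_lt => e e0; near=> y.
apply: le_lt_trans (distZ_lip x y) _; near: y.
exact: (@cvgr_dist_lt _ _ _ _ _ id x).
Unshelve. all: by end_near. Qed.

Lemma measurable_distZ : measurable_fun setT distZ.
Proof. exact: continuous_measurable_fun continuous_distZ. Qed.

Lemma tm_distZ_lt s : 0 <= s -> (tm [set x | (distZ x < s)%R] <= (2 * s)%:E)%E.
Proof.
move=> s0; rewrite torus_measureE.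
have mA : measurable ([set x | (distZ x < s)%R] : set (measurableTypeR R)).
  rewrite -[X in measurable X]setTI (_ : [set x | _] = distZ @^-1` `]-oo, s[).
    by apply: measurable_distZ => //; exact: measurable_itv.
  by apply/seteqP; split => u /=; rewrite in_itv/=.
have m1 : measurable (`[0%R, s] : set (measurableTypeR R)) by exact: measurable_itv.
have m2 : measurable (`[1%R - s, 1%R] : set (measurableTypeR R)) by exact: measurable_itv.
apply: (@le_trans _ _ (mu (`[0%R, s] `|` `[1%R - s, 1%R]))).
  apply: le_measure; rewrite ?inE.
  - by apply: measurableI => //; exact: measurable_itv.
  - exact: measurableU.
  - move=> x [/= h]; rewrite in_itv/= => /andP[x0 x1].
    have [n hn] := distZ_ex x; rewrite hn ltr_norml in h; move/andP: h => [h1 h2].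
    have [n0|n1] := leP n 0.
      left; rewrite /= in_itv/= x0/=; apply: ltW; apply: le_lt_trans h2.
      by rewrite lerDl oppr_ge0 lerz0.
    right; rewrite /= in_itv/= (ltW x1) andbT.
    have : 1 <= n%:~R :> R by rewrite ler1z -gtz0_ge1.
    by lra.
apply: le_trans (measureU2 _ m1 m2) _.
have e1 : (mu `[0%R, s] <= s%:E)%E.
  by rewrite lebesgue_measure_itv/= lte_fin; case: ifP; rewrite ?sube0// lee_fin.
have e2 : (mu `[(1 - s)%R, 1%R] <= s%:E)%E.
  rewrite lebesgue_measure_itv/= lte_fin; case: ifP; rewrite ?lee_fin//.
  by move=> _; rewrite opprB addrC subrK.
by rewrite mulr_natl mulr2n EFinD; apply: leeD.
Qed.

Lemma tm_distZ_ge s : 0 <= s -> s <= 2^-1 -> (s%:E <= tm [set x | (distZ x < s)%R])%E.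
Proof.
move=> s0 s1; rewrite torus_measureE.
have mA : measurable ([set x | (distZ x < s)%R] : set (measurableTypeR R)).
  rewrite -[X in measurable X]setTI (_ : [set x | _] = distZ @^-1` `]-oo, s[).
    by apply: measurable_distZ => //; exact: measurable_itv.
  by apply/seteqP; split => u /=; rewrite in_itv/=.
have e : (mu `[0%R, s[ = s%:E)%E.
  rewrite lebesgue_measure_itv/= lte_fin; case: ifPn; first by rewrite sube0.
  by rewrite -leNgt => s00; congr EFin; apply/eqP; rewrite eq_le s0 s00.
rewrite -e; apply: le_measure; rewrite ?inE.
- exact: measurable_itv.
- by apply: measurableI => //; exact: measurable_itv.
- move=> x /=; rewrite in_itv/= => /andP[x0 xs]; split; last first.
    by rewrite in_itv/= x0/=; lra.
  by apply: le_lt_trans (distZ_le x 0) _; rewrite subr0 ger0_norm.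
Qed.

End distance_to_integers.

(** * Sums of tents *)

Section steps.
Context {R : realType}.
Local Notation tm := (@torus_measure R).
Implicit Types (p : R).

(** The sets are nested, so at each point the sum is one of the partial sums, and
    it is the one of largest index j with e j. *)
Lemma nested_powR_le p (v : nat -> R) (e : nat -> bool) K : 0 < p -> (forall k, 0 <= v k) ->
  (forall k, e k.+1 -> e k) ->
  (\sum_(k < K) v k * (e k)%:R) `^ p <= \sum_(j < K) (\sum_(k < j.+1) v k) `^ p * (e j)%:R.
Proof.
move=> p0 v0 he.
have hd k j : (k <= j)%N -> e j -> e k.
  elim: j => [|j IH]; first by rewrite leqn0 => /eqP ->.
  by rewrite leq_eqVlt => /predU1P[->//|]; rewrite ltnS => /IH h /he.
elim: K => [|K IH]; first by rewrite !big_ord0 powR0 ?gt_eqF.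
have [eK|eK] := boolP (e K); last first.
  by rewrite !big_ord_recr/= (negbTE eK) !mulr0 !addr0.
rewrite [leRHS]big_ord_recr/= eK mulr1 ler_wpDl//.
  by apply: sumr_ge0 => j _; rewrite mulr_ge0 ?powR_ge0.
apply: eq_ler; congr (_ `^ p); apply: eq_bigr => k _.
by rewrite (hd k K) ?mulr1// -ltnS.
Qed.

Lemma int_distZ_steps (a s : nat -> R) K : (forall j, 0 <= a j) -> (forall j, 0 <= s j) ->
  (\int[tm]_x (\sum_(j < K) a j * (distZ x < s j)%R%:R)%:E <= (\sum_(j < K) a j * (2 * s j))%:E)%E.
Proof.
move=> a0 s0.
pose E j := [set x : R | distZ x < s j].
have mE j : measurable (E j : set (measurableTypeR R)).
  rewrite -[X in measurable X]setTI (_ : E j = distZ @^-1` `]-oo, s j[).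
    by apply: measurable_distZ => //; exact: measurable_itv.
  by apply/seteqP; split => u /=; rewrite /E/= in_itv/=.
have mI j : measurable_fun setT (\1_(E j) : R -> R) by apply: measurable_indic; exact: mE.
have I0 j x : 0 <= (\1_(E j) x : R) by rewrite indicE.
have IE j : (\int[tm]_x (\1_(E j) x : R)%:E = tm (E j))%E.
  by rewrite (@integral_indic _ (measurableTypeR R) R tm setT measurableT _ (mE j)) setIT.
have i1 j x : (distZ x < s j)%R%:R = (\1_(E j) x : R).
  rewrite indicE; congr ((nat_of_bool _)%:R); apply/idP/idP => [h|/set_mem//].
  exact: (@mem_set _ (E j) x h).
apply: (@le_trans _ _ (\int[tm]_x \sum_(j < K) ((a j)%:E * (\1_(E j) x : R)%:E))%E).
  apply: le_integral_ge0 => x _; first by rewrite lee_fin; apply: sumr_ge0 => j _; rewrite mulr_ge0.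
  rewrite (eq_bigr (fun j : 'I_K => (a j * (distZ x < s j)%R%:R)%:E)) ?sumEFin//.
  by move=> j _; rewrite i1 EFinM.
rewrite ge0_integral_sum//; last 2 first.
- by move=> j; apply: emeasurable_funM => //; exact/measurable_EFinP.
- by move=> j x _; rewrite mule_ge0 ?lee_fin.
rewrite -sumEFin; apply: lee_sum => j _.
rewrite (tm_Zl (a0 j) (mI j) (I0 j)) IE [leRHS]EFinM; apply: lee_wpmul2l; first by rewrite lee_fin a0.
by apply: tm_distZ_lt.
Qed.

Lemma pint_scale p (c : R) (g : R -> R) : 0 <= c -> measurable_fun setT g ->
  pint p (fun x => c * g x) = ((c `^ p)%:E * pint p g)%E.
Proof.
move=> c0 mg; have P0 : (0 <= (c `^ p)%:E)%E by rewrite lee_fin powR_ge0.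
rewrite /pint -ge0_integralZl//; last exact: (measurable_pow p mg).
by apply: eq_integral => x _; rewrite -EFinM normrM ger0_norm// powRM.
Qed.

End steps.

Section tents.
Context {R : realType}.
Local Notation tm := (@torus_measure R).
Local Notation D k := (2^-1 ^+ k : R).
Context (p al : R) (p1 : 1 < p) (al0 : 0 < al) (alp : al < p^-1).

Let p0 : 0 < p. Proof. exact: lt_trans p1. Qed.
Let al1 : al < 1. Proof. by apply: lt_trans alp _; rewrite invf_lt1. Qed.
Let ga : R := p^-1 - al.

(** The exponent is 1/r. With this height all tents have comparable weak L_r norms. *)
Definition tent k (x : R) : R := D k `^ (- (p^-1 - al)) * Num.max 0 (1 - distZ x / D k).

Lemma tent_ge0 k x : 0 <= tent k x.
Proof. by rewrite mulr_ge0 ?powR_ge0// le_max lexx. Qed.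

Lemma tent_le k x : `|tent k x| <= D k `^ (- ga).
Proof.
rewrite ger0_norm ?tent_ge0// /tent -[leRHS]mulr1 ler_wpM2l ?powR_ge0//.
by rewrite ge_max ler01/= gerBl divr_ge0 ?distZ_ge0 ?dy_ge0.
Qed.

Lemma tent_lip k x y : `|tent k x - tent k y| <= D k `^ (- ga) / D k * `|x - y|.
Proof.
rewrite /tent -mulrBr normrM ger0_norm ?powR_ge0// -mulrA ler_wpM2l ?powR_ge0//.
have H (u v : R) : `|Num.max 0 u - Num.max 0 v| <= `|u - v|.
  wlog uv : u v / u <= v.
    by move=> h; have [|/ltW] := leP u v => /h// h2; rewrite distrC [leRHS]distrC.
  rewrite !(ler0_norm (x := _ - _)) ?subr_le0//; last by rewrite ge_max !le_max lexx uv orbT.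
  rewrite !opprB; case: (leP 0 u) => u0; case: (leP 0 v) => v0; lra.
apply: le_trans (H _ _) _.
rewrite (_ : _ - _ = (distZ y - distZ x) / D k); last by ring.
rewrite normrM [`|_^-1|]gtr0_norm ?invr_gt0 ?dy_gt0// mulrC ler_wpM2l ?invr_ge0 ?dy_ge0//.
by rewrite distrC distZ_lip.
Qed.

Lemma tent_out k x : D k <= distZ x -> tent k x = 0.
Proof.
move=> h; rewrite /tent max_l ?mulr0// subr_le0 ler_pdivlMr ?dy_gt0// mul1r//.
Qed.

Lemma tent_in k x : distZ x < D k.+1 -> D k `^ (- ga) / 2 <= tent k x.
Proof.
move=> h; rewrite /tent ler_wpM2l ?powR_ge0// le_max; apply/orP; right.
have : distZ x / D k <= 2^-1.
  by rewrite ler_pdivrMr ?dy_gt0// -exprS ltW.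
by lra.
Qed.

Lemma per_tent k : per (tent k).
Proof. by move=> x; rewrite /tent per_distZ. Qed.

Lemma tentN k x : tent k (- x) = tent k x.
Proof. by rewrite /tent distZN. Qed.

Lemma measurable_tent k : measurable_fun setT (tent k).
Proof.
apply: measurable_funM => //; apply: measurable_maxr => //.
by apply: measurable_funB => //; apply: measurable_funM => //; exact: measurable_distZ.
Qed.

Lemma pint_tent k : (pint p (tent k) <= (2 * (D k `^ al) `^ p)%:E)%E.
Proof.
have s0 (j : nat) : 0 <= D (k + j)%N by exact: dy_ge0.
have a0 (j : nat) : 0 <= (D k `^ (- ga)) `^ p by exact: powR_ge0.
have := @int_distZ_steps R (fun=> (D k `^ (- ga)) `^ p) (fun=> D k) 1 a0 (fun=> dy_ge0 k).
rewrite big_ord1; under eq_integral do rewrite big_ord1.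
move=> h; apply: le_trans _ (le_trans h _).
  apply: le_integral_ge0 => x _; first by rewrite lee_fin powR_ge0.
  rewrite lee_fin; have [xk|kx] := ltP (distZ x) (D k).
    by rewrite mulr1; apply: ge0_ler_powR; rewrite ?nnegrE ?(ltW p0) ?powR_ge0 ?tent_le.
  by rewrite tent_out// normr0 powR0 ?gt_eqF// mulr0.
rewrite lee_fin mulrCA ler_wpM2l// -!powRrM -[X in _ * X <= _]powRr1 ?dy_ge0// -powRD_pos ?dy_gt0//.
by apply: eq_ler; congr (_ `^ _); rewrite /ga; field; rewrite gt_eqF.
Qed.

Let Cn : R := (1 - al)^-1 + (1 + al^-1) * 2 `^ al.

Let Cn0 : 0 < Cn.
Proof.
rewrite addr_gt0 ?invr_gt0 ?subr_gt0// mulr_gt0 ?powR_gt0// addr_gt0 ?invr_gt0//.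
Qed.

Lemma fdiff_tent_near k h x : 0 < h -> h <= D k ->
  `|fdiff al h (tent k) x| <= Cn * h `^ al * D k `^ (- p^-1).
Proof.
move=> h0 hk.
apply: le_trans (fdiff_lip_scale x al0 al1 (tent_le k) (tent_lip k) h0 hk) _.
rewrite -!mulrA ler_wpM2l ?(ltW Cn0)// powRM ?dy_ge0 ?invr_ge0 ?(ltW h0)//.
rewrite -[h^-1]powR_inv1 ?(ltW h0)// -powRrM mulrN mulN1r opprK mulrA -powRD_pos ?dy_gt0// mulrC.
by apply: eq_ler; congr (_ * _ `^ _); rewrite /ga; ring.
Qed.

Let far n x : R := (D n.+1 <= distZ x)%R%:R.

(** Where the distance to the integers is at least D n.+1, the term of index j of the
    difference vanishes unless j h is at least D n.+2, since the support of the
    tent is within D n.+3 of the integers. Only the tail of the coefficients is left. *)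
Lemma fdiff_tent_far k n h : 0 < h -> h <= D k -> (n.+3 <= k)%N ->
  (pint p (fun x => far n x * fdiff al h (tent k) x)%R <=
    ((al^-1 * 3 `^ al * (D n.+2 / h) `^ (- al)) `^ p * (2 * (D k `^ al) `^ p))%:E)%E.
Proof.
move=> h0 hk nk.
pose th j : R := binc al j * (D n.+2 <= j%:R * h)%R%:R.
pose J := Num.truncn (D n.+2 / h).
have r0 : 0 < D n.+2 / h by rewrite divr_gt0 ?dy_gt0.
have /andP[J1 J2] := truncn_itv (ltW r0); rewrite -/J in J1 J2.
have hD : h <= D n.+3 by apply: le_trans hk _; exact: dy_le.
have J3 : (2 <= J)%N.
  rewrite truncn_ge_nat ?(ltW r0)// ler_pdivlMr//.
  by move: hD; rewrite (dy_halfS n.+2); lra.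
have J4 : (0 < J.-1)%N by rewrite -ltnS prednK// ltnW.
have hA m : \sum_(j < m) `|th j| <= al^-1 * 3 `^ al * (D n.+2 / h) `^ (- al).
  apply: le_trans (_ : \sum_(J.-1 <= j < m) `|binc al j.+1| <= _).
    rewrite -(big_mkord xpredT (fun j => `|th j|)).
    have z j : (j < J)%N -> `|th j| = 0.
      move=> jJ; rewrite /th lt_geF ?mulr0 ?normr0//.
      rewrite -ltr_pdivlMr//; apply: lt_le_trans J1; by rewrite ltr_nat.
    have [mJ|Jm] := leqP m J.
      rewrite big_nat big1 ?sumr_ge0// => j /andP[_ jm]; apply: z; exact: leq_trans mJ.
    rewrite (@big_cat_nat _ _ _ J) ?(ltnW Jm)//= big_nat big1 ?add0r; last first.
      by move=> j /andP[_ jm]; exact: z.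
    have Je : J = J.-1.+1 by rewrite prednK// ltnW.
    have me : m = m.-1.+1 by rewrite prednK// (leq_trans _ Jm).
    rewrite {1}Je {1}me big_add1/=.
    apply: (@le_trans _ _ (\sum_(J.-1 <= j < m.-1) `|binc al j.+1|)).
      apply: ler_sum => j _; rewrite /th normrM -[leRHS]mulr1 ler_wpM2l//.
      by set bb := (_ <= _ * h)%R; case: bb; rewrite ?normr1 ?normr0.
    have Jm1 : (J.-1 <= m.-1)%N by rewrite -ltnS -me -Je ltnW//.
    rewrite [leRHS](@big_cat_nat _ _ _ m.-1)//= ?leq_pred// lerDl; exact: sumr_ge0.
  apply: le_trans (sum_tail_binc_le m al0 (ltW al1) J4) _.
  rewrite -mulrA ler_wpM2l ?invr_ge0 ?(ltW al0)//.
  have -> : 3 `^ al * (D n.+2 / h) `^ (- al) = (D n.+2 / h / 3) `^ (- al).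
    rewrite [in RHS]powRM ?(ltW r0) ?invr_ge0// mulrC; congr (_ * _).
    by rewrite -powR_inv1// -powRrM mulN1r opprK.
  apply: powRN_le; rewrite ?oppr_le0 ?(ltW al0) ?divr_gt0//.
  rewrite ler_pdivrMr// -natrM; apply: ltW; apply: lt_le_trans J2 _.
  by rewrite ler_nat; move: J3; clear; lia.
have mF j : measurable_fun setT (fun x : R => tent k (x - j%:R * h)).
  exact: (measurable_comp_shift _ (measurable_tent k)).
have hF j : (pint p (fun x => tent k (x - j%:R * h)%R) <= (2 * (D k `^ al) `^ p)%:E)%E.
  by rewrite (pint_shift _ (- (j%:R * h)) (measurable_tent k) (per_tent k)) pint_tent.
have X0 : 0 <= 2 * (D k `^ al) `^ p by rewrite mulr_ge0 ?powR_ge0.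
have := pint_series (ltW p1) mF hF X0 hA; apply: le_trans.
apply: pint_le; first exact: ltW.
move=> x; rewrite /far; have [h1|h1] := leP (D n.+1) (distZ x); last by rewrite mul0r normr0.
rewrite mul1r; apply: eq_ler; congr `|limn (series _)|; apply/funext => j.
rewrite /th; have [h2|h2] := leP (D n.+2) (j%:R * h); first by rewrite mulr1.
rewrite mulr0 mul0r tent_out ?mulr0//.
apply: (@le_trans _ _ (D n.+2)); first by apply: dy_le; exact: ltnW.
have h3 : `|x - j%:R * h - x| = j%:R * h.
  by rewrite addrAC subrr add0r normrN ger0_norm// mulr_ge0 ?(ltW h0).
have := distZ_lip (x - j%:R * h) x; rewrite h3 ler_norml => /andP[h4 _].
move: h1; rewrite (dy_halfS n.+1) in h2 *; lra.
Qed.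

Definition tsum (c : nat -> R) K (x : R) : R := \sum_(k < K) c k * tent k x.

Lemma fdiff_tsum c K h x : fdiff al h (tsum c K) x = \sum_(k < K) c k * fdiff al h (tent k) x.
Proof. exact: (@fdiff_sum R al h tent c (fun k => D k `^ (- ga)) K x al0 (ltW al1) tent_le). Qed.

Lemma pint_tsum c K : (forall k, 0 <= c k) ->
  (pint p (tsum c K) <= ((\sum_(k < K) c k * D k `^ al) `^ p * 2)%:E)%E.
Proof.
move=> c0.
pose th k := if (k < K)%N then c k * D k `^ al else 0.
pose F k (x : R) := (D k `^ al)^-1 * tent k x.
have d0 k : 0 < D k `^ al by rewrite powR_gt0 ?dy_gt0.
have th0 k : 0 <= th k by rewrite /th; case: ifP => // _; rewrite mulr_ge0 ?powR_ge0.
have mF j : measurable_fun setT (F j) by apply: measurable_funM => //; exact: measurable_tent.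
have hF j : (pint p (F j) <= 2%:E)%E.
  rewrite (pint_scale p (ltW (eqbRL (invr_gt0 _) (d0 j))) (measurable_tent j)).
  have P0 : (0 <= ((D j `^ al)^-1 `^ p)%:E)%E by rewrite lee_fin powR_ge0.
  apply: le_trans (lee_wpmul2l P0 (pint_tent j)) _.
  rewrite -EFinM lee_fin mulrCA -powRM ?invr_ge0 ?powR_ge0// mulVf ?gt_eqF// powR1 mulr1//.
have hA n : \sum_(j < n) `|th j| <= \sum_(k < K) c k * D k `^ al.
  rewrite (eq_bigr (fun j : 'I_n => (j < K)%:R * (c j * D j `^ al))).
    by apply: (@sum_indic_le R (fun j => c j * D j `^ al)) => i; rewrite mulr_ge0 ?powR_ge0.
  move=> j _; rewrite ger0_norm// /th; case: ifP => _; rewrite ?mul1r ?mul0r//.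
have h2 : 0 <= 2 :> R by [].
have := pint_sum_le K (ltW p1) mF hF h2 hA; apply: le_trans.
apply: le_integral_ge0 => x _; first by rewrite lee_fin powR_ge0.
rewrite lee_fin; apply: ge0_ler_powR; rewrite ?nnegrE ?(ltW p0) ?normr_ge0//.
  by apply: sumr_ge0 => j _; rewrite mulr_ge0.
apply: le_trans (ler_norm_sum _ _ _) _; apply: ler_sum => k _.
have F0 : 0 <= F k x by apply: mulr_ge0 (tent_ge0 k x); rewrite invr_ge0 ltW.
rewrite normrM (ger0_norm (c0 k)) (ger0_norm (tent_ge0 k x)) (ger0_norm (th0 k)) (ger0_norm F0).
have -> : th k * F k x = c k * tent k x by rewrite /th ltn_ord /F [LHS]mulrA mulfK ?gt_eqF.
exact: lexx.
Qed.

Lemma measurable_distZ_lt (s : R) : measurable_fun setT (fun x : R => (distZ x < s)%R%:R : R).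
Proof.
pose E := [set x : R | distZ x < s].
have mE : measurable (E : set (measurableTypeR R)).
  rewrite -[X in measurable X]setTI (_ : E = distZ @^-1` `]-oo, s[).
    by apply: measurable_distZ => //; exact: measurable_itv.
  by apply/seteqP; split => u /=; rewrite /E/= in_itv/=.
rewrite (_ : (fun x => _) = \1_E); first by apply: measurable_indic; exact: mE.
apply/funext => x; rewrite indicE; congr ((nat_of_bool _)%:R); apply/idP/idP => [h|/set_mem//].
exact: (@mem_set _ E x h).
Qed.

Lemma measurable_distZ_ge (s : R) : measurable_fun setT (fun x : R => (s <= distZ x)%R%:R : R).
Proof.
rewrite (_ : (fun x => _) = (fun x => 1 - (distZ x < s)%R%:R)).
  by apply: measurable_funB => //; exact: measurable_distZ_lt.
by apply/funext => x; case: ltP; rewrite ?subr0 ?subrr.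
Qed.

Let phi h k := fdiff al h (tent k).

Let mphi h k : measurable_fun setT (phi h k).
Proof. exact: measurable_fdiff (measurable_tent k). Qed.

(** At distance d from the integers, only the scales D k > d / 4 contribute, which
    are coarse scales; their sets are nested, and after [nested_powR_le] the scales
    j and k interact with a geometric loss. *)
Lemma near_part_le : exists2 C : R, 0 < C & forall (c : nat -> R) K (A : R),
  (forall k, 0 <= c k) -> 0 <= A ->
  (pint p (fun x => A * \sum_(k < K) c k * D k `^ (- p^-1) * (distZ x < 4 * D k)%R%:R)%R <=
    (C * (A `^ p * \sum_(k < K) c k `^ p))%:E)%E.
Proof.
pose rho := (2^-1 : R) `^ p^-1.
have r0 : 0 <= rho by exact: powR_ge0.
have r1 : rho < 1 by apply: half_powR_lt1; rewrite invr_gt0.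
pose C := (2 / (1 - rho)) `^ p.
have C0 : 0 < C by rewrite powR_gt0// divr_gt0// subr_gt0.
exists (8 * C); first by rewrite mulr_gt0.
move=> c K A c0 A0.
pose v k := c k * D k `^ (- p^-1).
have v0 k : 0 <= v k by rewrite mulr_ge0 ?powR_ge0.
pose a j := A `^ p * (\sum_(k < j.+1) v k) `^ p.
have a0 j : 0 <= a j by rewrite mulr_ge0 ?powR_ge0.
have s0 j : 0 <= 4 * D j by rewrite mulr_ge0 ?dy_ge0.
have := int_distZ_steps K a0 s0 => h; apply: le_trans (le_trans _ h) _.
  apply: le_integral_ge0 => x _; first by rewrite lee_fin powR_ge0.
  have e0 : 0 <= \sum_(k < K) c k * D k `^ (- p^-1) * (distZ x < 4 * D k)%R%:R.
    by apply: sumr_ge0 => k _; apply: mulr_ge0 (v0 k) _.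
  rewrite lee_fin ger0_norm ?mulr_ge0// powRM// /a.
  rewrite [leRHS](eq_bigr (fun j : 'I_K => A `^ p * ((\sum_(k < j.+1) v k) `^ p * (distZ x < 4 * D j)%R%:R))); last first.
    by move=> j _; rewrite mulrA.
  rewrite -mulr_sumr ler_wpM2l ?powR_ge0//.
  apply: (@nested_powR_le R p v (fun k => distZ x < 4 * D k) K p0 v0) => k h1.
  apply: lt_le_trans h1 _; rewrite ler_wpM2l//; exact: dy_le.
rewrite lee_fin.
rewrite (eq_bigr (fun j : 'I_K => 8 * A `^ p * (D j * (\sum_(k < j.+1) v k) `^ p))); last first.
  by move=> j _; rewrite /a; ring.
rewrite -mulr_sumr (_ : 8 * C * _ = 8 * A `^ p * (C * \sum_(k < K) c k `^ p)); last by ring.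
rewrite ler_wpM2l ?mulr_ge0 ?powR_ge0//.
have row m : \sum_(k < K) rho ^+ ((m - k) + (k - m)) <= 2 / (1 - rho) by exact: sum_dist_le.
have col k : \sum_(m < K) rho ^+ ((m - k) + (k - m)) <= 2 / (1 - rho).
  rewrite (eq_bigr (fun m : 'I_K => rho ^+ ((k - m) + (m - k)))); first exact: sum_dist_le.
  by move=> m _; rewrite addnC.
apply: le_trans (@schur_le R p (2 / (1 - rho)) (fun m k => rho ^+ ((m - k) + (k - m))) c K (ltW p1) (fun m k => exprn_ge0 _ r0) c0 row col).
apply: ler_sum => j _.
have S0 : 0 <= \sum_(k < j.+1) v k by apply: sumr_ge0 => k _; exact: v0.
have -> : D j * (\sum_(k < j.+1) v k) `^ p = (D j `^ p^-1 * \sum_(k < j.+1) v k) `^ p.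
  by rewrite powRM ?powR_ge0// -powRrM mulVf ?gt_eqF// powRr1 ?dy_ge0.
apply: ge0_ler_powR; rewrite ?nnegrE ?(ltW p0) ?mulr_ge0 ?powR_ge0//.
  by apply: sumr_ge0 => k _; rewrite mulr_ge0 ?exprn_ge0.
rewrite (big_ord_widen K v (ltn_ord j)) big_mkcond/= mulr_sumr; apply: ler_sum => k _.
case: ifP => kj; last by rewrite mulr0 mulr_ge0 ?exprn_ge0.
rewrite ltnS in kj; have -> : (k - j = 0)%N by apply/eqP; rewrite subn_eq0.
rewrite addn0 /v mulrCA mulrC ler_wpM2r//.
rewrite -[in D j](subnK kj) dyD powRM ?dy_ge0// -mulrA -powRD_pos ?dy_gt0//.
by rewrite addrN powRr0 mulr1 dy_powR.
Qed.

(** On the shell number n, the tents of scale D k with k > n + 2 contribute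
    2^(-al (k - n)) times h^al, by [fdiff_tent_far]. Within a shell they are added by
    Jensen's inequality, and the shells by Schur's test. *)
Lemma far_part_le : exists2 C : R, 0 < C & forall (c : nat -> R) K (h : R),
  (forall k, 0 <= c k) -> 0 < h -> (forall k, (k < K)%N -> h <= D k) ->
  (pint p (fun x => \sum_(k < K) c k * `|phi h k x| * (4 * D k <= distZ x)%R%:R)%R <=
    (C * ((h `^ al) `^ p * \sum_(k < K) c k `^ p))%:E)%E.
Proof.
pose tau := (2^-1 : R) `^ al.
have t0 : 0 <= tau by exact: powR_ge0.
have t1 : tau < 1 by exact: half_powR_lt1.
pose C := (2 / (1 - tau)) `^ p.
have C0 : 0 < C by rewrite powR_gt0// divr_gt0// subr_gt0.
pose c3 : R := al^-1 * 3 `^ al.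
have c30 : 0 < c3 by rewrite mulr_gt0 ?invr_gt0 ?powR_gt0.
pose c4 : R := c3 * D 2 `^ (- al).
have c40 : 0 < c4 by rewrite mulr_gt0 ?powR_gt0 ?dy_gt0.
have two0 : 0 < 2 :> R by [].
exists (2 * (c4 `^ p * C)); first exact: mulr_gt0 two0 (mulr_gt0 (powR_gt0 p c40) C0).
move=> c K h c0 h0 hK.
have ha0 : 0 < h `^ al by rewrite powR_gt0.
pose b n k := c3 * (D n.+2 / h) `^ (- al) * D k `^ al.
have b0 n k : 0 < b n k.
  exact: mulr_gt0 (mulr_gt0 c30 (powR_gt0 _ (divr_gt0 (dy_gt0 _) h0))) (powR_gt0 _ (dy_gt0 _)).
have ch0 : 0 <= c4 * h `^ al by exact: mulr_ge0 (ltW c40) (ltW ha0).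
have bE n k : (n <= k)%N -> b n k = c4 * h `^ al * tau ^+ ((n - k) + (k - n)).
  move=> nk; have -> : (n - k = 0)%N by apply/eqP; rewrite subn_eq0.
  rewrite add0n /b powRM ?dy_ge0 ?invr_ge0 ?(ltW h0)//.
  rewrite -[h^-1]powR_inv1 ?(ltW h0)// -powRrM mulrN mulN1r opprK.
  rewrite -(addn2 n) dyD powRM ?dy_ge0// -[in D k](subnK nk) dyD powRM ?dy_ge0//.
  rewrite [(D (k - n)) `^ al]dy_powR -/tau /c4.
  have e : D n `^ (- al) * D n `^ al = 1 by rewrite -powRD_pos ?dy_gt0// addNr powRr0.
  rewrite [LHS](_ : _ = c3 * D 2 `^ (- al) * h `^ al * tau ^+ (k - n) * (D n `^ (- al) * D n `^ al)); last by ring.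
  by rewrite e mulr1.
pose ok n k := (n.+3 <= k)%N && (k < K)%N.
pose th n k := if ok n k then c k * b n k else 0.
pose F n k (x : R) := if ok n k then (b n k)^-1 * (far n x * phi h k x) else 0.
have th0 n k : 0 <= th n k by rewrite /th; case: ifP => // _; rewrite mulr_ge0 ?(ltW (b0 _ _)).
have mfar n : measurable_fun setT (far n) by exact: measurable_distZ_ge.
have mF n k : measurable_fun setT (F n k).
  rewrite /F; case: (ok n k) => //; apply: measurable_funM => //; exact: measurable_funM.
have hF n k : (pint p (F n k) <= 2%:E)%E.
  have [onk|nok] := boolP (ok n k); last first.
    have -> : F n k = (fun=> 0) by apply/funext => x; rewrite /F (negbTE nok).
    rewrite /pint; under eq_integral do rewrite normr0 powR0 ?gt_eqF//.
    by rewrite integral0 lee_fin.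
  have -> : F n k = (fun x => (b n k)^-1 * (far n x * phi h k x)).
    by apply/funext => x; rewrite /F onk.
  move/andP: onk => [nk kK].
  have mm : measurable_fun setT (fun x => far n x * phi h k x) by exact: measurable_funM.
  have bV : 0 <= (b n k)^-1 by rewrite invr_ge0 ltW.
  rewrite (pint_scale p bV mm).
  have P0 : (0 <= ((b n k)^-1 `^ p)%:E)%E by rewrite lee_fin powR_ge0.
  apply: le_trans (lee_wpmul2l P0 (fdiff_tent_far h0 (hK k kK) nk)) _.
  have bp : (al^-1 * 3 `^ al * (D n.+2 / h) `^ (- al)) `^ p * (2 * (D k `^ al) `^ p) = 2 * b n k `^ p.
    by rewrite /b [in RHS]powRM ?powR_ge0//; [rewrite mulrCA|exact: mulr_ge0 (ltW c30) (powR_ge0 _ _)].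
  rewrite -EFinM lee_fin bp mulrCA -(powRM p bV (ltW (b0 n k))) mulVf ?gt_eqF//.
  by rewrite powR1 mulr1.
pose A n := \sum_(k < K) tau ^+ ((n - k) + (k - n)) * c k.
have A0 n : 0 <= A n by apply: sumr_ge0 => k _; rewrite mulr_ge0 ?exprn_ge0.
have hA n m : \sum_(k < m) `|th n k| <= c4 * h `^ al * A n.
  apply: le_trans (_ : \sum_(k < m) (k < K)%:R * (c4 * h `^ al * (tau ^+ ((n - k) + (k - n)) * c k)) <= _).
    apply: ler_sum => k _; rewrite ger0_norm// /th; case: ifP => [/andP[nk kK]|_].
      by rewrite kK mul1r bE ?(leq_trans _ nk)//; last (by do 3 apply: leqW); apply: eq_ler; ring.
    exact: mulr_ge0 (ler0n _ _) (mulr_ge0 ch0 (mulr_ge0 (exprn_ge0 _ t0) (c0 k))).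
  apply: le_trans (@sum_indic_le R (fun k => c4 * h `^ al * (tau ^+ ((n - k) + (k - n)) * c k)) m K _) _.
    by move=> k; exact: mulr_ge0 ch0 (mulr_ge0 (exprn_ge0 _ t0) (c0 k)).
  by rewrite -mulr_sumr.
pose G n x := \sum_(k < K) `|th n k| * `|F n k x|.
have G0 n x : 0 <= G n x by apply: sumr_ge0 => k _; rewrite mulr_ge0.
have mG n : measurable_fun setT (fun x => (G n x `^ p)%:E).
  apply/measurable_EFinP; apply: (measurableT_comp (measurable_powR p)).
  by apply: measurable_sum => k; apply: measurable_funM => //; exact: measurableT_comp.
have h2 : 0 <= 2 :> R by [].
have hG n : (\int[tm]_x (G n x `^ p)%:E <= ((c4 * h `^ al * A n) `^ p * 2)%:E)%E.
  exact: (pint_sum_le K (ltW p1) (mF n) (hF n) h2 (hA n)).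
have GE n x k : ok n k -> `|th n k| * `|F n k x| = c k * `|far n x * phi h k x|.
  move=> onk; rewrite (ger0_norm (th0 n k)) /th /F onk normrM gtr0_norm ?invr_gt0//.
  by rewrite mulrA mulfK ?gt_eqF.
apply: (@le_trans _ _ (\int[tm]_x \sum_(n < K) (G n x `^ p)%:E)%E).
  apply: le_integral_ge0 => x _; first by rewrite lee_fin powR_ge0.
  set Fr := \sum_(k < K) _.
  have Fr0 : 0 <= Fr by apply: sumr_ge0 => k _; rewrite !mulr_ge0.
  rewrite sumEFin lee_fin ger0_norm//.
  have [n hn] : exists n, Fr <= G n x /\ ((K <= n)%N -> Fr = 0).
    have := distZ_ge0 x; rewrite le_eqVlt => /predU1P[x0|x0].
      exists 0%N; have -> : Fr = 0.
        rewrite /Fr big1// => k _; rewrite -x0 lt_geF ?mulr0// mulr_gt0 ?dy_gt0//.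
      by split.
    have x1 : distZ x < 1 by apply: le_lt_trans (distZ_le_half x) _; rewrite invf_lt1// ltr1n.
    have [n [n1 n2]] := dy_interval x0 x1.
    have key k : 4 * D k <= distZ x -> (n.+3 <= k)%N.
      move=> hk; rewrite ltnNge; apply/negP => kn.
      have := dy_le kn (R := R); rewrite !dy_halfS; move: hk n2 => hk n2 h5.
      have : 4 * (2^-1 * (2^-1 * D n)) = D n by field.
      lra.
    exists n; split.
      apply: ler_sum => k _; have [hk|hk] := leP (4 * D k) (distZ x); last first.
        by rewrite mulr0 mulr_ge0.
      have onk : ok n k by rewrite /ok key ?ltn_ord.
      by rewrite (GE n x k onk) mulr1 /far n1 mul1r.
    move=> Kn; rewrite /Fr big1// => k _.
    have [hk|hk] := leP (4 * D k) (distZ x); last by rewrite mulr0.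
    have := key k hk; have := ltn_ord k; move: Kn; clear; lia.
  have [nK|Kn] := ltnP n K; last first.
    by rewrite (hn.2 Kn) powR0 ?gt_eqF//; apply: sumr_ge0 => m _; exact: powR_ge0.
  apply: (@le_trans _ _ (G n x `^ p)).
    by apply: ge0_ler_powR; rewrite ?nnegrE ?(ltW p0) ?hn.1.
  rewrite (bigD1 (Ordinal nK))//= lerDl; apply: sumr_ge0 => m _; exact: powR_ge0.
rewrite ge0_integral_sum//; last 2 first.
- by move=> n; exact: mG.
- by move=> n x _; rewrite lee_fin powR_ge0.
apply: (@le_trans _ _ (\sum_(n < K) ((c4 * h `^ al * A n) `^ p * 2)%:E)%E).
  by apply: lee_sum => n _; exact: hG.
rewrite sumEFin lee_fin.
rewrite (eq_bigr (fun n : 'I_K => 2 * (c4 `^ p * (h `^ al) `^ p) * A n `^ p)); last first.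
  move=> n _; rewrite (powRM p ch0 (A0 n)) (powRM p (ltW c40) (ltW ha0)); ring.
rewrite -mulr_sumr (_ : 2 * (c4 `^ p * C) * _ = 2 * (c4 `^ p * (h `^ al) `^ p) * (C * \sum_(k < K) c k `^ p)); last by ring.
rewrite ler_wpM2l ?mulr_ge0 ?powR_ge0//.
apply: (@schur_le R p (2 / (1 - tau)) (fun n k => tau ^+ ((n - k) + (k - n))) c K (ltW p1) (fun m k => exprn_ge0 _ t0) c0).
- by move=> m; exact: sum_dist_le.
- move=> k; rewrite (eq_bigr (fun m : 'I_K => tau ^+ ((k - m) + (m - k)))); first exact: sum_dist_le.
  by move=> m _; rewrite addnC.
Qed.

Lemma measurable_tsum c K : measurable_fun setT (tsum c K).
Proof. by apply: measurable_sum => k; apply: measurable_funM => //; exact: measurable_tent. Qed.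

Lemma per_tsum c K : per (tsum c K).
Proof. by move=> x; apply: eq_bigr => k _; rewrite per_tent. Qed.

(** The tents are almost orthogonal in L_p for this purpose: the norm is that of
    the sequence c in l_p. At each point, [fdiff_tent_near] is used for the tents
    that are wide compared with the distance to the integers, and
    [fdiff_tent_far] for the others. *)
Lemma pint_fdiff_tsum : exists2 C : R, 0 < C & forall (c : nat -> R) K (h : R),
  (forall k, 0 <= c k) -> 0 < h -> (forall k, (k < K)%N -> h <= D k) ->
  (pint p (fdiff al h (tsum c K)) <= (C * ((h `^ al) `^ p * \sum_(k < K) c k `^ p))%:E)%E.
Proof.
have [C1 C10 h1] := near_part_le; have [C2 C20 h2] := far_part_le.
exists (2 `^ p * (C1 * Cn `^ p + C2)).
  by rewrite mulr_gt0 ?addr_gt0 ?mulr_gt0 ?powR_gt0.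
move=> c K h c0 h0 hK.
have A0 : 0 <= Cn * h `^ al by rewrite mulr_ge0 ?powR_ge0 ?(ltW Cn0).
pose N x := Cn * h `^ al * \sum_(k < K) c k * D k `^ (- p^-1) * (distZ x < 4 * D k)%R%:R.
pose Fr x := \sum_(k < K) c k * `|phi h k x| * (4 * D k <= distZ x)%R%:R.
have mN : measurable_fun setT N.
  apply: measurable_funM => //; apply: measurable_sum => k; apply: measurable_funM => //.
  exact: measurable_distZ_lt.
have mFr : measurable_fun setT Fr.
  apply: measurable_sum => k; apply: measurable_funM; last exact: measurable_distZ_ge.
  by apply: measurable_funM => //; apply: measurableT_comp => //; exact: mphi.
apply: (@le_trans _ _ (pint p (fun x => N x + Fr x)%R)).
  apply: pint_le; first exact: ltW.
  move=> x; rewrite fdiff_tsum; apply: le_trans (ler_norm_sum _ _ _) _.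
  apply: le_trans (ler_norm _); rewrite /N mulr_sumr -big_split/=; apply: ler_sum => k _.
  rewrite normrM (ger0_norm (c0 k)); have [hk|hk] := ltP (distZ x) (4 * D k).
    rewrite mulr1 mulr0 addr0 mulrCA ler_wpM2l//; exact: fdiff_tent_near h0 (hK k (ltn_ord k)).
  by rewrite !mulr0 add0r mulr1.
apply: le_trans (pint_add (ltW p0) mN mFr) _.
apply: (@le_trans _ _ ((2 `^ p)%:E * ((C1 * ((Cn * h `^ al) `^ p * \sum_(k < K) c k `^ p))%:E + (C2 * ((h `^ al) `^ p * \sum_(k < K) c k `^ p))%:E))%E).
  rewrite lee_wpmul2l ?lee_fin ?powR_ge0//; apply: leeD; [exact: h1|exact: h2].
rewrite -EFinD -EFinM lee_fin powRM ?powR_ge0 ?(ltW Cn0)//; apply: eq_ler; ring.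
Qed.

End tents.

(** * Embeddings tested on sums of tents *)

Section complexification.
Context {R : realType}.
Local Notation tm := (@torus_measure R).
Local Notation D k := (2^-1 ^+ k : R).
Implicit Types (p al t W V : R) (g : R -> R).

Definition real_cx g (x : R) : R[i] := Complex (g x) 0.

Lemma cabs_real_cx g x : cabs (real_cx g x) = `|g x|.
Proof. by rewrite /cabs /= expr0n/= addr0 sqrtr_sqr. Qed.

Lemma torus_fun_real_cx g : measurable_fun setT g -> per g -> torus_fun (real_cx g).
Proof. by move=> mg pg; split => //= x; rewrite /real_cx pg. Qed.

Lemma frac_diff_real_cx al h g x : frac_diff al h (real_cx g) x = real_cx (frac_diff_re al h g) x.
Proof.
rewrite /frac_diff /real_cx; congr Complex.
rewrite /frac_diff_re (_ : series _ = cst 0) ?lim_cst//.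
by apply/funext => n; rewrite /series/= big1// => j _; rewrite mulr0.
Qed.

Lemma Lp_norm_real_cx p g W : 0 < p -> 0 <= W -> (pint p g <= (W `^ p)%:E)%E -> (Lp_norm p (real_cx g) <= W%:E)%E.
Proof.
move=> p0 W0 h; apply: (Lp_norm_pint p0 W0); apply: le_trans h.
by apply: pint_le; [exact: ltW|move=> x; rewrite cabs_real_cx normr_id].
Qed.

Lemma pint_opp p g : measurable_fun setT g -> per g -> pint p (fun x => g (- x)) = pint p g.
Proof.
move=> mg pg; rewrite /pint (torus_opp (F := fun x => (`|g x| `^ p)%:E))//.
- exact: measurable_pow.
- by move=> x; rewrite pg.
Qed.

Lemma fdiff_even al h g x : (forall y, g (- y) = g y) -> fdiff al (- h) g x = fdiff al h g (- x).
Proof.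
move=> eg; rewrite /fdiff; congr (limn (series _)); apply/funext => j.
by rewrite -eg; congr (_ * g _); ring.
Qed.

(** For an even function, steps of both signs give the same norm. *)
Lemma modulus_real_cx p al g t W : 0 < p -> 0 <= W -> measurable_fun setT g -> per g -> (forall y, g (- y) = g y) ->
  (forall y, 0 <= y -> y <= t -> (pint p (fdiff al y g) <= (W `^ p)%:E)%E) ->
  (modulus al p (real_cx g) t <= W%:E)%E.
Proof.
move=> p0 W0 mg pg eg hW; apply: ge_ereal_sup => z [h /= ht <-].
rewrite (_ : frac_diff al h (real_cx g) = real_cx (frac_diff_re al h g)); last first.
  by apply/funext => x; exact: frac_diff_real_cx.
apply: Lp_norm_real_cx => //; rewrite pint_frac_diff_re//.
have [h0|h0] := leP 0 h; first by apply: hW => //; rewrite -(ger0_norm h0).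
have -> : fdiff al h g = (fun x => fdiff al (- h) g (- x)).
  by apply/funext => x; have := fdiff_even al (- h) x eg; rewrite opprK.
rewrite pint_opp; [|exact: measurable_fdiff|exact: per_fdiff].
by apply: hW; [rewrite oppr_ge0 ltW|rewrite -(ltr0_norm h0)].
Qed.

Lemma lip_norm_real_cx_le p al b (q : \bar R) : 0 < p -> 0 < al -> (0 < q)%E -> exists2 C : R, 0 < C &
  forall g (W : nat -> R) (S : R), measurable_fun setT g -> per g -> (forall y, g (- y) = g y) ->
   (forall m, 0 <= W m) -> 0 <= S -> (pint p g <= (S `^ p)%:E)%E ->
   (forall m y, 0 <= y -> y <= D m -> (pint p (fdiff al y g) <= ((D m `^ al * W m) `^ p)%:E)%E) ->
   lq_le q (fun m => m.+1%:R `^ (- b) * W m) S -> (lip_norm p q al b (real_cx g) <= (C * S)%:E)%E.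
Proof.
move=> p0 al0 q0.
pose k : R := 2 `^ `|- b| * 2 `^ al.
have k0 : 0 < k by rewrite mulr_gt0 ?powR_gt0.
exists (1 + k); first by rewrite addr_gt0.
move=> g W S mg pg eg W0 S0 hS hW hl.
rewrite /lip_norm mulrDl mul1r EFinD; apply: leeD; first exact: Lp_norm_real_cx.
have a0 m : 0 <= m.+1%:R `^ (- b) * W m by rewrite mulr_ge0 ?powR_ge0.
apply: (Lq_dtt_le q0 _ _ _ (lq_le_scale q0 a0 S0 (ltW k0) hl)).
- by rewrite mulr_ge0 ?(ltW k0).
- by move=> m; rewrite mulr_ge0 ?(ltW k0) ?a0.
move=> m t t1 t2; have t0 : 0 < t by apply: lt_le_trans t1; exact: dy_gt0.
have [/andP[l1 l2] _] := ln_dy_bounds t1 t2.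
have m0 : 0 < m.+1%:R :> R by rewrite ltr0n.
have /andP[_ w2] := powR_weight (- b) m0 l1 l2.
apply/andP; split; first by rewrite mule_ge0 ?lee_fin ?mulr_ge0 ?powR_ge0// modulus_ge0// ltW.
have hm : (modulus al p (real_cx g) t <= (D m `^ al * W m)%:E)%E.
  apply: modulus_real_cx => //; first by rewrite mulr_ge0 ?powR_ge0.
  by move=> y y0 yt; apply: hW => //; apply: le_trans yt _; exact: ltW.
have e : D m.+1 `^ (- al) * D m `^ al = 2 `^ al.
  rewrite dy_halfS powRM ?dy_ge0// -mulrA -powRD_pos ?dy_gt0// addNr powRr0 mulr1.
  by rewrite -powR_inv1// -powRrM mulN1r opprK.
rewrite [leRHS](_ : _ = ((D m.+1 `^ (- al) * (2 `^ `|- b| * m.+1%:R `^ (- b)))%:E * (D m `^ al * W m)%:E)%E); last first.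
  rewrite -EFinM; congr EFin; rewrite /k -e; ring.
apply: lee_pmul; rewrite ?lee_fin ?mulr_ge0 ?powR_ge0//; first by rewrite modulus_ge0// ltW.
apply: ler_pM; rewrite ?powR_ge0//.
by apply: powRN_le; rewrite ?oppr_le0 ?(ltW al0) ?dy_gt0.
Qed.

(** The rearrangement is at least s m on the interval [D m.+1, D m[ as soon as
    |g| is at least s m on a set of measure greater than D m. The alternative s m = 0
    allows for indices without information. *)
Lemma lz_norm_real_cx_ge (r c : R) (u : \bar R) : 0 <= r^-1 -> (0 < u)%E -> exists2 C : R, 0 < C &
  forall g (s : nat -> R) n (S : R), measurable_fun setT g -> (forall m, 0 <= s m) -> 0 <= S ->
   (forall m, (m < n)%N -> s m = 0 \/ ((D m)%:E < tm [set x | (s m <= `|g x|)%R])%E) ->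
   (lz_norm r u c (real_cx g) <= S%:E)%E ->
   lq_le u (fun m => if (m < n)%N then m.+1%:R `^ c * (D m `^ r^-1 * s m) else 0) (C * S).
Proof.
move=> r0 u0; have [C C0 hC] := Lq_dtt_ge u0.
pose k : R := (2 `^ `|c|)^-1 * 2^-1 `^ r^-1.
have k0 : 0 < k by rewrite mulr_gt0 ?invr_gt0 ?powR_gt0.
exists (k^-1 * C); first by rewrite mulr_gt0 ?invr_gt0.
move=> g s n S mg s0 S0 hs hS.
pose a m := k * (m.+1%:R `^ c * (D m `^ r^-1 * s m)).
have a0 m : 0 <= a m by rewrite !mulr_ge0 ?powR_ge0 ?(ltW k0).
have mn : measurable_fun setT (fun x => `|g x|) by exact: measurableT_comp.
have ha : lq_le u (fun m => if (m < n)%N then a m else 0) (C * S).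
  apply: hC => //; last exact: hS.
  move=> m t mn' t1 t2; have t0 : 0 < t by apply: lt_le_trans t1; exact: dy_gt0.
  have [/andP[l1 l2] lE] := ln_dy_bounds t1 t2.
  have m0 : 0 < m.+1%:R :> R by rewrite ltr0n.
  have /andP[w1 _] := powR_weight c m0 l1 l2.
  rewrite (_ : a m = (2^-1 `^ r^-1 * D m `^ r^-1) * ((2 `^ `|c|)^-1 * m.+1%:R `^ c) * s m); last by rewrite /a /k; ring.
  rewrite EFinM; apply: lee_pmul; rewrite ?lee_fin ?mulr_ge0 ?powR_ge0 ?invr_ge0 ?powR_ge0//.
    apply: ler_pM; rewrite ?mulr_ge0 ?powR_ge0 ?invr_ge0 ?powR_ge0//; last by rewrite lE.
    rewrite -powRM ?invr_ge0 ?dy_ge0// -dy_halfS.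
    by apply: ge0_ler_powR; rewrite ?nnegrE ?dy_ge0 ?(ltW t0).
  apply: le_ereal_inf_tmp => _ [z [z0 hz] <-]; rewrite lee_fin.
  have [->//|hm] := hs m mn'; rewrite leNgt; apply/negP => zs.
  have : (tm [set x | (s m <= `|g x|)%R] < tm [set x | (s m <= `|g x|)%R])%E.
    apply: le_lt_trans _ hm; apply: le_trans (_ : t%:E <= _)%E; last by rewrite lee_fin ltW.
    apply: le_trans hz; apply: le_measure; rewrite ?inE.
    - rewrite -[X in measurable X]setTI (_ : [set x | _] = (fun x => `|g x|) @^-1` `[s m, +oo[).
        by apply: mn => //; exact: measurable_itv.
      by apply/seteqP; split => x /=; rewrite in_itv/= andbT.
    - rewrite (_ : [set x | _] = [set x | (z < `|g x|)%R]); first exact: measurable_superlevel.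
      by apply/funext => x; rewrite /mkset cabs_real_cx.
    - by move=> x h; rewrite /mkset cabs_real_cx; exact: lt_le_trans h.
  by rewrite ltxx.
have a'0 m : 0 <= (if (m < n)%N then a m else 0) by case: ifP.
have := lq_le_scale u0 a'0 (mulr_ge0 (ltW C0) S0) (ltW (eqbRL (invr_gt0 k) k0)) ha.
rewrite mulrA; congr (lq_le _ _ _); apply/funext => m.
by case: ifP => _; rewrite ?mulr0// /a mulrA mulVf ?mul1r ?gt_eqF.
Qed.

End complexification.

Section tests.
Context {R : realType}.
Local Notation tm := (@torus_measure R).
Local Notation D k := (2^-1 ^+ k : R).
Context (p al : R) (p1 : 1 < p) (al0 : 0 < al) (alp : al < p^-1).

Let p0 : 0 < p. Proof. exact: lt_trans p1. Qed.
Let al1 : al < 1. Proof. by apply: lt_trans alp _; rewrite invf_lt1. Qed.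
Local Notation tsum := (tsum p al).
Local Notation tent := (tent p al).

Lemma sum_indic_min (f : nat -> R) K m :
  \sum_(k < K) (k <= m)%:R * f k = \sum_(k < minn K m.+1) f k.
Proof.
rewrite (big_ord_widen K f (geq_minl _ _)) [RHS]big_mkcond/=; apply: eq_bigr => k _.
by rewrite leq_min ltn_ord/= ltnS; case: ifP; rewrite ?mul1r ?mul0r.
Qed.

(** For steps up to D m, the tents of scale at least D m are covered by
    [pint_fdiff_tsum], and the finer ones by their L_p norms. *)
Lemma pint_fdiff_tsum_scale : exists2 C : R, 0 < C & forall (c : nat -> R) K m (y Z : R),
  (forall k, 0 <= c k) -> 0 <= Z -> 0 <= y -> y <= D m ->
  \sum_(k < K) (k <= m)%:R * c k `^ p <= Z `^ p ->
  \sum_(k < K) (m < k)%:R * (c k * D k `^ al) <= D m `^ al * Z ->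
  (pint p (fdiff al y (tsum c K)) <= ((D m `^ al * (C * Z)) `^ p)%:E)%E.
Proof.
have [C1 C10 h1] := pint_fdiff_tsum p1 al0 alp.
pose C : R := 2 `^ p * (C1 + 2 * (2 + al^-1) `^ p).
have two0 : 0 < 2 :> R by [].
have C0 : 0 < C.
  apply: mulr_gt0; first exact: powR_gt0.
  by apply: addr_gt0 => //; apply: mulr_gt0 => //; rewrite powR_gt0// addr_gt0 ?invr_gt0.
exists (C `^ p^-1); first by rewrite powR_gt0.
move=> c K m y Z c0 Z0 y0 ym hn hf.
have -> : (D m `^ al * (C `^ p^-1 * Z)) `^ p = C * (D m `^ al * Z) `^ p.
  have DZ0 : 0 <= D m `^ al * Z by rewrite mulr_ge0 ?powR_ge0.
  rewrite mulrCA (powRM p (powR_ge0 C p^-1) DZ0) -powRrM mulVf ?gt_eqF// powRr1//.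
  exact: ltW.
pose c2 k := (m < k)%:R * c k.
have c20 k : 0 <= c2 k by rewrite mulr_ge0.
pose K1 := minn K m.+1.
have split_ x : fdiff al y (tsum c K) x = fdiff al y (tsum c K1) x + fdiff al y (tsum c2 K) x.
  rewrite !(fdiff_tsum p1 al0 alp) -(sum_indic_min (fun k => c k * fdiff al y (tent k) x)) -big_split/=.
  apply: eq_bigr => k _; rewrite /c2; have [km|mk] := leqP k m.
    by rewrite mul1r !mul0r addr0.
  by rewrite mul0r add0r mul1r.
have mt c' K' : measurable_fun setT (fdiff al y (tsum c' K')).
  exact: measurable_fdiff (measurable_tsum p al c' K').
have [yE|yn] := eqVneq y 0.
  rewrite /pint (_ : (fun x => _) = cst 0%E) ?integral_cst//.
    by rewrite mul0e lee_fin mulr_ge0 ?powR_ge0 ?(ltW C0).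
  apply/funext => x; rewrite yE (fdiff_tsum p1 al0 alp) big1 ?normr0 ?powR0 ?gt_eqF// => k _.
  rewrite (fdiff0 x al0 al1 (tent_le p al k) (tent_lip p al k)) ?mulr0//.
have yp : 0 < y by rewrite lt_neqAle eq_sym yn.
rewrite (_ : fdiff al y (tsum c K) = (fun x => fdiff al y (tsum c K1) x + fdiff al y (tsum c2 K) x)); last first.
  by apply/funext => x; exact: split_.
apply: le_trans (pint_add (ltW p0) (mt _ _) (mt _ _)) _.
have DZ0 : 0 <= D m `^ al * Z by rewrite mulr_ge0 ?powR_ge0.
have b1 : (pint p (fdiff al y (tsum c K1)) <= (C1 * (D m `^ al * Z) `^ p)%:E)%E.
  apply: le_trans (h1 c K1 y c0 yp _) _.
    move=> k kK; apply: le_trans ym _; apply: dy_le.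
    by move: kK; rewrite leq_min ltnS => /andP[].
  rewrite lee_fin ler_wpM2l ?(ltW C10)// -(sum_indic_min (fun k => c k `^ p)) powRM ?powR_ge0//.
  have h3 : 0 <= \sum_(k < K) (k <= m)%:R * c k `^ p by apply: sumr_ge0 => k _; rewrite mulr_ge0 ?powR_ge0.
  apply: (ler_pM (powR_ge0 _ _) h3 _ hn).
  apply: ge0_ler_powR; rewrite ?nnegrE ?(ltW p0) ?powR_ge0//.
  by apply: ge0_ler_powR; rewrite ?nnegrE ?(ltW al0) ?dy_ge0.
have b2 : (pint p (fdiff al y (tsum c2 K)) <= (2 * (2 + al^-1) `^ p * (D m `^ al * Z) `^ p)%:E)%E.
  have X0 : 0 <= (D m `^ al * Z) `^ p * 2 by rewrite mulr_ge0 ?powR_ge0.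
  have hX : (pint p (tsum c2 K) <= ((D m `^ al * Z) `^ p * 2)%:E)%E.
    apply: le_trans (pint_tsum al p1 K c20) _.
    rewrite lee_fin ler_wpM2r//; apply: ge0_ler_powR; rewrite ?nnegrE ?(ltW p0)//.
      by apply: sumr_ge0 => k _; rewrite mulr_ge0 ?powR_ge0.
    by apply: le_trans hf; apply: ler_sum => k _; rewrite /c2 mulrA.
  apply: le_trans (pint_fdiff_le y (ltW p1) al0 (ltW al1) X0 (measurable_tsum p al c2 K) (per_tsum p al c2 K) hX) _.
  rewrite lee_fin; apply: eq_ler; ring.
apply: (@le_trans _ _ ((2 `^ p)%:E * ((C1 * (D m `^ al * Z) `^ p)%:E + (2 * (2 + al^-1) `^ p * (D m `^ al * Z) `^ p)%:E))%E).
  by rewrite lee_wpmul2l ?lee_fin ?powR_ge0//; apply: leeD.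
by rewrite -EFinD -EFinM lee_fin /C; apply: eq_ler; ring.
Qed.

Lemma tsumN c K x : tsum c K (- x) = tsum c K x.
Proof. by apply: eq_bigr => k _; rewrite tentN. Qed.

Lemma lq_le_shift2 (u : \bar R) (a : nat -> R) S : lq_le u a S -> lq_le u (fun k => a k.+2) S.
Proof.
case: u => [s||] //= h n; apply: le_trans (h n.+2).
by rewrite [leRHS]big_ord_recl [X in _ + X]big_ord_recl/= addrA lerDr addr_ge0 ?powR_ge0.
Qed.

Lemma two_succ_bounds k : 2 * k.+1%:R / 2 <= k.+3%:R :> R /\ k.+3%:R <= 2 * (2 * k.+1%:R) :> R.
Proof.
split; first by rewrite mulrAC divff// mul1r ler_nat; do 2 apply: leqW.
by rewrite -!natrM ler_nat; lia.
Qed.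

(** All the tents are nonnegative, so on the interval of half-width D k.+1 the sum
    is at least half the height of the tent k. This interval has measure greater
    than D k.+2, whence the shift by 2. *)
Lemma lz_norm_tsum_ge (r c : R) (u : \bar R) : r^-1 = p^-1 - al -> (0 < u)%E -> exists2 C : R, 0 < C &
  forall (a : nat -> R) K (S : R), (forall k, 0 <= a k) -> 0 <= S ->
   (lz_norm r u c (real_cx (tsum a K)) <= S%:E)%E ->
   lq_le u (fun k => if (k < K)%N then k.+1%:R `^ c * a k else 0) (C * S).
Proof.
move=> rE u0; have r0 : 0 < r^-1 by rewrite rE subr_gt0.
have [C C0 hC] := lz_norm_real_cx_ge c (ltW r0) u0.
pose k0 : R := (2 `^ `|c|)^-1 * 2 `^ c * (D 2 `^ r^-1 / 2).
have kp : 0 < k0 by rewrite !mulr_gt0 ?invr_gt0 ?powR_gt0 ?dy_gt0.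
exists (k0^-1 * C); first by rewrite mulr_gt0 ?invr_gt0.
move=> a K S a0 S0 hS.
(* the tent of index k is seen by the rearrangement at D k.+2 *)
pose s m := if (m < 2)%N then 0 else a m.-2 * (D m.-2 `^ (- r^-1) / 2).
have s0 m : 0 <= s m by rewrite /s; case: ifP => // _; rewrite !mulr_ge0 ?powR_ge0 ?invr_ge0.
have hs m : (m < K.+2)%N -> s m = 0 \/ ((D m)%:E < tm [set x | (s m <= `|tsum a K x|)%R])%E.
  rewrite /s; case: m => [|[|k]] /=; [by left|by left|] => kK; right.
  apply: (@lt_le_trans _ _ (D k.+1)%:E); first by rewrite lte_fin dy_lt.
  have h2 : D k.+1 <= 2^-1 by rewrite exprS ler_piMr// -(expr0 (2^-1)) dy_le.
  apply: le_trans (tm_distZ_ge (dy_ge0 _) h2) _.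
  apply: le_measure; rewrite ?inE.
  - rewrite -[X in measurable X]setTI (_ : [set x | _] = distZ @^-1` `]-oo, D k.+1[).
      by apply: measurable_distZ => //; exact: measurable_itv.
    by apply/seteqP; split => x /=; rewrite in_itv/=.
  - set z := (_ * _)%R; rewrite -[X in measurable X]setTI (_ : [set x | _] = (fun x => `|tsum a K x|) @^-1` `[z, +oo[).
      have mn : measurable_fun setT (fun x => `|tsum a K x|).
        by apply: measurableT_comp => //; exact: measurable_tsum.
      by apply: mn => //; exact: measurable_itv.
    by apply/seteqP; split => x /=; rewrite in_itv/= andbT.
  - move=> x /= hx.
    have t0 j : 0 <= a j * tent j x by rewrite mulr_ge0// tent_ge0.
    have kK' : (k < K)%N by rewrite -2!ltnS.
    apply: (@le_trans _ _ (a k * tent k x)).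
      by rewrite ler_wpM2l// rE; exact: tent_in.
    apply: le_trans (ler_norm _); rewrite /tsum (bigD1 (Ordinal kK'))//= lerDl.
    by apply: sumr_ge0 => j _; exact: t0.
have := lq_le_shift2 (hC _ _ _ _ (measurable_tsum p al a K) s0 S0 hs hS) => h3.
have A0 k : 0 <= (if (k.+2 < K.+2)%N then k.+3%:R `^ c * (D k.+2 `^ r^-1 * s k.+2) else 0).
  by case: ifP => // _; rewrite !mulr_ge0 ?powR_ge0.
have CS : 0 <= C * S by rewrite mulr_ge0 ?(ltW C0).
have h4 := lq_le_scale u0 A0 CS (ltW (eqbRL (invr_gt0 k0) kp)) h3.
rewrite -mulrA; apply: (lq_leW u0 _ _ _ (lexx _) h4).
- by move=> k; case: ifP => // _; rewrite mulr_ge0 ?powR_ge0.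
- move=> k; rewrite !ltnS; case: ifP => kK; last by rewrite mulr0.
  rewrite ler_pdivlMl//.
  have e : D k.+2 `^ r^-1 * s k.+2 = D 2 `^ r^-1 / 2 * a k.
    rewrite /s /= -(addn2 k) dyD powRM ?dy_ge0//.
    rewrite [LHS](_ : _ = D 2 `^ r^-1 / 2 * a k * (D k `^ r^-1 * D k `^ (- r^-1))); last by ring.
    by rewrite -powRD_pos ?dy_gt0// addrN powRr0 mulr1.
  rewrite e /k0.
  have m0 : 0 < 2 * k.+1%:R :> R by rewrite mulr_gt0// ltr0n.
  have [l1 l2] := two_succ_bounds k.
  have /andP[w1 _] := powR_weight c m0 l1 l2.
  rewrite powRM// in w1.
  rewrite [leLHS](_ : _ = (2 `^ `|c|)^-1 * (2 `^ c * k.+1%:R `^ c) * (D 2 `^ r^-1 / 2 * a k)); last by ring.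
  by rewrite ler_wpM2r// !mulr_ge0 ?powR_ge0 ?invr_ge0.
- by rewrite mulr_ge0// invr_ge0 ltW.
Qed.

(** Continuity at 0 bounds the target norm by 1 on a ball of radius d. The test
    function is rescaled to enter this ball, and homogeneity gives the inequality
    for all S. *)
Lemma necessity_seq (b r c : R) (q u : \bar R) : r^-1 = p^-1 - al -> (0 < q)%E -> (0 < u)%E ->
  lip_embeds_lz p q al b r u c ->
  exists2 C : R, 0 < C & forall (a Z : nat -> R) K (S : R),
    (forall k, 0 <= a k) -> (forall k, 0 <= Z k) -> 0 < S ->
    (forall m, \sum_(k < K) (k <= m)%:R * a k `^ p <= Z m `^ p) ->
    (forall m, \sum_(k < K) (m < k)%:R * (a k * D k `^ al) <= D m `^ al * Z m) ->
    \sum_(k < K) a k * D k `^ al <= S ->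
    lq_le q (fun m => m.+1%:R `^ (- b) * Z m) S ->
    lq_le u (fun k => if (k < K)%N then k.+1%:R `^ c * a k else 0) (C * S).
Proof.
move=> rE q0 u0 [_ emb].
have [C1 C10 h1] := lip_norm_real_cx_le b p0 al0 q0.
have [C2 C20 h2] := lz_norm_tsum_ge c rE u0.
have [C3 C30 h3] := pint_fdiff_tsum_scale.
pose C4 : R := 2 `^ p^-1 + C3.
have C40 : 0 < C4 by rewrite addr_gt0 ?powR_gt0.
have lip (a Z : nat -> R) (K : nat) (S : R) : (forall k, 0 <= a k) -> (forall k, 0 <= Z k) -> 0 <= S ->
    (forall m, \sum_(k < K) (k <= m)%:R * a k `^ p <= Z m `^ p) ->
    (forall m, \sum_(k < K) (m < k)%:R * (a k * D k `^ al) <= D m `^ al * Z m) ->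
    \sum_(k < K) a k * D k `^ al <= S ->
    lq_le q (fun m => m.+1%:R `^ (- b) * Z m) S ->
    [/\ torus_fun (real_cx (tsum a K)), (Lp_norm p (real_cx (tsum a K)) < +oo)%E &
        (lip_norm p q al b (real_cx (tsum a K)) <= (C1 * (C4 * S))%:E)%E].
  move=> a0 Z0 S0 hn hf hV hq.
  have S4 : 0 <= C4 * S by rewrite mulr_ge0 ?(ltW C40).
  have e2 : (2 : R) = (2 `^ p^-1) `^ p by rewrite -powRrM mulVf ?gt_eqF// powRr1.
  have hp : (pint p (tsum a K) <= ((C4 * S) `^ p)%:E)%E.
    apply: le_trans (pint_tsum al p1 K a0) _.
    rewrite lee_fin [X in _ * X <= _]e2 -powRM ?powR_ge0//; last first.
      by apply: sumr_ge0 => k _; rewrite mulr_ge0 ?powR_ge0.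
    apply: ge0_ler_powR; rewrite ?nnegrE ?(ltW p0)//.
      by rewrite mulr_ge0 ?powR_ge0//; apply: sumr_ge0 => k _; rewrite mulr_ge0 ?powR_ge0.
    rewrite mulrC; apply: ler_pM; rewrite ?powR_ge0//.
      by apply: sumr_ge0 => k _; rewrite mulr_ge0 ?powR_ge0.
    by rewrite /C4 lerDl ltW.
  split.
  - by apply: torus_fun_real_cx; [exact: measurable_tsum|exact: per_tsum].
  - by apply: le_lt_trans (Lp_norm_real_cx p0 S4 hp) (ltry _).
  - apply: (h1 _ (fun m => C3 * Z m)) => //.
    + exact: measurable_tsum.
    + exact: per_tsum.
    + by move=> x; exact: tsumN.
    + by move=> m; rewrite mulr_ge0 ?(ltW C30).
    + by move=> m y y0 ym; exact: h3.
    + have z0 m : 0 <= m.+1%:R `^ (- b) * Z m by rewrite mulr_ge0 ?powR_ge0.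
      have := lq_le_scale q0 z0 S0 (ltW C30) hq => h4.
      apply: (lq_leW q0 _ _ _ _ h4).
      * by move=> m; rewrite !mulr_ge0 ?powR_ge0 ?(ltW C30).
      * by move=> m; rewrite mulrCA.
      * by rewrite mulr_ge0 ?(ltW C30).
      * by rewrite ler_wpM2r// /C4 lerDr powR_ge0.
(* the zero function, written as an empty sum of tents *)
pose f0 : R -> R[i] := real_cx (tsum (fun=> 0) 0).
have A0 : lip_space p q al b f0.
  have [t1 t2 t3] : [/\ torus_fun f0, (Lp_norm p f0 < +oo)%E & (lip_norm p q al b f0 <= (C1 * (C4 * 0))%:E)%E].
    apply: (lip _ (fun=> 0)) => //.
    - by move=> m; rewrite big_ord0 powR_ge0.
    - by move=> m; rewrite big_ord0 mulr0.
    - by rewrite big_ord0.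
    - case: q q0 {emb h1 lip} => [s||] // s0; last by move=> m; rewrite mulr0.
      by move=> n; rewrite big1 ?powR_ge0// => m _; rewrite mulr0 powR0 ?gt_eqF.
  by split=> //; apply: le_lt_trans t3 (ltry _).
have [d d0 hd] := emb _ A0 1 ltr01.
exists (C2 * (2 * C1 * C4 / d)); first by rewrite !mulr_gt0 ?invr_gt0.
move=> a Z K S a0 Z0 S0 hn hf hV hq.
pose ka := d / (2 * C1 * C4 * S).
have ka0 : 0 < ka by rewrite divr_gt0// !mulr_gt0.
pose a' k := ka * a k.
have a'0 k : 0 <= a' k by rewrite mulr_ge0// ltW.
have Z'0 k : 0 <= ka * Z k by rewrite mulr_ge0// ltW.
have [tf fin1 hl] : [/\ torus_fun (real_cx (tsum a' K)), (Lp_norm p (real_cx (tsum a' K)) < +oo)%E &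
        (lip_norm p q al b (real_cx (tsum a' K)) <= (C1 * (C4 * (ka * S)))%:E)%E].
  apply: (lip _ (fun k => ka * Z k)) => //.
  - by rewrite mulr_ge0 ?ltW.
  - move=> m; rewrite powRM ?(ltW ka0)//.
    rewrite (eq_bigr (fun k : 'I_K => ka `^ p * ((k <= m)%:R * a k `^ p))).
      by rewrite -mulr_sumr ler_wpM2l ?powR_ge0.
    by move=> k _; rewrite /a' powRM ?(ltW ka0)// mulrCA.
  - move=> m; rewrite mulrCA.
    rewrite (eq_bigr (fun k : 'I_K => ka * ((m < k)%:R * (a k * D k `^ al)))).
      by rewrite -mulr_sumr ler_wpM2l ?(ltW ka0).
    by move=> k _; rewrite /a'; ring.
  - rewrite (eq_bigr (fun k : 'I_K => ka * (a k * D k `^ al))).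
      by rewrite -mulr_sumr ler_wpM2l ?(ltW ka0).
    by move=> k _; rewrite /a' mulrA.
  - have z0 m : 0 <= m.+1%:R `^ (- b) * Z m by rewrite mulr_ge0 ?powR_ge0.
    have := lq_le_scale q0 z0 (ltW S0) (ltW ka0) hq.
    by congr (lq_le _ _ _); apply/funext => m; rewrite mulrCA.
have e1 : C1 * (C4 * (ka * S)) = d / 2.
  by rewrite /ka; field; rewrite !gt_eqF.
have hlt : (lip_norm p q al b (real_cx (tsum a' K)) < d%:E)%E.
  apply: le_lt_trans hl _; rewrite e1 lte_fin ltr_pdivrMr// ltr_pMr// ltr1n//.
have As : lip_space p q al b (real_cx (tsum a' K)).
  by split=> //; apply: lt_trans hlt (ltry _).
have sub0 : (fun x => real_cx (tsum a' K) x - f0 x) = real_cx (tsum a' K).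
  by apply/funext => x; rewrite /f0 /real_cx /tsum big_ord0; congr Complex; rewrite subr0.
have := hd _ As; rewrite sub0 => /(_ hlt) /ltW hlz.
have := h2 a' K 1 a'0 ler01 hlz => h4.
have kV0 : 0 <= ka^-1 by rewrite invr_ge0 ltW.
have A'0 k : 0 <= (if (k < K)%N then k.+1%:R `^ c * a' k else 0).
  by case: ifP => // _; rewrite mulr_ge0 ?powR_ge0.
have C21 : 0 <= C2 * 1 by rewrite mulr1 ltW.
have := lq_le_scale u0 A'0 C21 kV0 h4.
have -> : ka^-1 * (C2 * 1) = C2 * (2 * C1 * C4 / d) * S.
  by rewrite /ka; field; rewrite !gt_eqF.
congr (lq_le _ _ _); apply/funext => k; case: ifP => _; rewrite ?mulr0//.
by rewrite /a' mulrCA [ka^-1 * _]mulrA mulVf ?gt_eqF// mul1r.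
Qed.

End tests.

(** * Growth along powers of two *)

Section growth.
Context {R : realType}.
Local Notation D k := (2^-1 ^+ k : R).
Implicit Types (x y b s t A C : R).

Lemma exp2_unbounded t C : 0 < t -> exists N : nat, C < (2 ^ N)%:R `^ t.
Proof.
move=> t0; have h1 : 0 < (2 : R) `^ t - 1.
  have e : (2 : R) `^ t = (2^-1 `^ t)^-1 by rewrite -[2^-1]powR_inv1// -powRrM mulN1r powRN invrK.
  by rewrite subr_gt0 e invf_gt1 ?powR_gt0// half_powR_lt1.
set d := (2 : R) `^ t - 1 in h1.
pose N := (Num.truncn (`|C| / d)).+1; exists N.
have -> : (2 ^ N)%:R `^ t = (1 + d) ^+ N :> R.
  rewrite natrX -powR_mulrn// -powRrM mulrC powRrM powR_mulrn ?powR_ge0//.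
  by rewrite /d addrC subrK.
apply: (@lt_le_trans _ _ (1 + d *+ N)); last first.
  elim: (N) => [|n IH]; first by rewrite mulr0n addr0 expr0.
  rewrite exprS mulrDl mul1r mulrS [d + _]addrC addrA lerD//.
  by rewrite ler_peMr ?(ltW h1)// exprn_ege1// lerDl ltW.
have h2 : `|C| < d *+ N by rewrite -mulr_natr mulrC -ltr_pdivrMr// truncnS_gt.
by apply: le_lt_trans (ler_norm C) _; apply: lt_trans h2 _; rewrite ltrDr.
Qed.

Lemma exp2_growth x y C :
  (forall N : nat, (2 ^ N.+1)%:R `^ x <= C * (2 ^ N.+1)%:R `^ y) -> x <= y.
Proof.
move=> h; rewrite leNgt; apply/negP => yx.
have t0 : 0 < x - y by rewrite subr_gt0.
have [N] := exp2_unbounded C t0; apply/negP; rewrite -leNgt.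
have N0 : 0 < (2 ^ N.+1)%:R :> R by rewrite ltr0n expn_gt0.
apply: (@le_trans _ _ ((2 ^ N.+1)%:R `^ (x - y))).
  by apply: ge0_ler_powR; rewrite ?nnegrE ?(ltW t0)// ler_nat leq_exp2l.
by rewrite powRD_pos// powRN ler_pdivrMr ?powR_gt0.
Qed.

(** Half of the exponential decay, the factor sqrt(tau)^j, absorbs the power. *)
Lemma sum_poly_exp be (tau : R) : 0 <= be -> 0 < tau -> tau < 1 ->
  exists2 A : R, 0 < A & forall n, \sum_(j < n) j.+1%:R `^ be * tau ^+ j <= A.
Proof.
move=> b0 t0 t1.
have [->|bn] := eqVneq be 0.
  exists (1 - tau)^-1; first by rewrite invr_gt0 subr_gt0.
  move=> n; rewrite (eq_bigr (fun j : 'I_n => tau ^+ j)); last by move=> j _; rewrite powRr0 mul1r.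
  have := @sum_geo_le R tau n; apply => //; exact: ltW.
have bp : 0 < be by rewrite lt_neqAle eq_sym bn.
pose sg := Num.sqrt tau.
have s0 : 0 < sg by rewrite sqrtr_gt0.
have ss : sg * sg = tau by rewrite -expr2 sqr_sqrtr ?ltW.
have s1 : sg < 1 by rewrite -sqrtr1 ltr_sqrt.
have l0 : 0 < - ln sg by rewrite oppr_gt0 ln_lt0// s0.
pose e := - ln sg / be; have e0 : 0 < e by rewrite divr_gt0.
have key j : j.+1%:R `^ be * sg ^+ j <= e `^ (- be) * sg^-1.
  have h1 : j.+1%:R * e <= expR (j.+1%:R * e).
    by apply: le_trans (expR_ge1Dx _); rewrite lerDr.
  have h2 : (j.+1%:R * e) `^ be <= expR (j.+1%:R * - ln sg).
    apply: le_trans (_ : expR (j.+1%:R * e) `^ be <= _).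
      have je0 : 0 <= j.+1%:R * e := mulr_ge0 (ler0n _ _) (ltW e0).
      by apply: ge0_ler_powR; rewrite ?nnegrE ?je0 ?expR_ge0.
    by rewrite -expRM /e -mulrA divfK ?gt_eqF.
  have h3 : expR (j.+1%:R * - ln sg) = (sg ^+ j)^-1 * sg^-1.
    rewrite mulrN expRN mulr_natl -lnXn// lnK ?posrE ?exprn_gt0// exprS invfM mulrC//.
  rewrite h3 powRM ?(ltW e0)// in h2.
  have sj : 0 < sg ^+ j by rewrite exprn_gt0.
  rewrite -ler_pdivlMr// powRN -mulrA [sg^-1 * _]mulrC.
  have ep : 0 < e `^ be := powR_gt0 be e0.
  by rewrite (ler_pdivlMl _ _ ep) [leLHS]mulrC.
exists (e `^ (- be) * sg^-1 * (1 - sg)^-1).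
  by rewrite !mulr_gt0 ?powR_gt0 ?invr_gt0 ?subr_gt0.
move=> n; apply: le_trans (_ : \sum_(j < n) e `^ (- be) * sg^-1 * sg ^+ j <= _).
  apply: ler_sum => j _; rewrite -ss exprMn mulrA ler_wpM2r ?exprn_ge0 ?(ltW s0)//.
rewrite -mulr_sumr ler_wpM2l ?mulr_ge0 ?powR_ge0 ?invr_ge0 ?(ltW s0)//.
by have := @sum_geo_le R sg n; apply => //; exact: ltW.
Qed.

(** The scales finer than D m contribute like the first of them. *)
Lemma sum_fine_scales be al : 0 <= be -> 0 < al -> exists2 A : R, 0 < A &
  forall K m, \sum_(k < K) (m <= k)%:R * (k.+1%:R `^ be * D k `^ al) <= A * (D m `^ al * m.+1%:R `^ be).
Proof.
move=> b0 al0; have t0 : 0 < (2^-1 : R) `^ al by rewrite powR_gt0.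
have [A A0 hA] := sum_poly_exp b0 t0 (half_powR_lt1 al0).
exists A => // K m.
apply: (@le_trans _ _ (\sum_(k < m + K) (m <= k)%:R * (k.+1%:R `^ be * D k `^ al))).
  rewrite (big_ord_widen (m + K) (fun k => (m <= k)%:R * (k.+1%:R `^ be * D k `^ al)) (leq_addl _ _)).
  by rewrite big_mkcond/=; apply: ler_sum => k _; case: ifP => // _; rewrite !mulr_ge0 ?powR_ge0.
rewrite (sum_indic_window (fun k => k.+1%:R `^ be * D k `^ al)).
rewrite mulrC; apply: le_trans (ler_wpM2l _ (hA K)); last by rewrite mulr_ge0 ?powR_ge0.
rewrite mulr_sumr; apply: ler_sum => j _.
rewrite dyD powRM ?dy_ge0// [(D j) `^ al]dy_powR.
rewrite [leRHS](_ : _ = (m.+1%:R `^ be * j.+1%:R `^ be) * (D m `^ al * (2^-1 `^ al) ^+ j)); last by ring.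
rewrite ler_wpM2r ?mulr_ge0 ?powR_ge0 ?exprn_ge0 ?powR_ge0// -powRM//.
apply: ge0_ler_powR; rewrite ?nnegrE ?mulr_ge0// -natrM ler_nat.
by rewrite mulSn mulnS; lia.
Qed.

Lemma harmonic_le N : \sum_(m < 2 ^ N) m.+1%:R^-1 <= N.+1%:R :> R.
Proof.
elim: N => [|N IH]; first by rewrite expn0 big_ord1 invr1.
rewrite expnS mul2n -addnn big_split_ord/= -[in leRHS]natr1 lerD//.
apply: (@le_trans _ _ (\sum_(i < 2 ^ N) (2 ^ N)%:R^-1)).
  apply: ler_sum => i _; rewrite lef_pV2 ?posrE ?ltr0n ?expn_gt0// ler_nat.
  by rewrite -addnS leq_addr.
by rewrite sumr_const card_ord -[X in X <= _]mulr_natl mulfV// pnatr_eq0 -lt0n expn_gt0.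
Qed.

(** The indices k for which k + 1 is a power of two. *)
Definition pow2 k : bool := k.+1 == (2 ^ trunc_log 2 k.+1)%N.

Lemma pow2_exp N : pow2 (2 ^ N).-1.
Proof. by rewrite /pow2 prednK ?expn_gt0// trunc_expnK. Qed.

Lemma sum_pow2_ge N : N.+1%:R <= \sum_(k < 2 ^ N) (pow2 k)%:R :> R.
Proof.
elim: N => [|N IH]; first by rewrite expn0 big_ord1.
have e : (2 ^ N.+1 = (2 ^ N.+1).-1.+1)%N by rewrite prednK// expn_gt0.
rewrite [in leRHS]e big_ord_recr/= pow2_exp -natr1 lerD2r; apply: le_trans IH _.
have h : (2 ^ N <= (2 ^ N.+1).-1)%N.
  by rewrite -ltnS -e ltn_exp2l.
rewrite (big_ord_widen _ (fun k => (pow2 k)%:R : R) h) big_mkcond/=.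
by apply: ler_sum => i _; case: ifP.
Qed.

Lemma sum_pow2_le t : 0 < t -> exists2 A : R, 0 < A & forall n,
  \sum_(k < n) k.+1%:R `^ t * (pow2 k)%:R <= A * n%:R `^ t.
Proof.
move=> t0; pose tau : R := 2^-1 `^ t.
have t1 : tau < 1 by exact: half_powR_lt1.
pose A := (1 - tau)^-1; have A0 : 0 < A by rewrite invr_gt0 subr_gt0.
exists A => // n; case: n => [|n]; first by rewrite big_ord0 mulr_ge0 ?powR_ge0 ?(ltW A0).
have key : \sum_(k < n.+1) k.+1%:R `^ t * (pow2 k)%:R <= A * (2 ^ trunc_log 2 n.+1)%:R `^ t :> R.
  elim: n => [|n IH].
    rewrite big_ord1 /pow2 trunc_log1 expn0 powR1 mul1r mulr1.
    by rewrite /A invf_ge1 ?subr_gt0// gerBl powR_ge0.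
  rewrite big_ord_recr/=; set j := trunc_log 2 n.+2.
  have [pw|npw] := boolP (pow2 n.+1); last first.
    rewrite mulr0 addr0; apply: le_trans IH _; rewrite ler_wpM2l ?(ltW A0)//.
    apply: ge0_ler_powR; rewrite ?nnegrE ?(ltW t0)// ler_nat leq_exp2l//.
    exact: leq_trunc_log.
  have nE : n.+2 = (2 ^ j)%N by apply/eqP.
  have j0 : (0 < j)%N by rewrite lt0n; apply/eqP => jz; move: nE; rewrite jz expn0.
  have jl : trunc_log 2 n.+1 = j.-1.
    apply: trunc_log_eq => //; rewrite prednK//; apply/andP; split.
      by rewrite -ltnS nE ltn_exp2l// ltn_predL.
    by rewrite -nE.
  rewrite jl in IH; rewrite mulr1 nE.
  apply: le_trans (lerD IH (lexx _)) _.
  have e : (2 ^ j.-1)%:R `^ t = tau * (2 ^ j)%:R `^ t :> R.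
    rewrite -powRM//; congr (_ `^ _).
    by rewrite -[in RHS](prednK j0) expnS natrM mulrA mulVf// mul1r.
  rewrite e mulrA -[X in _ + X]mul1r -mulrDl.
  by have -> : A * tau + 1 = A by rewrite /A; field; rewrite gt_eqF// subr_gt0.
apply: le_trans key _; rewrite ler_wpM2l ?(ltW A0)//.
apply: ge0_ler_powR; rewrite ?nnegrE ?(ltW t0)// ler_nat.
by have /andP[] := @trunc_log_bounds 2 n.+1 isT isT.
Qed.

End growth.

(** * Necessity *)

Section test_sequences.
Context {R : realType}.
Local Notation D k := (2^-1 ^+ k : R).
Implicit Types (b et be c : R) (q u : \bar R).

Lemma sum_tail_weight (s b : R) (K n : nat) : 1 < b * s -> (0 < K)%N ->
  \sum_(m < n) (K <= m)%:R * m.+1%:R `^ (- (b * s)) <= (b * s - 1)^-1 * K%:R `^ (1 - b * s).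
Proof.
move=> bs K0; have bs0 : 0 < b * s - 1 by rewrite subr_gt0.
have := sum_powRN_le n bs0 K0; rewrite opprB; apply: le_trans.
rewrite (_ : 1 - b * s - 1 = - (b * s)); last by ring.
rewrite -(big_mkord xpredT (fun m => (K <= m)%:R * m.+1%:R `^ (- (b * s)))).
have [nK|Kn] := leqP n K.
  rewrite [leRHS]big_geq// big_nat big1// => m /andP[_ mn].
  by rewrite leqNgt (leq_trans mn nK) mul0r.
rewrite (@big_cat_nat _ _ _ K) ?(ltnW Kn)//= big_nat big1 ?add0r; last first.
  by move=> m /andP[_ mK]; rewrite leqNgt mK mul0r.
rewrite big_nat [leRHS]big_nat; apply: ler_sum => m /andP[Km _].
by rewrite Km mul1r.
Qed.

(** Up to K the summand is (m + 1)^(et - b); beyond K the factor with et is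
    constant, and the rest converges because b s > 1. *)
Lemma trunc_weight_le (s b et : R) (K n : nat) : 0 < s -> 1 < b * s -> 0 <= et -> (0 < K)%N ->
  \sum_(m < n) (m.+1%:R `^ (- b) * (minn m.+1 K)%:R `^ et) `^ s <=
  \sum_(m < K) m.+1%:R `^ ((et - b) * s) + (b * s - 1)^-1 * K%:R `^ ((et - b) * s + 1) :> R.
Proof.
move=> s0 bs e0 K0; have Kp : 0 < K%:R :> R by rewrite ltr0n.
apply: (@le_trans _ _ (\sum_(m < n) (m < K)%:R * m.+1%:R `^ ((et - b) * s) +
   K%:R `^ (et * s) * \sum_(m < n) (K <= m)%:R * m.+1%:R `^ (- (b * s)))).
  rewrite mulr_sumr -big_split/=; apply: ler_sum => m _.
  rewrite powRM ?powR_ge0// -!powRrM mulNr.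
  have m0 : 0 < m.+1%:R :> R by rewrite ltr0n.
  case: (ltnP m K) => mK.
    rewrite (minn_idPl mK) mul1r mul0r mulr0 addr0 -powRD_pos//.
    by apply: eq_ler; congr (_ `^ _); ring.
  by rewrite (minn_idPr (leqW mK)) mul0r add0r mul1r mulrC.
apply: lerD; first by apply: (@sum_indic_le R (fun m => m.+1%:R `^ ((et - b) * s))) => i; exact: powR_ge0.
apply: le_trans (ler_wpM2l (powR_ge0 _ _) (sum_tail_weight n bs K0)) _.
rewrite mulrCA -powRD_pos//; apply: eq_ler; congr (_ * _ `^ _); ring.
Qed.

Lemma trunc_weight_pow q b et : (0 < q)%E -> recip q < b -> b <= et -> exists2 B : R, 1 <= B &
  forall K, (0 < K)%N ->
    lq_le q (fun m => m.+1%:R `^ (- b) * (minn m.+1 K)%:R `^ et) (B * K%:R `^ (et - b + recip q)).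
Proof.
case: q => [s||] // q0; last first.
  rewrite recipy => b0 be; exists 1 => // K K0 m; rewrite mul1r addr0.
  have et0 : 0 <= et by apply: le_trans be; exact: ltW.
  have Kp : 0 < K%:R :> R by rewrite ltr0n.
  have m0 : 0 < m.+1%:R :> R by rewrite ltr0n.
  have [mK|Km] := leqP m.+1 K.
    rewrite -powRD_pos// addrC; apply: ge0_ler_powR; rewrite ?nnegrE ?subr_ge0// ler_nat//.
  rewrite [in leRHS]addrC [leRHS]powRD_pos// ler_wpM2r ?powR_ge0//.
  by apply: powRN_le; rewrite ?oppr_le0 ?(ltW b0)// ler_nat ltnW.
rewrite lte_fin in q0; rewrite recipE// => sb be.
have b0 : 0 < b by apply: lt_trans sb; rewrite invr_gt0.
have bs : 1 < b * s by rewrite -(mulVf (lt0r_neq0 q0)) ltr_pM2r.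
pose B0 : R := 1 + (b * s - 1)^-1.
have B01 : 1 <= B0 by rewrite lerDl invr_ge0 subr_ge0 ltW.
exists (B0 `^ s^-1).
  have e : (1 : R) `^ s^-1 = 1 by rewrite powR1.
  rewrite -[X in X <= _]e; apply: ge0_ler_powR; rewrite ?nnegrE ?invr_ge0 ?(ltW q0)//.
  exact: le_trans ler01 B01.
move=> K K0 n; have Kp : 0 < K%:R :> R by rewrite ltr0n.
have B00 : 0 <= B0 by exact: le_trans ler01 B01.
rewrite (powRM s (powR_ge0 _ _) (powR_ge0 _ _)) -!powRrM mulVf ?gt_eqF// powRr1//.
rewrite [(et - b + s^-1) * s]mulrDl mulVf ?gt_eqF//.
have et0 : 0 <= et by apply: le_trans be; exact: ltW.
apply: le_trans (trunc_weight_le n q0 bs et0 K0) _.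
rewrite /B0 [leRHS]mulrDl mul1r lerD2r [leRHS]powRD_pos// powRr1 ?(ltW Kp)//.
apply: (@le_trans _ _ (\sum_(m < K) K%:R `^ ((et - b) * s))).
  apply: ler_sum => m _; apply: ge0_ler_powR; rewrite ?nnegrE ?mulr_ge0 ?subr_ge0 ?(ltW q0)//.
  by rewrite ler_nat.
by rewrite sumr_const card_ord mulr_natr.
Qed.

(** With the exponent b - 1/q the part up to K becomes a harmonic sum, whence a
    power of the logarithm. *)
Lemma trunc_weight_log q b : (0 < q)%E -> recip q < b -> exists2 B : R, 1 <= B &
  forall N : nat,
    lq_le q (fun m => m.+1%:R `^ (- b) * (minn m.+1 (2 ^ N))%:R `^ (b - recip q)) (B * N.+1%:R `^ recip q).
Proof.
case: q => [s||] // q0; last first.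
  move=> hb; have [B B1 hB] := trunc_weight_pow q0 hb (lexx b).
  exists B => // N; have K0 : (0 < 2 ^ N)%N by rewrite expn_gt0.
  have := hB (2 ^ N)%N K0; rewrite recipy subr0 addr0 subrr.
  by rewrite !powRr0.
rewrite lte_fin in q0; rewrite recipE// => sb.
have bs : 1 < b * s by rewrite -(mulVf (lt0r_neq0 q0)) ltr_pM2r.
pose B0 : R := 1 + (b * s - 1)^-1.
have Bi : 0 <= (b * s - 1)^-1 by rewrite invr_ge0 subr_ge0 ltW.
have B01 : 1 <= B0 by rewrite lerDl.
exists (B0 `^ s^-1).
  have e : (1 : R) `^ s^-1 = 1 by rewrite powR1.
  rewrite -[X in X <= _]e; apply: ge0_ler_powR; rewrite ?nnegrE ?invr_ge0 ?(ltW q0)//.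
  exact: le_trans ler01 B01.
move=> N n; have K0 : (0 < 2 ^ N)%N by rewrite expn_gt0.
have B00 : 0 <= B0 by exact: le_trans ler01 B01.
rewrite (powRM s (powR_ge0 _ _) (powR_ge0 _ _)) -!powRrM mulVf ?gt_eqF// !powRr1//.
have et0 : 0 <= b - s^-1 by rewrite subr_ge0 ltW.
apply: le_trans (trunc_weight_le n q0 bs et0 K0) _.
have e : (b - s^-1 - b) * s = -1 by field; rewrite gt_eqF.
rewrite e addNr powRr0 mulr1 /B0 mulrDl mul1r; apply: lerD.
  rewrite (eq_bigr (fun m : 'I_(2 ^ N) => m.+1%:R^-1)); first exact: harmonic_le.
  by move=> m _; rewrite powR_inv1.
by rewrite ler_peMr// ler1n.
Qed.

Section necessity.
Context (p al b r : R) (q : \bar R).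
Context (p1 : 1 < p) (al0 : 0 < al) (alp : al < p^-1) (rE : r^-1 = p^-1 - al).
Context (q0 : (0 < q)%E) (hb : recip q < b).

Let p0 : 0 < p. Proof. exact: lt_trans p1. Qed.

Let rq0 : 0 <= recip q.
Proof. by case: q q0 => [s||] // s0; rewrite recipE// invr_ge0 ltW. Qed.

Let b0 : 0 < b. Proof. exact: le_lt_trans hb. Qed.

(** [necessity_seq] for the coefficients (k + 1)^be on a set e of indices. The
    growth et of their partial l_p norms determines the modulus of smoothness, and
    the finer tents add nothing by [sum_fine_scales]. *)
Lemma necessity_power u c be et (e : nat -> bool) (A1 : R) :
  (0 < u)%E -> lip_embeds_lz p q al b r u c -> 0 <= be -> be <= et -> 0 <= A1 ->
  (forall n, \sum_(k < n) (k.+1%:R `^ be * (e k)%:R) `^ p <= (A1 * n%:R `^ et) `^ p) ->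
  exists2 C : R, 0 < C & forall K (S : R), (0 < K)%N -> 1 <= S ->
    lq_le q (fun m => m.+1%:R `^ (- b) * (minn m.+1 K)%:R `^ et) S ->
    lq_le u (fun k => if (k < K)%N then k.+1%:R `^ (c + be) * (e k)%:R else 0) (C * S).
Proof.
move=> u0 emb be0 beet A10 hn.
have [C C0 hC] := necessity_seq p1 al0 alp rE q0 u0 emb.
have [A2 A20 hA2] := sum_fine_scales be0 al0.
pose A := A1 + A2; have A0 : 0 < A by rewrite ltr_wpDl.
exists (C * A); first by rewrite mulr_gt0.
move=> K S K0 S1 hS; have S0 : 0 < S by exact: lt_le_trans S1.
pose a k := k.+1%:R `^ be * (e k)%:R.
pose Z m := A * (minn m.+1 K)%:R `^ et.
have a0 k : 0 <= a k by rewrite mulr_ge0 ?powR_ge0.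
have Z0 k : 0 <= Z k by rewrite mulr_ge0 ?powR_ge0 ?(ltW A0).
have ale k : a k <= k.+1%:R `^ be by rewrite /a; case: (e k); rewrite ?mulr1// mulr0 powR_ge0.
have AS : 0 < A * S by rewrite mulr_gt0.
have h1 m : \sum_(k < K) (k <= m)%:R * a k `^ p <= Z m `^ p.
  rewrite (sum_indic_min (fun k => a k `^ p)) minnC; apply: le_trans (hn _) _.
  have le : A1 * (minn m.+1 K)%:R `^ et <= Z m by rewrite /Z /A ler_wpM2r ?powR_ge0// lerDl ltW.
  by apply: ge0_ler_powR le; rewrite ?nnegrE; [exact: ltW | exact: mulr_ge0 A10 (powR_ge0 _ _) | exact: Z0].
have h2 m : \sum_(k < K) (m < k)%:R * (a k * D k `^ al) <= D m `^ al * Z m.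
  have [Km|mK] := leqP K m.+1.
    rewrite big1 => [|k _]; first exact: mulr_ge0 (powR_ge0 _ _) (Z0 m).
    by rewrite ltnNge -ltnS (leq_trans (ltn_ord k) Km) mul0r.
  apply: (@le_trans _ _ (\sum_(k < K) (m <= k)%:R * (k.+1%:R `^ be * D k `^ al))).
    apply: ler_sum => k _; apply: ler_pM; rewrite ?mulr_ge0 ?powR_ge0//.
      by case: (ltnP m k) => // mk; rewrite (ltnW mk).
    by rewrite ler_wpM2r ?powR_ge0.
  apply: le_trans (hA2 K m) _; rewrite mulrCA ler_wpM2l ?powR_ge0// /Z (minn_idPl (ltnW mK)).
  apply: ler_pM; rewrite ?powR_ge0 ?(ltW A20)//; first by rewrite /A lerDr.
  by rewrite ler_powR// ler1n.
have h3 : \sum_(k < K) a k * D k `^ al <= A * S.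
  apply: (@le_trans _ _ (\sum_(k < K) (0 <= k)%:R * (k.+1%:R `^ be * D k `^ al))).
    by apply: ler_sum => k _; rewrite mul1r ler_wpM2r ?powR_ge0.
  apply: le_trans (hA2 K 0%N) _; rewrite expr0 !powR1 !mulr1.
  apply: le_trans (_ : A * 1 <= _); first by rewrite mulr1 /A lerDr.
  by rewrite ler_wpM2l ?(ltW A0).
have h4 : lq_le q (fun m => m.+1%:R `^ (- b) * Z m) (A * S).
  have z0 m : 0 <= m.+1%:R `^ (- b) * (minn m.+1 K)%:R `^ et :> R by rewrite mulr_ge0 ?powR_ge0.
  have := lq_le_scale q0 z0 (ltW S0) (ltW A0) hS.
  by congr (lq_le _ _ _); apply/funext => m; rewrite mulrCA.
have := hC a Z K (A * S) a0 Z0 AS h1 h2 h3 h4.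
rewrite mulrA; congr (lq_le _ _ _); apply/funext => k; case: ifP => // _.
by rewrite /a mulrA -powRD_pos// ltr0n.
Qed.

(** Along powers of two the partial l_p norms are geometric sums, so there is no
    loss: et = be. *)
Lemma necessity_sparse u c be : (0 < u)%E -> lip_embeds_lz p q al b r u c -> 0 < be ->
  exists2 C : R, 0 < C & forall K (S : R), (0 < K)%N -> 1 <= S ->
    lq_le q (fun m => m.+1%:R `^ (- b) * (minn m.+1 K)%:R `^ be) S ->
    lq_le u (fun k => if (k < K)%N then k.+1%:R `^ (c + be) * (pow2 k)%:R else 0) (C * S).
Proof.
move=> u0 emb be0.
have bp0 : 0 < be * p by rewrite mulr_gt0.
have [A A0 hA] := @sum_pow2_le R (be * p) bp0.
apply: (@necessity_power u c be be pow2 (A `^ p^-1) u0 emb (ltW be0) (lexx _) (powR_ge0 _ _)).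
move=> n; rewrite powRM ?powR_ge0// -!powRrM mulVf ?gt_eqF// powRr1 ?(ltW A0)//.
apply: le_trans (hA n); apply: ler_sum => k _.
by rewrite powRM ?powR_ge0// -powRrM; case: (pow2 k); rewrite ?powR1// powR0 ?gt_eqF.
Qed.

(** Coefficients (k + 1)^b; the single term of index K - 1 of the target
    norm is K^xi. *)
Lemma necessity_recip u (xi : R) : (0 < u)%E -> lip_embeds_lz p q al b r u (- b + xi) -> xi <= recip q.
Proof.
move=> u0 emb; have [C C0 hC] := necessity_sparse u0 emb b0.
have [B B1 hB] := trunc_weight_pow q0 hb (lexx b).
have B0 : 0 < B by exact: lt_le_trans B1.
apply: (@exp2_growth R xi (recip q) (C * B)) => N.
have K0 : (0 < 2 ^ N.+1)%N by rewrite expn_gt0.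
set K := (2 ^ N.+1)%N in K0 *; have Kp : 0 < K%:R :> R by rewrite ltr0n.
have S1 : 1 <= B * K%:R `^ (b - b + recip q).
  rewrite -[X in X <= _]mulr1; apply: ler_pM => //.
  rewrite subrr add0r -[X in X <= _](@powRr0 R K%:R) ler_powR// ler1n//.
have := hC K _ K0 S1 (hB K K0).
have a0 k : 0 <= (if (k < K)%N then k.+1%:R `^ (- b + xi + b) * (pow2 k)%:R else 0) :> R.
  by case: ifP => // _; rewrite mulr_ge0 ?powR_ge0.
have uN : u != -oo%E by case: (u) u0.
have CS : 0 <= C * (B * K%:R `^ (b - b + recip q)).
  by rewrite !mulr_ge0 ?powR_ge0 ?(ltW C0) ?(ltW B0).
move=> /(lq_le_term K.-1 u0 a0 CS uN).
rewrite prednK// leqnn pow2_exp mulr1 subrr add0r addrAC addNr add0r mulrA.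
exact.
Qed.

(** Coefficients (k + 1)^(b - 1/q), so that all the nonzero terms on the target side
    equal 1, and there are log K of them. *)
Lemma necessity_recip_log (v : R) : 0 < v -> lip_embeds_lz p q al b r v%:E (- b + recip q) ->
  1 <= v * recip q.
Proof.
move=> v0 emb; have be0 : 0 < b - recip q by rewrite subr_gt0.
have u0 : (0 < v%:E)%E by [].
have [C C0 hC] := necessity_sparse u0 emb be0.
have [B B1 hB] := trunc_weight_log q0 hb.
have B0 : 0 < B by exact: lt_le_trans B1.
apply: (@exp2_growth R _ _ ((C * B) `^ v)) => M.
pose N := (2 ^ M.+1).-1; have NM : (N.+1 = 2 ^ M.+1)%N by rewrite prednK// expn_gt0.
have K0 : (0 < 2 ^ N)%N by rewrite expn_gt0.
have S1 : 1 <= B * N.+1%:R `^ recip q.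
  rewrite -[X in X <= _]mulr1; apply: ler_pM => //.
  by rewrite -[X in X <= _](@powRr0 R N.+1%:R) ler_powR// ler1n.
have := hC _ _ K0 S1 (hB N) => /(_ (2 ^ N)%N).
rewrite powRr1// -NM => h.
have CB : 0 <= C * B by rewrite mulr_ge0 ?(ltW C0) ?(ltW B0).
rewrite [v * _]mulrC powRrM -(powRM v CB (powR_ge0 _ _)) -mulrA; apply: le_trans h.
apply: le_trans (@sum_pow2_ge R N) _; apply: ler_sum => k _.
rewrite ltn_ord (_ : - b + recip q + (b - recip q) = 0); last by ring.
by rewrite powRr0 mul1r; case: (pow2 k); rewrite ?powR1// powR_ge0.
Qed.

(** Coefficients (k + 1)^b at all indices; their partial l_p norms grow with
    the additional exponent 1/p. The terms with k between K/2 and K suffice for the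
    lower bound. *)
Lemma necessity_dense (v c : R) : 0 < v -> lip_embeds_lz p q al b r v%:E c ->
  c + b + v^-1 <= p^-1 + recip q.
Proof.
move=> v0 emb; have u0 : (0 < v%:E)%E by [].
have pV0 : 0 < p^-1 by rewrite invr_gt0.
have beet : b <= b + p^-1 by rewrite lerDl ltW.
pose all1 (k : nat) := true.
have hn n : \sum_(k < n) (k.+1%:R `^ b * (all1 k)%:R) `^ p <= (1 * n%:R `^ (b + p^-1)) `^ p :> R.
  have [->|n0] := posnP n; first by rewrite big_ord0 powR_ge0.
  have np : 0 < n%:R :> R by rewrite ltr0n.
  rewrite mul1r -powRrM mulrDl mulVf ?gt_eqF// powRD_pos// powRr1 ?(ltW np)//.
  apply: (@le_trans _ _ (\sum_(k < n) n%:R `^ (b * p))).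
    apply: ler_sum => k _; rewrite mulr1 -powRrM; apply: ge0_ler_powR; rewrite ?nnegrE ?mulr_ge0 ?(ltW b0) ?(ltW p0)//.
    by rewrite ler_nat.
  by rewrite sumr_const card_ord mulr_natr.
have [C C0 hC] := @necessity_power v%:E c b (b + p^-1) all1 1 u0 emb (ltW b0) beet ler01 hn.
have [B B1 hB] := trunc_weight_pow q0 hb beet.
have B0 : 0 < B by exact: lt_le_trans B1.
set x := c + b.
rewrite -(ler_pM2r v0) [leLHS]mulrDl mulVf ?gt_eqF//.
apply: (@exp2_growth R _ _ (2 * 2 `^ `|x * v| * (C * B) `^ v)) => N.
have H0 : (0 < 2 ^ N)%N by rewrite expn_gt0.
set H := (2 ^ N)%N in H0; have EK : (2 ^ N.+1 = H + H)%N by rewrite expnS mul2n addnn.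
have K0 : (0 < 2 ^ N.+1)%N by rewrite expn_gt0.
set K := (2 ^ N.+1)%N in EK K0 *; clearbody K H; have Kp : 0 < K%:R :> R by rewrite ltr0n.
have S1 : 1 <= B * K%:R `^ (b + p^-1 - b + recip q).
  rewrite -[X in X <= _]mulr1; apply: ler_pM => //.
  rewrite -[X in X <= _](@powRr0 R K%:R) ler_powR ?ler1n//.
  by rewrite (_ : b + _ - b = p^-1) ?addr_ge0 ?(ltW pV0)//; ring.
have := hC K _ K0 S1 (hB K K0) => /(_ K).
rewrite (_ : b + p^-1 - b = p^-1); last by ring.
have CB : 0 <= C * B by rewrite mulr_ge0 ?(ltW C0) ?(ltW B0).
rewrite mulrA (powRM v CB (powR_ge0 _ _)) -powRrM => h.
rewrite -mulrA powRD_pos// powRr1 ?(ltW Kp)//.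
have P0 : 0 < (2 : R) `^ `|x * v| by rewrite powR_gt0.
have half k : (H <= k < K)%N -> (2 `^ `|x * v|)^-1 * K%:R `^ (x * v) <= k.+1%:R `^ (x * v) :> R.
  case/andP=> Hk kK.
  have lo : K%:R / 2 <= k.+1%:R :> R.
    by rewrite EK natrD -mulr2n -[H%:R *+ 2]mulr_natr mulfK ?pnatr_eq0// ler_nat ltnW.
  have hi : k.+1%:R <= 2 * K%:R :> R.
    by apply: (@le_trans _ _ K%:R); rewrite ?ler_nat// ler_peMl ?ler1n.
  by case/andP: (powR_weight (x * v) Kp lo hi).
rewrite -ler_pdivrMl ?mulr_gt0// invfM mulrACA; apply: le_trans h.
apply: (@le_trans _ _ (\sum_(H <= k < K) (2 `^ `|x * v|)^-1 * K%:R `^ (x * v))).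
  rewrite sumr_const_nat (_ : (K - H = H)%N); last by rewrite EK addnK.
  rewrite -[leRHS]mulr_natr.
  have -> : K%:R = H%:R * 2 :> R by rewrite EK natrD -mulr2n mulr_natr.
  apply: eq_ler; field; rewrite gt_eqF//.
rewrite -(big_mkord xpredT (fun k => (if (k < K)%N then k.+1%:R `^ (c + b) * (all1 k)%:R else 0) `^ v)).
rewrite [leRHS](@big_cat_nat _ _ _ H)//= ?EK ?leq_addr// -EK.
rewrite ler_wpDl ?sumr_ge0// => [*|]; first exact: powR_ge0.
rewrite big_nat [leRHS]big_nat; apply: ler_sum => k kk.
by rewrite (andP kk).2 mulr1 -powRrM; exact: half.
Qed.

End necessity.

Theorem lip_embeds_lz_iff (p al r : R) (q u : \bar R) (b xi : R)
  (p1 : 1 < p) (al0 : 0 < al) (alp : al < p^-1) (rE : r^-1 = p^-1 - al)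
  (q0 : (0 < q)%E) (u0 : (0 < u)%E) (hb : recip q < b) :
  (lip_embeds_lz p q al b r q (- b + xi) <-> xi <= recip (Order.max p%:E q)) /\
  (lip_embeds_lz p q al b r u (- b + recip q) <-> (Order.max p%:E q <= u)%E).
Proof.
have p0 : 0 < p by exact: lt_trans p1.
have mx0 : (0 < Order.max p%:E q)%E by rewrite lt_max q0 orbT.
split; split.
- move=> emb; have := necessity_recip p1 al0 alp rE q0 hb q0 emb.
  case: (leP p%:E q) => // qp _.
  case: q q0 hb qp emb {mx0} => [s||]// s0 hb' sp emb.
  rewrite lte_fin in s0; have := necessity_dense p1 al0 alp rE _ hb' s0 emb.
  by rewrite recipE// recipE// => /(_ s0); lra.
- exact: embeds_same.
- case: u u0 => [v||]// v0 emb; last by rewrite leey.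
  rewrite lte_fin in v0.
  have dense := necessity_dense p1 al0 alp rE q0 hb v0 emb.
  have pv : p <= v.
    rewrite -lef_pV2 ?posrE//; move: dense; lra.
  have := necessity_recip_log p1 al0 alp rE q0 hb v0 emb.
  rewrite ge_max lee_fin pv/=.
  case: q q0 {hb emb dense mx0} => [s||]// s0; last by rewrite recipy mulr0 ler10.
  by rewrite lte_fin in s0; rewrite recipE// ler_pdivlMr// mul1r lee_fin.
- exact: embeds_upper.
Qed.

End test_sequences.

Theorem theorem10p8 (R : realType) (p alpha r : R) (q u : \bar R) (b xi : R)
  (hp : 1 < p) (halpha0 : 0 < alpha) (halphap : alpha < 1 / p)
  (hr : alpha - 1 / p = - (1 / r))
  (hq : (0 < q)%E) (hu : (0 < u)%E) (hb : recip q < b) :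
  (lip_embeds_lz p q alpha b r q (- b + xi) <->
     xi <= recip (Order.max p%:E q)) /\
  (lip_embeds_lz p q alpha b r u (- b + recip q) <->
     (Order.max p%:E q <= u)%E).
Proof.
move: halphap hr; rewrite !div1r => halphap hr.
by apply: lip_embeds_lz_iff => //; rewrite -[LHS]opprK -hr opprB.
Qed.
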